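(* Let $p\neq2$ be a prime, $\alpha>0$, $m\in\mathbb{Q}_p^\times$ and $a,b\in\mathbb{C}$. The distribution $T\in\mathbf{S}'(\mathbb{Q}_p^4)$ determined by $$\mathcal{F}[T](k)=a\,\delta_+(Q(k)-m^2)+b\,\delta_-(Q(k)-m^2)$$ is a weak solution of $\square_{\alpha,m}T=0$ and is invariant under $\mathcal{L}_+^{\uparrow}$.
   Context: $\mathbf{S}(\mathbb{Q}_p^4)$ is the space of locally constant compactly supported complex functions, $\mathbf{S}'(\mathbb{Q}_p^4)$ the space of all linear functionals on it. For $x=(x_0,\boldsymbol{x}),y=(y_0,\boldsymbol{y})\in\mathbb{Q}_p\times\mathbb{Q}_p^3$: $[x,y]=x_0y_0-x_1y_1-x_2y_2-x_3y_3$, $Q(x)=[x,x]$. With $\chi_p(y)=\exp(2\pi i\{y\}_p)$ ($\{y\}_p$ the fractional part), $\mathcal{F}[\varphi](k)=\int_{\mathbb{Q}_p^4}\chi_p([x,k])\varphi(x)\,d^4x$ ($d^4x$ normalized Haar measure), extended to distributions by $(\mathcal{F}T,\varphi)=(T,\mathcal{F}\varphi)$. Positivity: $a=p^{ord(a)}ac(a)\in\mathbb{Q}_p^\times$, $|ac(a)|_p=1$, is called positive ($a>0$) if the reduction of $ac(a)$ mod $p$ lies in $\{1,\dots,\frac{p-1}{2}\}$, and negative ($a<0$) otherwise. $V_{m^2}=\{k\in\mathbb{Q}_p^4:Q(k)=m^2\}$, $V_{m^2}^{\pm}=\{(k_0,\boldsymbol{k})\in V_{m^2}:\pm k_0>0\}$.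 $d\lambda_{m^2}$ is the measure on $V_{m^2}$ induced by the Gel'fand–Leray form, i.e. by the restriction to $V_{m^2}$ of any analytic $3$-form $\lambda$ with $dk_0\wedge dk_1\wedge dk_2\wedge dk_3=dQ\wedge\lambda$; on a piece of $V_{m^2}$ where $\partial Q/\partial k_l\neq0$ and $k_l$ is an analytic function of the other coordinates, it is the normalized Haar measure in the other three coordinates divided by $|\partial Q/\partial k_l|_p$. $(\delta_\pm(Q(k)-m^2),\varphi)=\int_{V_{m^2}^\pm}\varphi\,d\lambda_{m^2}$. $SO(Q)=\{\Lambda\in GL_4(\mathbb{Q}_p):[\Lambda x,\Lambda y]=[x,y]\ \forall x,y,\ \det\Lambda=1\}$, and $\mathcal{L}_+^{\uparrow}$ is the largest subgroup of $SO(Q)$ with $\mathcal{L}_+^\uparrow(V_{m^2}^{\pm})=V_{m^2}^{\pm}$ (for both signs). For $\Lambda\in GL_4(\mathbb{Q}_p)$: $(\Lambda\varphi)(x)=\varphi(\Lambda^{-1}x)$, $(\Lambda T,\varphi)=(T,\Lambda^{-1}\varphi)$; $T$ is invariant under a group $G_0$ if $\Lambda T=T$ for all $\Lambda\in G_0$. Product of distributions: with $\delta_j(x)=p^{4j}\Omega(p^j\|x\|_p)$, $\Omega$ the characteristic function of $[0,1]$, $\|x\|_p=\max_i|x_i|_p$, $(TS,\varphi)=\lim_{j\to+\infty}(S,(T*\delta_j)\varphi)$ if the limit exists for all $\varphi\in\mathbf{S}(\mathbb{Q}_p^4)$. $\square_{\alpha,m}T=\mathcal{F}^{-1}[|[k,k]-m^2|_p^\alpha\mathcal{F}T]$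 is defined on the space $\mathcal{E}_{Q,m}$ of $T\in\mathbf{S}'(\mathbb{Q}_p^4)$ for which the product $|[k,k]-m^2|_p^\alpha\mathcal{F}T$ exists. A weak solution of $\square_{\alpha,m}T=S$ is a $T\in\mathcal{E}_{Q,m}$ satisfying this equality. *)

(* Defs.v *)
From HB Require Import structures.
From mathcomp Require Import all_boot all_order all_algebra.
From mathcomp Require Import all_classical all_reals all_analysis.
From mathcomp Require Import zify.
From mathcomp Require Import generic_quotient fraction complex.

Set Implicit Arguments.
Unset Strict Implicit.
Unset Printing Implicit Defensive.

Import Order.TTheory GRing.Theory Num.Theory.
Import numFieldNormedType.Exports.

Local Open Scope classical_set_scope.
Local Open Scope ring_scope.
Local Open Scope quotient_scope.

(* Z_p as the inverse limit of the Z/p^n: x n is the residue of x mod p^n,    *)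
(* represented by a natural number below p^n.                                 *)
Section PadicInt.
Variables (p : nat) (p_pr : prime p).
Local Open Scope nat_scope.

Definition coherent (x : nat -> nat) := forall n, x n = x n.+1 %% p ^ n.

Definition padic_int of prime p := {x : nat -> nat | `[< coherent x >]}.
Local Notation Zp := (padic_int p_pr).

HB.instance Definition _ := SubType.on Zp.
HB.instance Definition _ := [Choice of Zp by <:].

Definition residue (x : Zp) : nat -> nat := val x.

Let pX_gt0 n : 0 < p ^ n. Proof. by rewrite expn_gt0 prime_gt0. Qed.

Lemma residueS x n : residue x n.+1 %% p ^ n = residue x n.
Proof. by have /asboolP-/(_ n) := valP x. Qed.

Lemma residue_lt x n : residue x n < p ^ n.
Proof. by rewrite -residueS ltn_mod. Qed.

Lemma residue_mod x n : residue x n %% p ^ n = residue x n.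
Proof. by rewrite modn_small // residue_lt. Qed.

Lemma residue_le x m n : m <= n -> residue x n %% p ^ m = residue x m.
Proof.
move=> /subnK <-; elim: (n - m) => [|k IH]; first exact: residue_mod.
by rewrite -IH -[in RHS]residueS modn_dvdm // dvdn_exp2l // leq_addl.
Qed.

Lemma padic_int_ext x y : (forall n, residue x n = residue y n) -> x = y.
Proof. by move=> xy; apply: val_inj; apply/funext. Qed.

Lemma coherent_mod (f : nat -> nat) :
  (forall n, f n.+1 = f n %[mod p ^ n]) ->
  `[< coherent (fun n => f n %% p ^ n) >].
Proof.
move=> H; apply/asboolP => n.
by rewrite modn_dvdm ?dvdn_exp2l.
Qed.

Definition mk_padic_int f H : Zp :=
  Sub (fun n => f n %% p ^ n) (@coherent_mod f H).

Lemma add_subproof x y n :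
  residue x n.+1 + residue y n.+1 = residue x n + residue y n %[mod p ^ n].
Proof. by rewrite -modnDm !residueS. Qed.

Lemma mul_subproof x y n :
  residue x n.+1 * residue y n.+1 = residue x n * residue y n %[mod p ^ n].
Proof. by rewrite -modnMm !residueS. Qed.

Lemma opp_subproof x n :
  p ^ n.+1 - residue x n.+1 = p ^ n - residue x n %[mod p ^ n].
Proof.
apply/eqP; rewrite -(eqn_modDr (residue x n.+1)) subnK ?(ltnW (residue_lt _ _))//.
rewrite -[X in _ == X]modnDmr residueS subnK ?(ltnW (residue_lt _ _))//.
by rewrite modnn expnS modnMl.
Qed.

Lemma nat_subproof k n : k = k %[mod p ^ n]. Proof. by []. Qed.

Definition padd x y := mk_padic_int (add_subproof x y).
Definition pmul x y := mk_padic_int (mul_subproof x y).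
Definition popp x := mk_padic_int (opp_subproof x).
Definition pnat k := mk_padic_int (nat_subproof k).

Let paddE x y n : residue (padd x y) n = (residue x n + residue y n) %% p ^ n.
Proof. by []. Qed.
Let pmulE x y n : residue (pmul x y) n = (residue x n * residue y n) %% p ^ n.
Proof. by []. Qed.
Let poppE x n : residue (popp x) n = (p ^ n - residue x n) %% p ^ n.
Proof. by []. Qed.
Let pnatE k n : residue (pnat k) n = k %% p ^ n.
Proof. by []. Qed.
Let opE := (paddE, pmulE, poppE, pnatE).

Lemma paddA : associative padd.
Proof. by move=> x y z; apply: padic_int_ext => n; rewrite !opE modnDml modnDmr addnA. Qed.

Lemma paddC : commutative padd.
Proof. by move=> x y; apply: padic_int_ext => n; rewrite !opE addnC. Qed.

Lemma padd0 : left_id (pnat 0) padd.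
Proof. by move=> x; apply: padic_int_ext => n; rewrite !opE mod0n add0n residue_mod. Qed.

Lemma paddN : left_inverse (pnat 0) popp padd.
Proof.
move=> x; apply: padic_int_ext => n; rewrite !opE.
by rewrite modnDml subnK ?(ltnW (residue_lt _ _))// modnn mod0n.
Qed.

Lemma pmulA : associative pmul.
Proof. by move=> x y z; apply: padic_int_ext => n; rewrite !opE modnMml modnMmr mulnA. Qed.

Lemma pmulC : commutative pmul.
Proof. by move=> x y; apply: padic_int_ext => n; rewrite !opE mulnC. Qed.

Lemma pmul1 : left_id (pnat 1) pmul.
Proof. by move=> x; apply: padic_int_ext => n; rewrite !opE modnMml mul1n residue_mod. Qed.

Lemma pmulD : left_distributive pmul padd.
Proof.
move=> x y z; apply: padic_int_ext => n; rewrite !opE.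
by rewrite modnMml modnDml modnDmr mulnDl.
Qed.

Lemma pone_neq0 : pnat 1 != pnat 0.
Proof.
apply/eqP => /(congr1 (fun x => residue x 1)); rewrite !opE.
by rewrite expn1 mod0n modn_small ?prime_gt1.
Qed.

HB.instance Definition _ :=
  GRing.isZmodule.Build Zp paddA paddC padd0 paddN.
HB.instance Definition _ :=
  GRing.Zmodule_isComNzRing.Build Zp pmulA pmulC pmul1 pmulD pone_neq0.

Definition punit : pred Zp := fun x => `[< exists y, (y * x = 1)%R >].
Definition pinv (x : Zp) : Zp := xget x [set y | (y * x = 1)%R].

Lemma pmulV : {in punit, left_inverse 1%R pinv *%R}.
Proof. by move=> x /asboolP[y yx]; rewrite /pinv; case: xgetP => // /(_ y). Qed.

Lemma punitP x y : (y * x = 1)%R -> punit x.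
Proof. by move=> yx; apply/asboolP; exists y. Qed.

Lemma pinv_out : {in [predC punit], pinv =1 id}.
Proof.
move=> x; rewrite inE /= => /asboolP nx; rewrite /pinv; case: xgetP => // y _ yx.
by exfalso; apply: nx; exists y.
Qed.

HB.instance Definition _ :=
  GRing.ComNzRing_hasMulInverse.Build Zp pmulV punitP pinv_out.

Lemma residueD x y n : residue (x + y)%R n = (residue x n + residue y n) %% p ^ n.
Proof. by []. Qed.

Lemma residueM x y n : residue (x * y)%R n = (residue x n * residue y n) %% p ^ n.
Proof. by []. Qed.

Lemma residue0 n : residue 0%R n = 0.
Proof. exact: mod0n. Qed.

Lemma padic_int_neq0 x : x != 0%R -> exists n, residue x n != 0.
Proof.
move=> x0; apply: contrapT => H; move/negP: x0; apply; apply/eqP.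
apply: padic_int_ext => n; rewrite residue0; apply/eqP/negPn/negP => xn.
by apply: H; exists n.
Qed.

(* the exponent of p in x (0 if x = 0) *)
Definition zord (x : Zp) : nat :=
  if pselect (exists n, residue x n != 0) is left ex then (ex_minn ex).-1 else 0.

Lemma zordP x : x != 0%R -> forall N, zord x < N ->
  0 < residue x N /\ logn p (residue x N) = zord x.
Proof.
move=> x0 N; rewrite /zord; case: pselect => [ex|]; last first.
  by have := padic_int_neq0 x0.
case: ex_minnP => -[|m] xm min_m.
  by have := residue_lt x 0; rewrite expn0 ltnS leqn0 (negbTE xm).
rewrite /= => mN.
have xm0 : residue x m = 0.
  by apply/eqP/negPn/negP => /min_m; rewrite ltnn.
have xN0 : 0 < residue x N.
  rewrite lt0n; apply: contra xm => /eqP xN.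
  by rewrite -(residue_le x mN) xN mod0n.
split=> //; apply/eqP; rewrite eqn_leq; apply/andP; split.
  rewrite leqNgt; apply: contra xm; rewrite -pfactor_dvdn// => /eqP.
  by rewrite residue_le// => ->.
by rewrite -pfactor_dvdn// /dvdn residue_le ?(ltnW mN)// xm0.
Qed.

Lemma logn_modX k N : 0 < k -> logn p k < N ->
  0 < k %% p ^ N /\ logn p (k %% p ^ N) = logn p k.
Proof.
move=> k0 kN.
have r0 : 0 < k %% p ^ N.
  by rewrite lt0n; apply: contraL kN => kN0; rewrite -leqNgt -pfactor_dvdn.
split=> //; apply/eqP; rewrite eqn_leq.
have D j : j <= N -> (p ^ j %| k %% p ^ N) = (p ^ j %| k).
  by move=> jN; rewrite /dvdn modn_dvdm// dvdn_exp2l.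
apply/andP; split.
  by rewrite leqNgt -pfactor_dvdn// D// pfactor_dvdn// ltnn.
by rewrite -pfactor_dvdn// D ?(ltnW kN)// pfactor_dvdn.
Qed.

Lemma zordM_neq0 x y : x != 0%R -> y != 0%R ->
  (x * y)%R != 0%R /\ zord (x * y)%R = zord x + zord y.
Proof.
move=> x0 y0; set N := (zord x + zord y).+1.
have [xN0 xN] : 0 < residue x N /\ logn p (residue x N) = zord x.
  by apply: zordP; rewrite // ltnS leq_addr.
have [yN0 yN] : 0 < residue y N /\ logn p (residue y N) = zord y.
  by apply: zordP; rewrite // ltnS leq_addl.
have M M' : N <= M' -> logn p (residue x M' * residue y M') < M'.
  move=> NM; rewrite lognM; last 2 first.
  - by case: (zordP x0 (leq_trans (_ : zord x < N) NM)); rewrite // ltnS leq_addr.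
  - by case: (zordP y0 (leq_trans (_ : zord y < N) NM)); rewrite // ltnS leq_addl.
  case: (zordP x0 (leq_trans (_ : zord x < N) NM)); rewrite ?ltnS ?leq_addr// => _ ->.
  by case: (zordP y0 (leq_trans (_ : zord y < N) NM)); rewrite ?ltnS ?leq_addl// => _ ->.
have xy0 : (x * y)%R != 0%R.
  apply/eqP => /(congr1 (residue ^~ N)); rewrite residueM residue0 => e.
  have [] := logn_modX (_ : 0 < residue x N * residue y N) (M _ (leqnn _)).
    by rewrite muln_gt0 xN0.
  by rewrite e.
split=> //.
have hz : zord (x * y)%R < (maxn N (zord (x * y)%R).+1) by rewrite leq_max leqnn orbT.
set K := maxn _ _ in hz.
have NK : N <= K by rewrite leq_max leqnn.
have [xK0 xK] : 0 < residue x K /\ logn p (residue x K) = zord x.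
  by apply: zordP; rewrite // (leq_trans _ NK)// ltnS leq_addr.
have [yK0 yK] : 0 < residue y K /\ logn p (residue y K) = zord y.
  by apply: zordP; rewrite // (leq_trans _ NK)// ltnS leq_addl.
have [_ <-] := zordP xy0 hz.
rewrite residueM; have [] := logn_modX (_ : 0 < residue x K * residue y K) (M _ NK).
  by rewrite muln_gt0 xK0.
by move=> _ ->; rewrite lognM// xK yK.
Qed.

Lemma padic_int_mulf_eq0 (x y : Zp) : (x * y = 0 -> (x == 0) || (y == 0))%R.
Proof.
move=> xy; apply/negPn; rewrite negb_or; apply/negP => /andP[x0 y0].
by have [] := zordM_neq0 x0 y0; rewrite xy eqxx.
Qed.

HB.instance Definition _ :=
  GRing.ComUnitRing_isIntegral.Build Zp padic_int_mulf_eq0.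

Lemma zordD x y : (x + y)%R != 0%R -> x != 0%R -> y != 0%R ->
  minn (zord x) (zord y) <= zord (x + y)%R.
Proof.
move=> xy0 x0 y0; set N := (maxn (zord (x + y)%R) (maxn (zord x) (zord y))).+1.
have [sN0 sN] : 0 < residue (x + y)%R N /\
    logn p (residue (x + y)%R N) = zord (x + y)%R.
  by apply: zordP; rewrite // ltnS leq_maxl.
have [xN0 xN] : 0 < residue x N /\ logn p (residue x N) = zord x.
  by apply: zordP; rewrite // ltnS !leq_max leqnn orbT.
have [yN0 yN] : 0 < residue y N /\ logn p (residue y N) = zord y.
  by apply: zordP; rewrite // ltnS !leq_max leqnn !orbT.
rewrite -sN -pfactor_dvdn// residueD /dvdn modn_dvdm; last first.
  by rewrite dvdn_exp2l// ltnW// ltnS leq_max !geq_min !leq_max leqnn !orbT.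
rewrite -/(dvdn _ _) dvdn_add// pfactor_dvdn//.
  by rewrite xN geq_minl.
by rewrite yN geq_minr.
Qed.

End PadicInt.

Definition padic (p : nat) (p_pr : prime p) := {fraction (padic_int p_pr)}.

Section Padic.
Variables (p : nat) (p_pr : prime p).
Local Notation K := (padic p_pr).
Local Notation Zp := (padic_int p_pr).
Implicit Types x y : K.

HB.instance Definition _ := GRing.Field.on K.
HB.instance Definition _ := isPointed.Build K 0.

Definition padic_num x : Zp := (frac (repr x)).1.
Definition padic_den x : Zp := (frac (repr x)).2.

(* ord_p (u / v) = ord_p u - ord_p v; the value at 0 is irrelevant *)
Definition padic_ord x : int := (zord (padic_num x))%:Z - (zord (padic_den x))%:Z.

(* |x|_p = p^(- ord_p x) *)
Definition padic_norm x : rat :=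
  if x == 0 then 0 else p%:R ^ (- padic_ord x).

Definition padic_ac x : K := x * p%:R ^ (- padic_ord x).

Lemma padic_den_neq0 x : padic_den x != 0.
Proof. exact: denom_ratioP. Qed.

Lemma padicE x : x = tofrac (padic_num x) / tofrac (padic_den x).
Proof.
have d0 : tofrac (padic_den x) != 0 by rewrite tofrac_eq0 padic_den_neq0.
apply: (mulIf d0); rewrite mulfVK// -[X in X * _]reprK.
set t := padic_den x; set u := padic_num x.
rewrite [LHS](_ : _ = FracField.mul (\pi_(FracField.type Zp) (repr x)) (tofrac t))//.
rewrite !piE; apply/eqmodP => /=; rewrite FracField.equivfE /FracField.mulf.
by rewrite !numden_Ratio ?mulf_neq0 ?denom_ratioP ?oner_eq0 // ?mulr1 mulrC.
Qed.

Lemma padic_num_eq0 x : (padic_num x == 0) = (x == 0).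
Proof.
rewrite [in RHS](padicE x) mulf_eq0 invr_eq0 !tofrac_eq0.
by rewrite (negbTE (padic_den_neq0 x)) orbF.
Qed.

Lemma padic_ord_frac (u v : Zp) : u != 0 -> v != 0 ->
  padic_ord (tofrac u / tofrac v) = (zord u)%:Z - (zord v)%:Z.
Proof.
move=> u0 v0; set x : K := _ / _.
have x0 : x != 0 by rewrite mulf_neq0 ?invr_eq0 ?tofrac_eq0.
have e : u * padic_den x = padic_num x * v.
  apply/eqP; rewrite -tofrac_eq !tofracM.
  by rewrite -eqr_div ?tofrac_eq0 ?padic_den_neq0// -padicE.
have [_] := zordM_neq0 u0 (padic_den_neq0 x).
have nx0 : padic_num x != 0 by rewrite padic_num_eq0.
have [_] := zordM_neq0 nx0 v0.
rewrite -e => -> /eqP; rewrite /padic_ord => E.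
by apply/eqP; rewrite subr_eq addrAC eq_sym subr_eq -!PoszD eq_sym eqz_nat.
Qed.

Lemma padic_ordM x y : x != 0 -> y != 0 ->
  padic_ord (x * y) = padic_ord x + padic_ord y.
Proof.
move=> x0 y0.
have nx : padic_num x != 0 by rewrite padic_num_eq0.
have ny : padic_num y != 0 by rewrite padic_num_eq0.
have [nn nne] := zordM_neq0 nx ny.
have [dd dde] := zordM_neq0 (padic_den_neq0 x) (padic_den_neq0 y).
rewrite [in LHS](padicE x) [in LHS](padicE y) mulf_div -!tofracM.
by rewrite padic_ord_frac// nne dde !PoszD opprD addrACA.
Qed.

Let p_gt0 : 0 < p%:R :> rat. Proof. by rewrite ltr0n prime_gt0. Qed.
Let p_ge1 : 1 <= p%:R :> rat. Proof. by rewrite ler1n prime_gt0. Qed.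
Let p_neq0 : p%:R != 0 :> rat. Proof. by rewrite gt_eqF. Qed.

Lemma padic_norm0 : padic_norm 0 = 0. Proof. by rewrite /padic_norm eqxx. Qed.

Lemma padic_norm_eq0 x : (padic_norm x == 0) = (x == 0).
Proof.
rewrite /padic_norm; have [_|x0] := eqVneq x 0; first by rewrite eqxx.
by rewrite expfz_eq0 (negbTE p_neq0) andbF.
Qed.

Lemma padic_norm_ge0 x : 0 <= padic_norm x.
Proof. by rewrite /padic_norm; case: ifP => // _; rewrite exprz_ge0 ?ltW. Qed.

Lemma padic_normM x y : padic_norm (x * y) = padic_norm x * padic_norm y.
Proof.
rewrite /padic_norm mulf_eq0.
have [_|x0] := eqVneq x 0; first by rewrite mul0r.
have [_|y0] := eqVneq y 0; first by rewrite mulr0.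
by rewrite /= padic_ordM// opprD expfzDr.
Qed.

Lemma padic_norm1 : padic_norm 1 = 1.
Proof.
have := padic_normM 1 1; rewrite mulr1 => /eqP.
rewrite -subr_eq0 -{1}[padic_norm 1]mulr1 -mulrBr mulf_eq0.
by rewrite padic_norm_eq0 oner_eq0 /= subr_eq0 => /eqP.
Qed.

Lemma padic_normN x : padic_norm (- x) = padic_norm x.
Proof.
rewrite -mulN1r padic_normM; apply/eqP.
have /eqP : padic_norm (-1) ^+ 2 = 1.
  by rewrite expr2 -padic_normM mulrNN mulr1 padic_norm1.
rewrite sqrf_eq1 => /orP[/eqP->|/eqP h]; first by rewrite mul1r.
by have := padic_norm_ge0 (-1); rewrite h.
Qed.

Lemma padic_ordD x y : x != 0 -> y != 0 -> x + y != 0 ->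
  Num.min (padic_ord x) (padic_ord y) <= padic_ord (x + y).
Proof.
move=> x0 y0 xy0.
have nx : padic_num x != 0 by rewrite padic_num_eq0.
have ny : padic_num y != 0 by rewrite padic_num_eq0.
have dx := padic_den_neq0 x; have dy := padic_den_neq0 y.
have dxF : tofrac (padic_den x) != 0 by rewrite tofrac_eq0.
have dyF : tofrac (padic_den y) != 0 by rewrite tofrac_eq0.
have E : x + y = tofrac (padic_num x * padic_den y + padic_num y * padic_den x) /
                 tofrac (padic_den x * padic_den y).
  by rewrite tofracD !tofracM -(addf_div _ _ dxF dyF) -!padicE.
have s0 : padic_num x * padic_den y + padic_num y * padic_den x != 0.
  by apply: contra xy0 => /eqP s; rewrite E s tofrac0 mul0r.
have [dd dde] := zordM_neq0 dx dy.
have [m1 m1e] := zordM_neq0 nx dy; have [m2 m2e] := zordM_neq0 ny dx.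
have := zordD s0 m1 m2; rewrite E padic_ord_frac// m1e m2e dde /padic_ord.
move: (zord _) (zord _) (zord _) (zord _) (zord _) => a b c d e; clear.
rewrite geq_min ge_min !PoszD => /orP[|] h; apply/orP; [left|right]; move: h; lia.
Qed.

Lemma padic_normD x y :
  padic_norm (x + y) <= Num.max (padic_norm x) (padic_norm y).
Proof.
have [->|x0] := eqVneq x 0.
  by rewrite add0r le_max lexx orbT.
have [->|y0] := eqVneq y 0.
  by rewrite addr0 le_max lexx.
have [->|xy0] := eqVneq (x + y) 0.
  by rewrite padic_norm0 le_max padic_norm_ge0.
have := padic_ordD x0 y0 xy0.
rewrite /padic_norm (negbTE x0) (negbTE y0) (negbTE xy0) ge_min le_max.
by move=> /orP[|] h; apply/orP; [left|right]; rewrite ler_weXz2l// lerN2.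
Qed.

Definition padic_dist x y : rat := padic_norm (x - y).

Let distxx x : padic_dist x x = 0.
Proof. by rewrite /padic_dist subrr padic_norm0. Qed.

Let dist_pos x y : padic_dist x y = 0 -> x = y.
Proof. by move=> /eqP; rewrite padic_norm_eq0 subr_eq0 => /eqP. Qed.

Let dist_sym x y : padic_dist x y = padic_dist y x.
Proof. by rewrite /padic_dist -padic_normN opprB. Qed.

Let dist_tri y x z : padic_dist x z <= padic_dist x y + padic_dist y z.
Proof.
rewrite /padic_dist -[x - z](subrKA y).
apply: (le_trans (padic_normD _ _)).
by rewrite ge_max lerDl lerDr !padic_norm_ge0.
Qed.

HB.instance Definition _ :=
  isMetric.Build rat K distxx dist_pos dist_sym dist_tri.

(* {x}_p, the unique element of Z[1/p] in [0, 1[ congruent to x modulo Z_p *)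
Definition padic_frac_part x : rat :=
  xget 0 [set r : rat | [/\ 0 <= r < 1, (exists n, r * p%:R ^+ n \is a Num.int)
                          & padic_norm (x - ratr r) <= 1]].

Definition padic_positive x : Prop :=
  x != 0 /\ exists2 j : nat, (1 <= j <= p.-1./2)%N & padic_norm (padic_ac x - j%:R) < 1.

End Padic.

Section Vectors.
Variables (p : nat) (p_pr : prime p) (n : nat).
Local Notation K := (padic p_pr).

Definition padic_borel := g_sigma_algebraType (@open 'cV[K]_n).

Definition vnorm (x : 'cV[K]_n) : rat := \big[Num.max/0]_(i < n) padic_norm (x i 0).

Definition normalized_haar (R : realType)
    (mu : {measure set padic_borel -> \bar R}) : Prop :=
  (forall (a : 'cV[K]_n) (A : set padic_borel), measurable A ->
     mu [set a + x | x in (A : set 'cV[K]_n)] = mu A) /\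
  mu [set x : 'cV[K]_n | vnorm x <= 1] = 1%E.

(* The bound on |c i| r^|i| makes the power series absolutely convergent on   *)
(* the polydisc vnorm h < r, so that its sum may be computed over boxes.      *)
Definition analytic_at (g : 'cV[K]_n -> K) (y : 'cV[K]_n) : Prop :=
  exists (c : {ffun 'I_n -> nat} -> K) (r M : rat),
  [/\ 0 < r,
      forall i : {ffun 'I_n -> nat}, padic_norm (c i) * r ^+ (\sum_j i j)%N <= M &
      forall h : 'cV[K]_n, vnorm h < r ->
        (fun N : nat => \sum_(i : {ffun 'I_n -> 'I_N})
           c [ffun j => i j : nat] * \prod_j h j 0 ^+ i j) @ \oo --> g (y + h)].

End Vectors.

Section ComplexValued.
Variable R : realType.
Local Notation C := R[i].

Definition Cintegral d (T : measurableType d) (mu : {measure set T -> \bar R})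
    (D : set T) (f : T -> C) : C :=
  ((\int[mu]_(x in D) complex.Re (f x)) +i*
   (\int[mu]_(x in D) complex.Im (f x)))%C.

Variables (p : nat) (p_pr : prime p).
Local Notation K := (padic p_pr).

Definition padic_char (x : K) : C :=
  let t := 2 * trigo.pi * ratr (padic_frac_part x) in (cos t +i* sin t)%C.

Variable n : nat.

Definition test_pred : {pred 'cV[K]_n -> C^o} := fun f =>
  `[< (forall x, \forall y \near x, f y = f x) /\
      compact (closure [set x | f x != 0]) >].

Lemma test_pred_submod_closed : submod_closed test_pred.
Proof.
split=> [|a f g /asboolP[lf cf] /asboolP[lg cg]]; apply/asboolP; split.
- by move=> x; apply: filterE.
- rewrite [X in closure X](_ : _ = set0) ?closure0; first exact: compact0.
  by apply/seteqP; split=> x //=; rewrite eqxx.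
- move=> x; near=> y; have fy : f y = f x by near: y; exact: lf.
  have gy : g y = g x by near: y; exact: lg.
  by rewrite !fctE fy gy.
- apply: (subclosed_compact _ (compactU cf cg)); first exact: closed_closure.
  rewrite -closureU; apply: closure_subset => x /=; apply: contraPP.
  move=> /not_orP[/negP/negPn/eqP fx /negP/negPn/eqP gx].
  by rewrite !fctE fx gx scaler0 addr0 eqxx.
Unshelve. all: by end_near. Qed.

HB.instance Definition _ :=
  GRing.isSubmodClosed.Build C ('cV[K]_n -> C^o) test_pred test_pred_submod_closed.

(* S(Q_p^n), as a C-vector space *)
Definition test_fun := {f : 'cV[K]_n -> C^o | f \in test_pred}.

HB.instance Definition _ := SubType.on test_fun.
HB.instance Definition _ := [Choice of test_fun by <:].
HB.instance Definition _ := [SubChoice_isSubLmodule of test_fun by <:].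

Definition test_val (phi : test_fun) : 'cV[K]_n -> C := val phi.

(* f seen as a test function; 0 if f is not one. Fourier transforms, linear   *)
(* changes of variables and regularized products of test functions are test   *)
(* functions, so the default value is never used below.                       *)
Definition to_test (f : 'cV[K]_n -> C) : test_fun := insubd 0 (f : _ -> C^o).

End ComplexValued.

Section Minkowski.
Variables (p : nat) (p_pr : prime p).
Local Notation K := (padic p_pr).
Implicit Types (x k : 'cV[K]_4) (m : K) (L : 'M[K]_4).

Definition bracket x (y : 'cV[K]_4) : K :=
  x 0 0 * y 0 0 - \sum_(i < 3) x (lift ord0 i) 0 * y (lift ord0 i) 0.

Definition Qform x : K := bracket x x.

(* the partial derivative of Qform in the l-th coordinate *)
Definition dQform (l : 'I_4) k : K :=
  if l == ord0 then 2 * k l 0 else - (2 * k l 0).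

Definition hyperboloid m : set 'cV[K]_4 := [set k | Qform k = m ^+ 2].

(* the sheet V^+ for s = false, and V^- for s = true *)
Definition sheet m (s : bool) : set 'cV[K]_4 :=
  [set k | hyperboloid m k /\ padic_positive ((-1) ^+ s * k 0 0)].

Definition SO_Q : set 'M[K]_4 :=
  [set L | [/\ L \in unitmx, forall x y, bracket (L *m x) (L *m y) = bracket x y
             & \det L = 1]].

Definition matrix_subgroup (G : set 'M[K]_4) : Prop :=
  [/\ G 1%:M, forall L L', G L -> G L' -> G (L *m L')
    & forall L, G L -> L \in unitmx /\ G (invmx L)].

Definition sheet_preserving_subgroup m (G : set 'M[K]_4) : Prop :=
  [/\ matrix_subgroup G, G `<=` SO_Q
    & forall L s, G L -> [set L *m k | k in sheet m s] = sheet m s].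

Definition restricted_lorentz_group m (G : set 'M[K]_4) : Prop :=
  sheet_preserving_subgroup m G /\
  forall H, sheet_preserving_subgroup m H -> H `<=` G.

(* the point of K^4 whose l-th coordinate is t and whose other coordinates    *)
(* are, in order, those of y                                                  *)
Definition insert_coord (l : 'I_4) (y : 'cV[K]_3) (t : K) : 'cV[K]_4 :=
  \col_i (if unlift l i is Some j then y j 0 else t).

Variable R : realType.
Local Notation C := R[i].

(* The measure induced by the Gel'fand-Leray form on V_{m^2}, as a Borel      *)
(* measure on K^4 carried by V_{m^2}; mu3 stands for the Haar measure of K^3. *)
(* For m != 0 and p != 2 the gradient of Qform does not vanish on V_{m^2}, so *)
(* that the analytic charts below cover V_{m^2} and lam is unique.            *)
Definition gelfand_leray (mu3 : {measure set (padic_borel p_pr 3) -> \bar R}) m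
    (lam : {measure set (padic_borel p_pr 4) -> \bar R}) : Prop :=
  lam (~` hyperboloid m) = 0%E /\
  forall (l : 'I_4) (U : set 'cV[K]_3) (g : 'cV[K]_3 -> K),
    open U ->
    (forall y : 'cV_3, U y -> analytic_at g y) ->
    (forall y : 'cV_3, U y -> hyperboloid m (insert_coord l y (g y)) /\
                      dQform l (insert_coord l y (g y)) != 0) ->
    lam [set insert_coord l y (g y) | y in (U : set 'cV[K]_3)] =
    (\int[mu3]_(y in (U : set (padic_borel p_pr 3)))
       (ratr (padic_norm (dQform l (insert_coord l y (g y))))^-1)%:E)%E.

(* Distributions are the linear functionals test_fun -> C; the operations     *)
(* below are written for arbitrary functionals.                               *)
Local Notation S4 := (test_fun R p_pr 4).
Local Notation functional := (S4 -> C^o).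
Implicit Types (phi : S4) (T P : functional).

Variable mu4 : {measure set (padic_borel p_pr 4) -> \bar R}.

Definition fourier phi : 'cV[K]_4 -> C := fun k =>
  Cintegral mu4 setT (fun x => padic_char R (bracket x k) * test_val phi x).

Definition fourier_dist T : functional := fun phi => T (to_test (fourier phi)).

Definition regular_dist (f : 'cV[K]_4 -> C) : functional := fun phi =>
  Cintegral mu4 setT (fun x => f x * test_val phi x).

Definition delta_j (j : nat) x : C :=
  if p%:R ^+ j * vnorm x <= 1 then (p ^ (4 * j))%:R else 0.

(* (T * delta_j)(x) = (T, delta_j(x - .)) *)
Definition conv_delta T j x : C := T (to_test (fun y : 'cV[K]_4 => delta_j j (x - y))).

(* P is the product T S' *)
Definition dist_product T S' P : Prop := forall phi,
  (fun j : nat => S' (to_test (fun x => conv_delta T j x * test_val phi x)))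
    @ \oo --> P phi.

Definition box_symbol (alpha : R) m : functional :=
  regular_dist (fun k => ((ratr (padic_norm (bracket k k - m ^+ 2))) `^ alpha)%:C%C).

Definition box_domain alpha m : set functional :=
  [set T | linear T /\ exists P, dist_product (box_symbol alpha m) (fourier_dist T) P].

(* S' = F^-1 P is expressed as F S' = P *)
Definition box_eq alpha m T S' : Prop :=
  linear S' /\
  exists2 P, dist_product (box_symbol alpha m) (fourier_dist T) P & fourier_dist S' = P.

Definition weak_solution alpha m T S' : Prop :=
  box_domain alpha m T /\ box_eq alpha m T S'.

Definition delta_sheet (lam : {measure set (padic_borel p_pr 4) -> \bar R})
    m (s : bool) : functional := fun phi =>
  Cintegral lam (sheet m s) (test_val phi).

Definition act_test L phi : S4 := to_test (fun x => test_val phi (invmx L *m x)).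

Definition act_dist L T : functional := fun phi => T (act_test (invmx L) phi).

Definition invariant_under (G : set 'M[K]_4) T : Prop :=
  forall L, G L -> act_dist L T = T.

End Minkowski.

(* Main.v *)
(* Near a point z of the hyperboloid V = {Q = m^2} one of the coordinates has |z_l| = ||z|| = p^e,
   and since p is odd it is an analytic function (a square root) of the other three. Hence the
   Gel'fand-Leray measure of a ball of radius p^-M < p^e centred at z is p^(-3M-e), and comparing
   ball by ball with the Haar measure gives lam(A) = p^n mu(A n {|Q - m^2| <= p^-n}) for every union
   A of balls of a fixed radius and all large n.
   - Weak equation: on V, within a bounded set, |Q - m^2|^alpha regularized at scale p^-j is
     O(p^(-j alpha)), and lam is finite on bounded sets, so the product with delta_+ and delta_- is 0.
   - Invariance: a linear map L scales mu by a constant kappa; if L preserves Q, it scales lam by the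
     same kappa, by the formula above. An indicator of a ball is a Fourier transform of an explicit
     wave packet, which reduces the invariance of T to that of its Fourier transform. *)
Require Import Defs.
From HB Require Import structures.
From mathcomp Require Import all_boot all_order all_algebra.
From mathcomp Require Import all_classical all_reals all_analysis.
From mathcomp Require Import zify lra ring.
From mathcomp Require Import fraction complex.
From mathcomp Require mpoly.
From mathcomp Require Import measurable_realfun.
Set Implicit Arguments.
Unset Strict Implicit.
Unset Printing Implicit Defensive.
Import Order.TTheory GRing.Theory Num.Theory.
Import numFieldNormedType.Exports.
Local Open Scope classical_set_scope.
Local Open Scope ring_scope.

(** * The p-adic absolute value *)

(** The Gel'fand-Leray measure is prescribed only on graphs of functions that are sums of power
    series over boxes of exponents. The square root must therefore be produced as an actual power
    series: Newton's iteration on polynomials, controlled by a Gauss norm, gives its coefficients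
    together with their bounds. A linear map preserving [Q] need not send a graph over three of the
    coordinates to a graph over the same ones, so charts are hard to compare directly. The thickened
    formula expresses [lam] through [mu4] and [Q] alone, and both behave simply under such a map.
    Its normalization comes from the scale [M = n + e]: there [Q] varies by at most
    [p^(e - M) = p^-n] on a ball of radius [p^-M], so the shell is a union of such balls, and
    [p^n * p^(-4M) = p^(-3M - e)]. Ball indicators span the test functions, so two linear
    functionals that agree on them are equal; this is why a Fourier preimage of each indicator is
    enough for the invariance. *)

Section PadicArith.
Variables (p : nat) (p_pr : prime p).
Local Notation K := (padic p_pr).
Local Notation Zp := (padic_int p_pr).
Local Notation q := (p%:R : rat).
Implicit Types (x y z : K) (u v : Zp) (N M : int).

Lemma q_gt1 : 1 < q. Proof. by rewrite ltr1n prime_gt1. Qed.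
Lemma q_gt0 : 0 < q. Proof. exact: lt_trans q_gt1. Qed.
Lemma q_neq0 : q != 0. Proof. by rewrite gt_eqF// q_gt0. Qed.

Lemma qX_gt0 N : 0 < q ^ N. Proof. by rewrite exprz_gt0// q_gt0. Qed.

Lemma ler_qX : {mono (fun N : int => q ^ N) : N M / N <= M}.
Proof. by move=> N M; rewrite ler_eXz2l// q_gt1. Qed.

Lemma ltr_qX : {mono (fun N : int => q ^ N) : N M / N < M}.
Proof. by move=> N M; rewrite ltr_eXz2l// q_gt1. Qed.

Lemma qX_le1 N : (q ^ N <= 1) = (N <= 0).
Proof. by rewrite -[leRHS](expr0z q) ler_qX. Qed.

Lemma residue_eq0 u n : u != 0 -> (residue u n == 0%N) = (n <= zord u)%N.
Proof.
move=> u0; apply/idP/idP => [un|nu].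
  rewrite leqNgt; apply: contraL un => /(zordP u0)[un _].
  by rewrite -lt0n.
have [uN lu] := zordP u0 (ltnSn (zord u)).
rewrite -(@residue_le _ _ u n (zord u).+1) ?(leqW nu)//.
by rewrite -/(dvdn _ _) pfactor_dvdn// lu.
Qed.

Lemma padic_norm_tofrac u : u != 0 ->
  padic_norm (tofrac u : K) = q ^ (- (zord u)%:Z).
Proof.
move=> u0; rewrite /padic_norm tofrac_eq0 (negbTE u0).
have := padic_ord_frac u0 (oner_neq0 Zp).
rewrite tofrac1 divr1 => ->.
suff -> : zord (1 : Zp) = 0%N by rewrite subr0.
have [_ /eqP] := zordM_neq0 (oner_neq0 Zp) (oner_neq0 Zp).
by rewrite mulr1 -{1}[zord 1]addn0 eqn_add2l => /eqP.
Qed.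

Lemma padic_norm_tofrac_le u n :
  (padic_norm (tofrac u : K) <= q ^ (- n%:Z)) = (residue u n == 0%N).
Proof.
have [->|u0] := eqVneq u 0.
  by rewrite residue0 eqxx tofrac0 padic_norm0 ltW// qX_gt0.
by rewrite padic_norm_tofrac// ler_qX residue_eq0// lerN2.
Qed.

Lemma padic_norm_tofrac_le1 u : padic_norm (tofrac u : K) <= 1.
Proof.
have := padic_norm_tofrac_le u 0; rewrite expr0z => ->.
by rewrite -leqn0 -ltnS -(expn0 p) residue_lt.
Qed.

Lemma residue_nat k n : residue (k%:R : Zp) n = (k %% p ^ n)%N.
Proof.
elim: k => [|k IH]; first by rewrite residue0 mod0n.
by rewrite -natr1 residueD IH modnDm addn1.
Qed.

Lemma tofrac_nat k : tofrac (k%:R : Zp) = k%:R :> K.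
Proof. by rewrite rmorph_nat. Qed.

Lemma padic_norm_nat_le k n :
  (padic_norm (k%:R : K) <= q ^ (- n%:Z)) = (p ^ n %| k)%N.
Proof. by rewrite -tofrac_nat padic_norm_tofrac_le residue_nat. Qed.

Lemma padic_norm_nat_le1 k : padic_norm (k%:R : K) <= 1.
Proof. by rewrite -tofrac_nat padic_norm_tofrac_le1. Qed.

Lemma padic_norm_neq0 x : x != 0 -> padic_norm x = q ^ (- padic_ord x).
Proof. by rewrite /padic_norm => /negbTE ->. Qed.

(** Norms are [0] or integer powers of [p], so a strict bound is a weak bound one power lower. *)
Lemma padic_norm_le_ltS x N :
  (padic_norm x <= q ^ (- N)) = (padic_norm x < q ^ (1 - N)).
Proof.
have [->|x0] := eqVneq x 0.
  by rewrite padic_norm0 ltW ?qX_gt0.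
rewrite padic_norm_neq0// ler_qX ltr_qX; lia.
Qed.

Lemma padic_norm_prime : padic_norm (p%:R : K) = q^-1.
Proof.
apply/eqP; rewrite eq_le.
have -> : q^-1 = q ^ (-1%:Z) by rewrite exprN1.
rewrite padic_norm_nat_le expn1 dvdnn/= leNgt.
rewrite (_ : -1%:Z = 1 - 2%:Z)// -padic_norm_le_ltS padic_norm_nat_le.
rewrite -[X in (_ %| X)%N]expn1 dvdn_Pexp2l//.
exact: prime_gt1.
Qed.

Lemma prime_neq0 : (p%:R : K) != 0.
Proof. by rewrite -padic_norm_eq0 padic_norm_prime invr_eq0 q_neq0. Qed.

Lemma padic_norm_expz N : padic_norm ((p%:R : K) ^ N) = q ^ (- N).
Proof.
have X n : padic_norm ((p%:R : K) ^+ n) = q ^ (- n%:Z).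
  elim: n => [|n IH]; first by rewrite expr0 padic_norm1.
  rewrite exprS padic_normM IH padic_norm_prime -exprN1 -expfzDr ?q_neq0//.
  by congr (_ ^ _); lia.
case: N => n; first exact: X.
rewrite NegzE opprK; apply: (@mulIf _ (q ^ (- n.+1%:Z))).
  by rewrite gt_eqF// qX_gt0.
rewrite -expfzDr ?q_neq0// subrr expr0z -X -padic_normM.
by rewrite -exprnN mulVf ?padic_norm1// expf_neq0// prime_neq0.
Qed.

Lemma padic_normB x y :
  padic_norm (x - y) <= Num.max (padic_norm x) (padic_norm y).
Proof. by rewrite -(padic_normN y) padic_normD. Qed.

Lemma padic_normD_le x y (r : rat) :
  padic_norm x <= r -> padic_norm y <= r -> padic_norm (x + y) <= r.
Proof. by move=> xr yr; apply: le_trans (padic_normD _ _) _; rewrite ge_max xr. Qed.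

Lemma padic_normB_le x y (r : rat) :
  padic_norm x <= r -> padic_norm y <= r -> padic_norm (x - y) <= r.
Proof. by move=> xr yr; rewrite padic_normD_le// padic_normN. Qed.

Lemma padic_normD_lt x y (r : rat) :
  padic_norm x < r -> padic_norm y < r -> padic_norm (x + y) < r.
Proof. by move=> xr yr; apply: le_lt_trans (padic_normD _ _) _; rewrite gt_max xr. Qed.

Lemma padic_norm_sum_le (I : Type) (s : seq I) (P : pred I) (F : I -> K) (r : rat) :
  0 <= r -> (forall i, P i -> padic_norm (F i) <= r) ->
  padic_norm (\sum_(i <- s | P i) F i) <= r.
Proof.
move=> r0 Fr; elim/big_ind: _ => //; first by rewrite padic_norm0.
by move=> x y; exact: padic_normD_le.
Qed.

Lemma padic_norm_distC x y : padic_norm (x - y) = padic_norm (y - x).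
Proof. by rewrite -padic_normN opprB. Qed.

Lemma padic_norm_eqD x y : padic_norm y < padic_norm x ->
  padic_norm (x + y) = padic_norm x.
Proof.
move=> yx; apply/eqP; rewrite eq_le padic_normD_le ?(ltW yx)//=.
have := padic_normB (x + y) y; rewrite addrK le_max => /orP[//|].
by rewrite leNgt yx.
Qed.

End PadicArith.

(** * Approximation by integers, completeness, and square roots near 1 *)

Section PadicComplete.
Variables (p : nat) (p_pr : prime p).
Local Notation K := (padic p_pr).
Local Notation Zp := (padic_int p_pr).
Local Notation q := (p%:R : rat).
Implicit Types (x y z : K) (u v : Zp) (N M : int).

Let pX_gt0 n : (0 < p ^ n)%N. Proof. by rewrite expn_gt0 prime_gt0. Qed.

Lemma residueB_eq0 u v n :
  (residue (u - v) n == 0%N) = (residue u n == residue v n).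
Proof.
have := residueD (u - v) v n; rewrite subrK => ->.
rewrite -[X in _ = (_ == X)](residue_mod v n) -[X in _ = (_ == X %% _)%N]add0n eqn_modDr.
by rewrite residue_mod mod0n.
Qed.

Lemma padic_norm_zord u v : u != 0 -> v != 0 ->
  padic_norm (tofrac u / tofrac v : K) <= 1 -> (zord v <= zord u)%N.
Proof.
move=> u0 v0; rewrite padic_norm_neq0 ?mulf_neq0 ?invr_eq0 ?tofrac_eq0//.
by rewrite padic_ord_frac// ?qX_le1//; lia.
Qed.

(** Write [x = a / b] with [a], [b] in Z_p. The power [p^v] of [p] in [b] also divides [a] and is
    removed from the residues of both; what is left of [b] is inverted modulo [p^N] by Euclid's
    algorithm. *)
Lemma padic_approx_nat x n : padic_norm x <= 1 ->
  exists k : nat, padic_norm (x - k%:R) <= q ^ (- n%:Z).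
Proof.
move=> x1; have [->|x0] := eqVneq x 0.
  by exists 0%N; rewrite subrr padic_norm0 ltW// qX_gt0.
set a := padic_num x; set b := padic_den x.
have a0 : a != 0 by rewrite padic_num_eq0.
have b0 : b != 0 by rewrite padic_den_neq0.
have xE : x = tofrac a / tofrac b by rewrite -padicE.
have ab : (zord b <= zord a)%N by apply: padic_norm_zord; rewrite -?xE.
(* Division by [b] costs [v] digits of precision; the extra digit gives [v < N], so that the residue
   of [b] modulo [p^N] still shows its order. *)
set v := zord b; pose N := (n + v).+1.
have vN : (v < N)%N by rewrite ltnS leq_addl.
have [B0 lB] := zordP b0 vN; set B := residue b N in B0 lB.
have vB : (p ^ v %| B)%N by rewrite pfactor_dvdn// lB.
set A := residue a N.
have vA : (p ^ v %| A)%N.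
  have : residue a v == 0%N by rewrite residue_eq0.
  by rewrite -(residue_le a (ltnW vN)).
have cB : coprime (B %/ p ^ v) (p ^ N).
  rewrite coprime_sym coprimeXl// prime_coprime//.
  apply/negP => /(dvdn_mul (dvdnn (p ^ v))).
  by rewrite mulnC -expnS [(_ * (_ %/ _))%N]mulnC divnK// pfactor_dvdn// lB ltnn.
have Bv0 : (0 < B %/ p ^ v)%N by rewrite divn_gt0// dvdn_leq.
have [k kn kE _] := egcdnP (p ^ N) Bv0.
rewrite (eqP cB) in kE.
exists (A %/ p ^ v * k)%N; set c := (_ * k)%N.
have b0F : tofrac b != 0 :> K by rewrite tofrac_eq0.
have -> : x - c%:R = tofrac (a - c%:R * b) / tofrac b.
  by rewrite tofracB tofracM tofrac_nat mulrBl -xE mulfK.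
have res : residue (a - c%:R * b) N == 0%N.
  rewrite residueB_eq0 residueM residue_nat modnMml -/B.
  suff -> : (c * B = A %/ p ^ v * kn * p ^ v * p ^ N + A)%N.
    by rewrite modnMDl /A residue_mod.
  rewrite -{1}(divnK vB) -[X in (_ + X)%N](divnK vA) /c.
  transitivity (A %/ p ^ v * (k * (B %/ p ^ v)) * p ^ v)%N; first by rewrite -!mulnA.
  rewrite kE; move: (A %/ p ^ v)%N (p ^ v)%N (p ^ N)%N => X Y Z; clear; lia.
move: res; rewrite -padic_norm_tofrac_le => res.
rewrite padic_normM; have bb : padic_norm (tofrac b)^-1 = q ^ v%:Z :> rat.
  have : padic_norm (tofrac b : K) * padic_norm (tofrac b)^-1 = 1.
    by rewrite -padic_normM divff// padic_norm1.
  rewrite padic_norm_tofrac// -/v => /(congr1 ( *%R (q ^ v%:Z))).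
  by rewrite mulrA -expfzDr ?q_neq0// subrr expr0z mul1r mulr1.
rewrite bb; apply: le_trans (ler_wpM2r _ res) _; first exact/ltW/qX_gt0.
by rewrite -expfzDr ?q_neq0// ler_qX// /N; lia.
Qed.

Lemma padic_digits x (N k : nat) : padic_norm x <= q ^ k%:Z ->
  exists a : 'I_(p ^ (k + N)),
    padic_norm (x - (a : nat)%:R * p%:R ^ (- k%:Z)) <= q ^ (- N%:Z).
Proof.
move=> xk; pose y : K := x * p%:R ^ k%:Z.
have p0 : (p%:R : K) != 0 := prime_neq0 p_pr.
have y1 : padic_norm y <= 1.
  rewrite padic_normM padic_norm_expz.
  apply: le_trans (ler_wpM2r _ xk) _; first exact/ltW/qX_gt0.
  by rewrite -expfzDr ?q_neq0// subrr expr0z.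
have [c cP] := padic_approx_nat (k + N) y1.
exists (Ordinal (ltn_pmod c (pX_gt0 (k + N)))) => /=.
have {}cP : padic_norm (y - (c %% p ^ (k + N))%N%:R) <= q ^ (- (k + N)%N%:Z).
  rewrite (_ : y - _ = (y - c%:R) + (c%:R - (c %% p ^ (k + N))%N%:R)); last by rewrite addrA subrK.
  apply: padic_normD_le => //; rewrite -natrB ?leq_mod//.
  by rewrite padic_norm_nat_le -eqn_mod_dvd ?leq_mod// modn_mod.
have -> : x = y * p%:R ^ (- k%:Z) by rewrite /y -mulrA -expfzDr// subrr mulr1.
rewrite -mulrBl padic_normM padic_norm_expz.
apply: le_trans (ler_wpM2r _ cP) _; first exact/ltW/qX_gt0.
by rewrite -expfzDr ?q_neq0// ler_qX//; lia.
Qed.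

Lemma le_all_qX (r : rat) : 0 <= r -> (forall n : nat, r <= q ^ (- n%:Z)) -> r = 0.
Proof.
move=> r0 rn; apply/eqP; rewrite eq_le r0 andbT leNgt; apply/negP => rp.
have [n nr] : exists n : nat, r^-1 < q ^ n%:Z.
  exists (Num.bound r^-1); apply: lt_le_trans (archi_boundP _) _.
    by rewrite invr_ge0.
  rewrite -exprnP -natrX ler_nat ltnW// ltn_expl// prime_gt1//.
have := rn n; rewrite leNgt => /negP; apply.
by rewrite -exprz_inv -exprnP exprVn invf_plt ?posrE// -natrX ltr0n.
Qed.

Lemma qX_small (r : rat) : 0 < r -> exists n : nat, q ^ (- n%:Z) < r.
Proof.
move=> r0; apply: contrapT => H.
have : r = 0.
  apply: le_all_qX; first exact: ltW.
  by move=> n; rewrite leNgt; apply/negP => h; apply: H; exists n.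
by move/eqP; rewrite gt_eqF.
Qed.

Lemma qX_large (r : rat) : exists n : nat, r <= q ^ n%:Z.
Proof.
have [r0|r0] := leP r 0; first by exists 0%N; rewrite (le_trans r0).
have ri0 : 0 < r^-1 by rewrite invr_gt0.
have [n nr] := qX_small ri0.
by exists n; rewrite -[r]invrK invf_ple ?posrE ?invr_gt0 ?qX_gt0// invr_expz ltW.
Qed.

(** The field is a fraction field of an inverse limit, so completeness is brought back to Z_p: a
    common denominator [p^k] clears the whole sequence, and the integers approximating its terms
    form a coherent system of residues. *)
Lemma padic_complete (t : nat -> K) :
  (forall n, padic_norm (t n.+1 - t n) <= q ^ (- n%:Z)) ->
  exists l, forall n, padic_norm (l - t n) <= q ^ (- n%:Z).
Proof.
move=> tC; have [k kP] := qX_large (Num.max (padic_norm (t 0%N)) 1).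
have tk n : padic_norm (t n) <= q ^ k%:Z.
  elim: n => [|n IH]; first by rewrite (le_trans _ kP)// le_max lexx.
  rewrite -[t _](subrK (t n)) padic_normD_le// (le_trans (tC n))//.
  by rewrite ler_qX//; lia.
pose f (n : nat) : nat := sval (cid (padic_digits n (tk n))).
have fP n : padic_norm (t n - (f n)%:R * p%:R ^ (- k%:Z)) <= q ^ (- n%:Z).
  by rewrite /f; case: (cid _).
(* [f i] matters modulo [p^(i + k)], so the index is shifted by [k] to get residues modulo [p^n]; up
   to [n = k] the truncated subtraction makes [g] constant. *)
pose g n := f (n - k)%N.
have p0 : (p%:R : K) != 0 := prime_neq0 p_pr.
have coh n : g n.+1 = g n %[mod p ^ n].
  have [nk|nk] := ltnP n k.
    by rewrite /g (eqP (_ : n.+1 - k == 0)%N)// (eqP (_ : n - k == 0)%N)// subn_eq0// ltnW.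
  have gE : g n.+1 = f (n - k).+1 by rewrite /g subSn.
  apply/eqP; wlog : / True by apply.
  move=> _; rewrite gE /g; set i := (n - k)%N.
  have H : padic_norm ((f i.+1)%:R - (f i)%:R : K) <= q ^ (- n%:Z).
    have -> : (f i.+1)%:R - (f i)%:R = (((t i.+1 - t i) - (t i.+1 - (f i.+1)%:R * p%:R ^ (- k%:Z)))
        + (t i - (f i)%:R * p%:R ^ (- k%:Z))) * p%:R ^ k%:Z :> K.
      have -> : (t i.+1 - t i - (t i.+1 - (f i.+1)%:R * p%:R ^ (- k%:Z)) +
        (t i - (f i)%:R * p%:R ^ (- k%:Z))) =
        ((f i.+1)%:R - (f i)%:R) * p%:R ^ (- k%:Z) by ring.
      by rewrite -mulrA -expfzDr// addNr mulr1.
    rewrite padic_normM padic_norm_expz.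
    apply: (@le_trans _ _ (q ^ (- i%:Z) * q ^ (- k%:Z))).
      rewrite ler_wpM2r ?(ltW (qX_gt0 _ _))// padic_normD_le// padic_normB_le//.
      by rewrite (le_trans (fP _))// ler_qX//; lia.
    by rewrite -expfzDr ?q_neq0// ler_qX// /i; lia.
  have [ff|ff] := leqP (f i) (f i.+1).
    by rewrite eqn_mod_dvd// -(padic_norm_nat_le p_pr) natrB.
  by rewrite eq_sym eqn_mod_dvd ?(ltnW ff)// -(padic_norm_nat_le p_pr) natrB ?(ltnW ff)// padic_norm_distC.
pose u : Zp := mk_padic_int p_pr coh.
exists (tofrac u * p%:R ^ (- k%:Z)) => n.
have -> : tofrac u * p%:R ^ (- k%:Z) - t n =
   (tofrac u - (f n)%:R) * p%:R ^ (- k%:Z) - (t n - (f n)%:R * p%:R ^ (- k%:Z)) by ring.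
apply: padic_normB_le => //.
rewrite padic_normM padic_norm_expz opprK -tofrac_nat -tofracB.
apply: (@le_trans _ _ (q ^ (- (n + k)%N%:Z) * q ^ k%:Z)); last first.
  by rewrite -expfzDr ?q_neq0// ler_qX//; lia.
rewrite ler_wpM2r ?(ltW (qX_gt0 _ _))// padic_norm_tofrac_le residueB_eq0 residue_nat.
by rewrite /u /residue /= /g addnK.
Qed.

Lemma padic_norm_small x : (forall n : nat, padic_norm x <= q ^ (- n%:Z)) -> x = 0.
Proof. by move=> /(le_all_qX (padic_norm_ge0 x))/eqP; rewrite padic_norm_eq0 => /eqP. Qed.

Hypothesis p_odd : p <> 2%N.

Lemma padic_norm2 : padic_norm (2 : K) = 1.
Proof.
apply/eqP; rewrite eq_le padic_norm_nat_le1 leNgt.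
rewrite (_ : (1 : rat) = q ^ (1 - 1%:Z))// -padic_norm_le_ltS padic_norm_nat_le.
by rewrite expn1 dvdn_prime2//; apply/eqP.
Qed.

Lemma two_neq0 : (2 : K) != 0.
Proof. by rewrite -padic_norm_eq0 padic_norm2. Qed.

Lemma padic_norm_half x : padic_norm (x / 2) = padic_norm x.
Proof.
have := padic_normM (x / 2) 2; rewrite divfK ?two_neq0// => ->.
by rewrite padic_norm2 mulr1.
Qed.

(** Newton's iteration from 1, with the slope frozen at 2, the derivative of [t^2] at 1. As 2 is a
    unit, the corrections are no larger than the error, and linear convergence suffices. *)
Lemma padic_sqrt_exists (w : K) (r : rat) : r < 1 -> padic_norm (w - 1) <= r ->
  exists2 t : K, t ^+ 2 = w & padic_norm (t - 1) <= r.
Proof.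
move=> r1 wr; have r0 : 0 <= r := le_trans (padic_norm_ge0 _) wr.
pose t := fix t (n : nat) := if n is n'.+1 then t n' - (t n' ^+ 2 - w) / 2 else 1 : K.
have tS n : t n.+1 = t n - (t n ^+ 2 - w) / 2 by [].
have lt1 x : padic_norm x < 1 -> padic_norm x <= q ^ (-1%:Z).
  by move=> h; rewrite padic_norm_le_ltS subrr expr0z.
have T n : padic_norm (t n - 1) <= r /\
    padic_norm (t n ^+ 2 - w) <= r * q ^ (- n%:Z).
  elim: n => [|n [t1 tw]].
    by rewrite /= subrr padic_norm0 expr1n padic_norm_distC oppr0 expr0z mulr1.
  set e := t n ^+ 2 - w in tw.
  have er : padic_norm e <= r.
    by rewrite (le_trans tw)// ler_piMr// ?qX_le1//; lia.
  split.
    rewrite tS -/e addrAC padic_normB_le//.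
    by rewrite padic_norm_half.
  (* Exact error formula: [e / 4] and [t n - 1] have norm at most [r < 1], hence at most [1/p], so
     each step gains a factor [p]. *)
  have -> : t n.+1 ^+ 2 - w = e * ((e / 2) / 2 - (t n - 1)).
    rewrite tS -/e; have -> : w = t n ^+ 2 - e by rewrite /e opprB addrC subrK.
    by field; exact: two_neq0.
  rewrite padic_normM (_ : - n.+1%:Z = - n%:Z - 1%:Z); last by lia.
  rewrite expfzDr ?q_neq0// mulrA ler_pM ?padic_norm_ge0//.
  by rewrite padic_normB_le// lt1// ?padic_norm_half (le_lt_trans _ r1).
have [|l lP] := @padic_complete t.
  move=> n; rewrite tS addrC addKr padic_normN padic_norm_half.
  apply: le_trans (T n).2 _; rewrite ler_piMl ?ltW// qX_gt0//.
have l1 : padic_norm (l - 1) <= r.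
  (* For [r = 0] no power of [p] lies below [r], but then all iterates equal 1. *)
  have [r00|rn0] := eqVneq r 0.
    suff -> : l = 1 by rewrite subrr padic_norm0.
    apply/eqP; rewrite -subr_eq0; apply/eqP/padic_norm_small => n.
    rewrite (_ : l - 1 = (l - t n) + (t n - 1)); last by rewrite addrA subrK.
    rewrite padic_normD_le// (le_trans (T n).1)// r00 ltW// qX_gt0//.
  have rp : 0 < r by rewrite lt_neqAle eq_sym rn0.
  have [n nr] := qX_small rp.
  rewrite (_ : l - 1 = (l - t n) + (t n - 1)); last by rewrite addrA subrK.
  by rewrite padic_normD_le// ?(T n).1// (le_trans (lP n))// ltW.
exists l => //.
apply/eqP; rewrite -subr_eq0; apply/eqP/padic_norm_small => n.
rewrite (_ : l ^+ 2 - w = (t n ^+ 2 - w) + (l - t n) * (l - t n + 2 * t n)); last by ring.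
have tn1 : padic_norm (t n) <= 1.
  rewrite -[t n](subrK 1) padic_normD_le ?padic_norm1//.
  by rewrite (le_trans (T n).1)// ltW.
have n1 : q ^ (- n%:Z) <= 1 by rewrite ?qX_le1//; lia.
apply: padic_normD_le; first by rewrite (le_trans (T n).2)// ler_piMl ?ltW// qX_gt0.
rewrite padic_normM -[leRHS]mulr1 ler_pM ?padic_norm_ge0//.
rewrite padic_normD_le// ?(le_trans (lP n))//.
by rewrite padic_normM padic_norm2 mul1r.
Qed.

End PadicComplete.

(** * Balls of Q_p^n *)

Section Balls.
Variables (p : nat) (p_pr : prime p) (n : nat).
Local Notation K := (padic p_pr).
Local Notation q := (p%:R : rat).
Local Notation V := ('cV[K]_n).
Implicit Types (x y z : V) (N M : int).

Definition vball z N : set V :=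
  [set y | forall i, padic_norm (y i 0 - z i 0) <= q ^ (- N)].

Lemma vball_refl z N : vball z N z.
Proof. by move=> i; rewrite subrr padic_norm0 ltW// qX_gt0. Qed.

Lemma vball_sym z N y : vball z N y -> vball y N z.
Proof. by move=> zy i; rewrite padic_norm_distC. Qed.

Lemma vball_trans z N y x : vball z N y -> vball y N x -> vball z N x.
Proof.
move=> zy yx i; rewrite (_ : x i 0 - z i 0 = (x i 0 - y i 0) + (y i 0 - z i 0)).
  by rewrite padic_normD_le.
by rewrite addrA subrK.
Qed.

Lemma vball_eq z N y : vball z N y -> vball z N = vball y N.
Proof.
move=> zy; apply/seteqP; split=> x; first exact/vball_trans/vball_sym.
exact: vball_trans.
Qed.

Lemma vball_mono z N M : M <= N -> vball z N `<=` vball z M.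
Proof. by move=> MN x zx i; rewrite (le_trans (zx i))// ler_qX// lerN2. Qed.

Lemma vballB z N y : vball z N y <-> vball 0 N (y - z).
Proof. by split=> H i; have := H i; rewrite !mxE ?subr0. Qed.

Lemma vballD z N x y : vball 0 N y -> vball z N x -> vball z N (x + y).
Proof.
move=> y0 zx; apply: vball_trans zx _ => i.
by have := y0 i; rewrite !mxE subr0 [x i 0 + _]addrC addrK.
Qed.

Lemma vball_shift a z N : [set a + x | x in vball z N] = vball (a + z) N.
Proof.
apply/seteqP; split=> [_ [x zx <-] i|x zx]; first by rewrite !mxE opprD addrACA subrr add0r.
exists (x - a); last by rewrite addrC subrK.
by move=> i; have := zx i; rewrite !mxE opprD addrA.
Qed.

Lemma vballS_nat z N : exists M : nat, vball z M%:Z `<=` vball z N.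
Proof. by exists `|N|%N; apply: vball_mono; lia. Qed.

Lemma vnorm_le x (r : rat) : 0 <= r ->
  (vnorm x <= r) <-> (forall i, padic_norm (x i 0) <= r).
Proof.
move=> r0; split=> [xr i|xr]; first exact: le_trans (le_bigmax _ _ _) xr.
by apply/bigmax_leP.
Qed.

Lemma vball0P x N : vball 0 N x <-> forall i, padic_norm (x i 0) <= q ^ (- N).
Proof. by split=> H i; have := H i; rewrite !mxE subr0. Qed.

Lemma vball0_vnorm x N : vball 0 N x <-> vnorm x <= q ^ (- N).
Proof.
rewrite vnorm_le ?(ltW (qX_gt0 _ _))//.
by split=> H i; have := H i; rewrite !mxE subr0.
Qed.

Lemma nbhs_vballP x (A : set V) :
  nbhs x A <-> exists N : nat, vball x N%:Z `<=` A.
Proof.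
split=> [/nbhs_ballP[e /= e0 eA]|[N NA]].
  have [N Ne] := qX_small p_pr e0.
  exists N => y xy; apply: eA; split=> // i j.
  rewrite (ord1 j) /ball /= /padic_dist padic_norm_distC.
  exact: le_lt_trans (xy i) Ne.
apply/nbhs_ballP; exists (q ^ (- N%:Z)); first exact: qX_gt0.
move=> y [_ xy]; apply: NA => i; have := xy i 0.
by rewrite /ball /= /padic_dist padic_norm_distC => /ltW.
Qed.

Lemma near_vball x N : \forall y \near x, vball x N y.
Proof. by have [M MN] := vballS_nat x N; apply/nbhs_vballP; exists M. Qed.

(** These are the unions of balls of radius [p^-N], the sets visible at a fixed scale. *)
Definition unif N (A : set V) := forall x y, A x -> vball x N y -> A y.

Lemma unif_vball z N M : N <= M -> unif M (vball z N).
Proof. by move=> NM x y zx xy; apply: vball_trans zx (vball_mono NM xy). Qed.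

Lemma unif_vball_id z N : unif N (vball z N).
Proof. exact: unif_vball. Qed.

Lemma unif_open N (A : set V) : unif N A -> open A.
Proof.
move=> uA; rewrite openE => x Ax; apply: filterS (near_vball x N) => y.
exact: uA Ax.
Qed.

Lemma unifC N (A : set V) : unif N A -> unif N (~` A).
Proof. by move=> uA x y nAx /vball_sym xy Ay; apply: nAx; apply: uA Ay xy. Qed.

Lemma unif_closed N (A : set V) : unif N A -> closed A.
Proof. by move=> /unifC/unif_open; rewrite openC. Qed.

(** Representatives of [p^-k Z_p^n] modulo [p^N Z_p^n]. *)
Definition grid (k N : nat) (a : {ffun 'I_n -> 'I_(p ^ (k + N))}) : V :=
  \col_i ((a i : nat)%:R * p%:R ^ (- k%:Z)).

Lemma grid_cover (k N : nat) x : vball 0 (- k%:Z) x ->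
  exists a, vball (grid (k := k) (N := N) a) N x.
Proof.
move=> xk; have H i : padic_norm (x i 0) <= q ^ k%:Z.
  by have := xk i; rewrite !mxE subr0 opprK.
exists [ffun i => sval (cid (padic_digits N (H i)))] => i.
by rewrite /grid !mxE ffunE; case: cid.
Qed.

Lemma grid_sub (k N : nat) a : vball 0 (- k%:Z) (grid (k := k) (N := N) a).
Proof.
move=> i; rewrite !mxE subr0 padic_normM padic_norm_expz !opprK.
by rewrite ler_piMl ?padic_norm_nat_le1// ltW// qX_gt0.
Qed.

Lemma grid_inj (k N : nat) a b x :
  vball (grid (k := k) (N := N) a) N x -> vball (grid b) N x -> a = b.
Proof.
move=> ax bx; apply/ffunP => i; apply/val_inj => /=.
have := vball_trans bx (vball_sym ax) i; rewrite !mxE.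
rewrite -mulrBl padic_normM padic_norm_expz opprK => H.
have {}H : padic_norm ((a i : nat)%:R - (b i : nat)%:R : K) <= q ^ (- (k + N)%N%:Z).
  rewrite -(ler_pM2r (qX_gt0 p_pr k%:Z)) (le_trans H)// -expfzDr ?q_neq0//.
  by rewrite ler_qX//; lia.
wlog ab : a b {ax bx} H / (b i <= a i)%N.
  move=> W; have [|/ltnW] := leqP (b i) (a i); first exact: W.
  by move=> ba; apply/esym/W => //; rewrite padic_norm_distC.
move: H; rewrite -natrB// padic_norm_nat_le -eqn_mod_dvd//.
by rewrite !modn_small// => /eqP.
Qed.

(** An ultrafilter on a large ball selects one grid ball at each scale. The centres of the selected
    balls form a Cauchy sequence, and the ultrafilter converges to its limit. *)
Lemma vball_compact z N : compact (vball z N).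
Proof.
suff H (k : nat) : compact (vball 0 (- k%:Z)).
  have [k zk] := qX_large p_pr (Num.max (vnorm z) (q ^ (- N))).
  apply: subclosed_compact (H k) _; first exact: unif_closed (@unif_vball_id z N).
  move=> x zx; apply/vball0P => i; rewrite opprK -[x i 0](subrK (z i 0)).
  rewrite padic_normD_le// (le_trans _ zk)// le_max ?zx ?orbT//.
  by rewrite le_bigmax.
rewrite compact_ultra => F FU Fk; have FP : ProperFilter F by exact: ultra_proper.
have meet A B : F A -> F B -> exists x, A x /\ B x.
  by move=> FA FB; have /filter_ex[x []] : F (A `&` B) by [exact: filterI]; exists x.
(* Finitely many grid balls cover the large ball; if the ultrafilter contained none of them, it
   would contain the intersection of their complements. *)
have G (j : nat) : exists z' : V, F (vball z' j).
  apply: contrapT => nG.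
  have : F (fun x => forall a, (~` vball (grid (k := k) (N := j) a) j) x).
    apply: filter_forall => a.
    by case: (in_ultra_setVsetC (vball (grid a) j) FU) => // Fa; exfalso; apply: nG; exists (grid a).
  move=> /(meet _ _ Fk)[x [/(grid_cover j)[a xa]]] /(_ a); exact.
pose c (j : nat) := sval (cid (G j)).
have Fc (j : nat) : F (vball (c j) j) by rewrite /c; case: cid.
have cc (j : nat) : vball (c j) j (c j.+1).
  have [x [x1 x2]] := meet _ _ (Fc j) (Fc j.+1).
  apply: vball_trans x1 _; apply: vball_sym; apply: vball_mono x2.
  by lia.
have L i : exists l, forall j : nat, padic_norm (l - c j i 0) <= q ^ (- j%:Z).
  by apply: padic_complete => j; exact: cc.
pose l : V := \col_i sval (cid (L i)).
have lc (j : nat) : vball (c j) j l by move=> i; rewrite mxE; case: cid.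
exists l; split.
  have [x [x1 x2]] := meet _ _ Fk (Fc 0%N).
  apply: vball_trans x1 _; have := vball_trans (vball_sym x2) (lc 0%N).
  by apply: vball_mono; lia.
move=> A /nbhs_vballP[j jA]; apply: filterS (Fc j).
by rewrite (vball_eq (lc j)).
Qed.

End Balls.

(** * Translation invariant measures *)

Section HaarBalls.
Variables (p : nat) (p_pr : prime p) (n : nat) (R : realType).
Local Notation K := (padic p_pr).
Local Notation q := (p%:R : rat).
Local Notation V := ('cV[K]_n).
Local Notation Vb := (padic_borel p_pr n).
Implicit Types (x y z : V).

Lemma open_measurable_padic (A : set V) : open A -> measurable (A : set Vb).
Proof. exact: sub_sigma_algebra. Qed.

Lemma unif_measurable (N : int) (A : set V) : unif N A -> measurable (A : set Vb).
Proof. by move=> /unif_open/open_measurable_padic. Qed.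

Lemma vball_measurable z (N : int) : measurable (vball z N : set Vb).
Proof. exact: unif_measurable (@unif_vball_id _ _ _ z N). Qed.

(** Enumerates the grid points of all sizes [k] at precision [N]; an integer that codes nothing
    gives the harmless point [0]. *)
Let center (N i : nat) : V :=
  if @unpickle {k : nat & {ffun 'I_n -> 'I_(p ^ (k + N))}} i is Some t
  then grid p_pr (tagged t) else 0.

Let center_cover (N : nat) x : exists i, vball (center N i) N x.
Proof.
have [k kx] := qX_large p_pr (vnorm x).
have /(grid_cover N)[a ax] : vball 0 (- k%:Z) x by rewrite vball0_vnorm opprK.
exists (pickle (existT (fun k => {ffun 'I_n -> 'I_(p ^ (k + N))}) k a)).
by rewrite /center pickleK.
Qed.

(** Two balls of the same radius are equal or disjoint, so removing the earlier balls from each one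
    leaves the whole ball or nothing. *)
Lemma unif_partition (N : nat) (A : set V) : unif N A ->
  exists F : (set V)^nat, [/\ trivIset setT F, A = \bigcup_i F i &
    forall i, F i = set0 \/ exists2 z, A z & F i = vball z N].
Proof.
move=> uA; pose G i := vball (center N i) N `&` A.
exists (seqDU G); split; first exact: trivIset_seqDU.
  rewrite -seqDU_bigcup_eq; apply/seteqP; split=> [x Ax|x [i _ []]//].
  by have [i ix] := center_cover N x; exists i.
move=> i; have [->|/set0P[x Gx]] := eqVneq (seqDU G i) set0; first by left.
right; have [[ix Ax] nx] := Gx; exists x => //.
apply/seteqP; split=> [y [[iy Ay] _]|y xy]; first by rewrite -(vball_eq ix).
split; first by split; [exact: vball_trans ix xy|exact: uA Ax xy].
move=> yj; apply: nx; move: yj; rewrite -!bigcup_mkord => -[j ji [jy _]].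
by exists j => //; split=> //; apply: vball_trans jy (vball_sym xy).
Qed.

Lemma measure_eq_unif (m1 m2 : {measure set Vb -> \bar R}) (N : nat) (A : set V) :
  unif N A -> (forall z, A z -> m1 (vball z N) = m2 (vball z N)) -> m1 A = m2 A.
Proof.
move=> uA m12; have [F [tF AF FE]] := unif_partition uA.
have mF i : measurable (F i : set Vb).
  by have [->|[z _ ->]] := FE i; [exact: measurable0|exact: vball_measurable].
have mA : measurable (\bigcup_i F i : set Vb) by exact: bigcupT_measurable.
rewrite AF !measure_semi_bigcup//; apply: eq_eseriesr => i _.
by have [->|[z Az ->]] := FE i; [rewrite !measure0|exact: m12].
Qed.

(** An open set is an increasing union of [unif] sets, where equality holds ball by ball; the open
    sets form a generating pi-system, exhausted by balls of finite measure. The threshold [N0]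
    admits formulas that are valid on small balls only. *)
Lemma measure_eq_balls (m1 m2 : {measure set Vb -> \bar R}) (N0 : nat) :
  (forall z (N : nat), (N0 <= N)%N -> m1 (vball z N) = m2 (vball z N)) ->
  (forall k : nat, (m1 (vball 0 (- k%:Z)) < +oo)%E) ->
  forall A : set Vb, measurable A -> m1 A = m2 A.
Proof.
move=> m12 m1fin.
have mU N (A : set V) : (N0 <= N)%N -> unif N A -> m1 A = m2 A.
  by move=> N0N uA; apply: (measure_eq_unif uA) => z _; exact: m12.
suff mO A : open A -> m1 A = m2 A.
  apply: (@measure_unique _ R Vb (@open V) (fun k => vball 0 (- k%:Z)) _ _ _ _ m1 m2) => //.
  - by move=> A B; exact: openI.
  - by move=> k; exact: unif_open (@unif_vball_id _ _ _ 0 _).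
  - apply/seteqP; split=> // x _; have [k kx] := qX_large p_pr (vnorm x).
    by exists k => //; rewrite vball0_vnorm opprK.
move=> oA; pose F N := [set x : V | vball x (N0 + N)%N `<=` A].
have uF N : unif (N0 + N)%N (F N) by move=> x y xA /vball_eq xy; rewrite /F /= -xy.
have mF N : measurable (F N : set Vb) by exact: unif_measurable (uF N).
have FA : \bigcup_N F N = A.
  apply/seteqP; split=> [x [N _]|x Ax]; first by apply; exact: vball_refl.
  have : nbhs x A by apply: open_nbhs_nbhs.
  move=> /nbhs_vballP[N NA]; exists N => // y xy; apply: NA.
  by apply: vball_mono xy; rewrite lez_nat leq_addl.
have ndF : {homo F : n m / (n <= m)%N >-> (n <= m)%O}.
  move=> i j ij; apply/subsetPset => x xA y xy; apply: xA.
  by apply: vball_mono xy; rewrite lez_nat leq_add2l.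
have mA : measurable (\bigcup_N F N : set Vb) by exact: bigcupT_measurable.
have c1 := nondecreasing_cvg_mu (mu := m1) mF mA ndF.
have c2 := nondecreasing_cvg_mu (mu := m2) mF mA ndF.
have E : m1 \o F = m2 \o F by apply/funext => N /=; apply: mU (uF N); rewrite leq_addr.
rewrite -FA -(cvg_lim _ c1)// -(cvg_lim _ c2)//.
by rewrite -[X in X @ _]/(m1 \o F) E.
Qed.

Lemma measure_ball_split (nu : {measure set Vb -> \bar R}) (k N : nat) :
  (forall z, nu (vball z N) = nu (vball 0 N)) ->
  nu (vball 0 (- k%:Z)) = (nu (vball 0 N) *+ (p ^ (k + N)) ^ n)%E.
Proof.
move=> inv; pose T := {ffun 'I_n -> 'I_(p ^ (k + N))}.
have p0 : (0 < p ^ (k + N))%N by rewrite expn_gt0 prime_gt0.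
pose a0 : T := [ffun=> Ordinal p0]; pose e := enum T.
pose F i := vball (grid p_pr (nth a0 e i)) N.
have -> : vball 0 (- k%:Z) = \bigcup_(i in `I_(size e)) F i.
  apply/seteqP; split=> [x /(grid_cover N)[a ax]|x [i _ ix]].
    exists (index a e); last by rewrite /F nth_index// mem_enum.
    by rewrite /= index_mem mem_enum.
  apply: vball_trans (grid_sub p_pr (nth a0 e i)) (vball_mono _ ix).
  by lia.
rewrite (@measure_fin_bigcup _ _ _ nu _ _ F)//.
- rewrite -fsbig_ord -cardE card_ffun !card_ord.
  by rewrite (eq_bigr (fun=> nu (vball 0 N))) => [|i _]; [rewrite /= sumr_const card_ord|exact: inv].
- move=> i j /= iE jE [x [xi xj]].
  have /eqP := grid_inj xi xj; rewrite nth_uniq ?enum_uniq// => /eqP; exact.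
- by move=> i _; exact: vball_measurable.
Qed.

(** The value [k] on the unit ball is left free so that the lemma also applies to the image of Haar
    measure under a linear map. For [N >= 0] the unit ball is cut into translates of the small one,
    for [N < 0] the large ball into unit balls. *)
Lemma haar_vball (nu : {measure set Vb -> \bar R}) (k : R) :
  (forall (a : V) (A : set Vb), measurable A ->
     nu [set a + x | x in (A : set V)] = nu A) ->
  nu (vball 0 0) = k%:E ->
  forall z (N : int), nu (vball z N) = (k * (p%:R : R) ^ (- (n%:Z * N)))%:E.
Proof.
move=> inv nu0.
have inv0 z N : nu (vball z N) = nu (vball 0 N).
  by rewrite -(inv z _ (vball_measurable 0 N)) vball_shift addr0.
have p0 : (p%:R : R) != 0 by rewrite pnatr_eq0 -lt0n prime_gt0.
move=> z N; rewrite inv0; case: N => N.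
  have := @measure_ball_split nu 0 N (fun z => inv0 z N); rewrite oppr0 nu0 add0n.
  have : nu (vball 0 N) \is a fin_num.
    rewrite ge0_fin_numE// (le_lt_trans (_ : _ <= nu (vball 0 0))%E) ?nu0 ?ltry//.
    rewrite -nu0; apply: le_measure; rewrite ?inE; [exact: vball_measurable..|].
    exact: vball_mono.
  move=> /fineK <-; rewrite -EFin_natmul => -[->].
  rewrite -[X in (X * _)%:E]mulr_natr -mulrA !natrX -exprM -PoszM mulnC.
  by rewrite exprnP -expfzDr// subrr expr0z mulr1.
rewrite NegzE (measure_ball_split (N := 0) N.+1 (fun z => inv0 z _)) nu0 -EFin_natmul addn0.
by rewrite -[X in X%:E]mulr_natr !natrX -exprM mulrN opprK -PoszM [(N.+1 * n)%N]mulnC.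
Qed.

End HaarBalls.

(** * Analytic square roots *)

Section SqrtSeries.
Import -(notations) mpoly.
Variables (p : nat) (p_pr : prime p) (p_odd : p <> 2%N) (n : nat).
Local Notation K := (padic p_pr).
Local Notation q := (p%:R : rat).
Local Notation MP := (mpoly n K).
Variables (r : rat) (r_gt0 : 0 < r).
Implicit Types (P Q : MP) (m : multinom n).

(** The Gauss norm for the polydisc of radius [r] is at most 1. By the ultrametric inequality this
    is stable under sums and products, hence under Newton's iteration. *)
Definition gauss_le1 P := forall m, padic_norm (mcoeff m P) * r ^+ mdeg m <= 1.
Definition order_ge (d : nat) P := forall m, (mdeg m < d)%N -> mcoeff m P = 0.

Let rX_ge0 d : 0 <= r ^+ d. Proof. by rewrite exprn_ge0// ltW. Qed.

Lemma gauss_le1D P Q : gauss_le1 P -> gauss_le1 Q -> gauss_le1 (P + Q).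
Proof.
move=> gP gQ m; rewrite mcoeffD.
apply: le_trans (ler_wpM2r (rX_ge0 _) (padic_normD _ _)) _.
by have [_|_] := leP (padic_norm (mcoeff m P)); [exact: gQ|exact: gP].
Qed.

Lemma gauss_le1Z a P : padic_norm a <= 1 -> gauss_le1 P -> gauss_le1 (a *: P).
Proof.
move=> a1 gP m; rewrite mcoeffZ padic_normM -mulrA.
by rewrite mulr_ile1 ?padic_norm_ge0// mulr_ge0// padic_norm_ge0.
Qed.

Lemma gauss_le1_monomial (a : K) m : padic_norm a * r ^+ mdeg m <= 1 ->
  gauss_le1 (a *: mpolyX K m).
Proof.
move=> am m'; rewrite mcoeffZ mcoeffX; have [<-|_] := eqVneq m m'; first by rewrite mulr1.
by rewrite mulr0 padic_norm0 mul0r.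
Qed.

Lemma gauss_le1_one : gauss_le1 1.
Proof.
move=> m; rewrite mcoeff1; have [->|_] := eqVneq m _; last by rewrite padic_norm0 mul0r.
by rewrite padic_norm1 mdeg0 expr0 mulr1.
Qed.

Lemma gauss_le1M P Q : gauss_le1 P -> gauss_le1 Q -> gauss_le1 (P * Q).
Proof.
move=> gP gQ m; rewrite mcoeffM -ler_pdivlMr ?exprn_gt0// mul1r.
apply: padic_norm_sum_le => [|k /eqP mk]; first by rewrite invr_ge0.
case: k mk => -[k1 ?] [k2 ?] /= mk.
rewrite -[leRHS]mul1r ler_pdivlMr ?exprn_gt0// mk mdegD exprD padic_normM mulrACA.
by rewrite mulr_ile1// ?mulr_ge0// padic_norm_ge0.
Qed.

Lemma order_geD d P Q : order_ge d P -> order_ge d Q -> order_ge d (P + Q).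
Proof. by move=> oP oQ m md; rewrite mcoeffD oP// oQ// addr0. Qed.

Lemma order_geZ d a P : order_ge d P -> order_ge d (a *: P).
Proof. by move=> oP m md; rewrite mcoeffZ oP// mulr0. Qed.

Lemma order_ge_leq d e P : (d <= e)%N -> order_ge e P -> order_ge d P.
Proof. by move=> de oP m md; apply: oP (leq_trans md de). Qed.

Lemma order_geM d e P Q : order_ge d P -> order_ge e Q -> order_ge (d + e) (P * Q).
Proof.
move=> oP oQ m md; rewrite mcoeffM big1// => k /eqP mk.
have [kd|kd] := ltnP (mdeg k.1) d; first by rewrite oP// mul0r.
rewrite oQ ?mulr0// -(ltn_add2l (mdeg k.1)) -mdegD -mk (leq_trans md)//.
by rewrite leq_add2r.
Qed.

Definition mnm_of_ffun (i : {ffun 'I_n -> nat}) : multinom n := Multinom [tuple i j | j < n].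

Lemma mnm_of_ffunE i j : mnm_of_ffun i j = i j.
Proof. by rewrite mnmE. Qed.

Lemma mdeg_mnm_of_ffun i : mdeg (mnm_of_ffun i) = (\sum_j i j)%N.
Proof. by rewrite mdegE; apply: eq_bigr => j _; rewrite mnm_of_ffunE. Qed.

(** The coordinates of [h] lie one power of [p] inside the polydisc, so each degree gains a factor
    [1/p] on the Gauss bound. *)
Lemma meval_term_le (h : 'cV[K]_n) P m d : (forall i, padic_norm (h i 0) <= r / q) ->
  gauss_le1 P -> (d <= mdeg m)%N ->
  padic_norm (mcoeff m P * \prod_i h i 0 ^+ m i) <= q ^ (- d%:Z).
Proof.
move=> hr gP dm.
have mono : padic_norm (\prod_i h i 0 ^+ m i) <= r ^+ mdeg m * (q^-1) ^+ mdeg m.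
  rewrite -exprMn mdegE -prodrXr; elim/big_ind2 : _ => [|x a y b xa yb|i _].
  - by rewrite padic_norm1.
  - by rewrite padic_normM ler_pM ?padic_norm_ge0.
  - elim: (m i) => [|e IH]; first by rewrite !expr0 padic_norm1.
    by rewrite !exprS padic_normM ler_pM ?padic_norm_ge0.
rewrite padic_normM.
apply: le_trans (ler_wpM2l (padic_norm_ge0 _) mono) _.
rewrite mulrA; apply: (@le_trans _ _ (q^-1 ^+ mdeg m)).
  by rewrite ler_piMl// exprn_ge0// invr_ge0 ltW// q_gt0.
by rewrite exprVn exprnN ler_qX// lerN2 lez_nat.
Qed.

Lemma meval_le (h : 'cV[K]_n) P d : (forall i, padic_norm (h i 0) <= r / q) ->
  gauss_le1 P -> order_ge d P ->
  padic_norm (meval (fun i => h i 0) P) <= q ^ (- d%:Z).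
Proof.
move=> hr gP oP; rewrite mevalE big_seq; apply: padic_norm_sum_le => [|m].
  exact/ltW/qX_gt0.
rewrite mcoeff_msupp => mP; apply: meval_term_le => //.
by rewrite leqNgt; apply: contra mP => /oP/eqP.
Qed.

(** [analytic_at] sums over boxes of exponents, [meval] over the support. They differ by monomials
    having some exponent at least [N], hence degree at least [N]. *)
Lemma meval_box (h : 'cV[K]_n) P (N : nat) : (forall i, padic_norm (h i 0) <= r / q) ->
  gauss_le1 P ->
  padic_norm (meval (fun i => h i 0) P - \sum_(i : {ffun 'I_n -> 'I_N})
    mcoeff (mnm_of_ffun [ffun j => i j : nat]) P * \prod_j h j 0 ^+ i j) <= q ^ (- N%:Z).
Proof.
move=> hr gP; rewrite mevalE.
pose F m := mcoeff m P * \prod_j h j 0 ^+ m j.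
pose up (i : {ffun 'I_n -> 'I_N}) := mnm_of_ffun [ffun j => i j : nat].
have up_inj : injective up.
  move=> i i' /mnmP ii'; apply/ffunP => j; apply/val_inj => /=.
  by have := ii' j; rewrite !mnm_of_ffunE !ffunE.
pose box m := [forall j, (m j < N)%N].
have boxP m : reflect (exists i, m = up i) (box m).
  apply: (iffP forallP) => [mN|[i ->] j]; last by rewrite mnm_of_ffunE ffunE.
  exists [ffun j => Ordinal (mN j)]; apply/mnmP => j.
  by rewrite mnm_of_ffunE !ffunE.
have -> : \sum_(i : {ffun 'I_n -> 'I_N}) mcoeff (up i) P * \prod_j h j 0 ^+ i j
    = \sum_(m <- msupp P | box m) F m.
  transitivity (\sum_(m <- map up (enum {ffun 'I_n -> 'I_N})) F m).
    rewrite big_map big_enum; apply: eq_bigr => i _; congr (_ * _).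
    by apply: eq_bigr => j _; rewrite mnm_of_ffunE ffunE.
  rewrite (bigID (fun m => m \in msupp P)) /= [X in _ + X]big1 ?addr0; last first.
    by move=> m; rewrite -mcoeff_eq0 => /eqP mP; rewrite /F mP mul0r.
  rewrite -big_filter -[in RHS]big_filter; apply: perm_big; apply: uniq_perm.
  - by rewrite filter_uniq// map_inj_uniq// enum_uniq.
  - by rewrite filter_uniq// msupp_uniq.
  move=> m; rewrite !mem_filter andbC; congr (_ && _); apply/mapP/boxP.
    by move=> [i _ ->]; exists i.
  by move=> [i ->]; exists i; rewrite ?mem_enum.
rewrite (bigID box) /= [X in X - _]addrC addrK.
apply: padic_norm_sum_le => [|m]; first exact/ltW/qX_gt0.
rewrite negb_forall => /existsP[j]; rewrite -leqNgt => Nm.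
by apply: meval_term_le => //; rewrite (leq_trans Nm)// mdegE (bigD1 j)//= leq_addr.
Qed.

Variable W : MP.
Hypotheses (W_gauss : gauss_le1 W) (W_order : order_ge 1 (W - 1)).

(** When [s] has constant term 1 and the error [s^2 - W] has none, the second factor has order at
    least 1; this is the gain of one degree per step. *)
Let newton_step (s S : MP) : S = s + (- 2^-1 * 1) *: (s ^+ 2 - W) ->
  S ^+ 2 - W = (s ^+ 2 - W) * (4^-1 *: (s ^+ 2 - W) + (-1) *: (s - 1)).
Proof.
move=> ->; set E := s ^+ 2 - W; have -> : W = s ^+ 2 - E by rewrite /E opprB addrC subrK.
rewrite -!mul_mpolyC; set h := mpolyC n (- 2^-1 * 1).
have hh : h + h + 1 = 0.
  rewrite /h -mpolyCD -mpolyC1 -mpolyCD (_ : _ + 1 = 0) ?mpolyC0//.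
  by field; exact: two_neq0.
have -> : mpolyC n (4^-1 : K) = h ^+ 2.
  by rewrite expr2 /h -mpolyCM mulr1 mulrNN -invfM -natrM.
rewrite mpolyCN mpolyC1.
apply/eqP; rewrite -subr_eq0; apply/eqP.
(* The identity holds modulo the relation [2h + 1 = 0], so the difference of the two sides is
   exhibited as a multiple of it. *)
transitivity ((h + h + 1) * (s * E)); first by ring.
by rewrite hh mul0r.
Qed.

(* Newton's iteration for a formal square root of [W], with the constant slope [2]: each step
   raises the order of the error by one, so the coefficients of degree [d] are final at step [d]. *)
Let sq : nat -> MP := fix sq d :=
  if d is d'.+1 then sq d' - 2^-1 *: (sq d' ^+ 2 - W) else 1.

Let sqP d : [/\ gauss_le1 (sq d), order_ge 1 (sq d - 1),
  gauss_le1 (sq d ^+ 2 - W) & order_ge d.+1 (sq d ^+ 2 - W)].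
Proof.
have half1 : padic_norm (- 2^-1 * 1 : K) <= 1.
  by rewrite mulr1 padic_normN -[2^-1]mul1r padic_norm_half// padic_norm1.
have gN P : gauss_le1 P -> gauss_le1 (- P).
  by move=> gP; rewrite -scaleN1r; apply: gauss_le1Z; rewrite ?padic_normN ?padic_norm1.
elim: d => [|d [g1 o1 g2 o2]].
  rewrite /= expr1n subrr; split.
  - exact: gauss_le1_one.
  - by move=> m _; rewrite mcoeff0.
  - by apply: gauss_le1D; [exact: gauss_le1_one|exact: gN].
  - by rewrite -opprB -scaleN1r; exact: order_geZ.
have sqS : sq d.+1 = sq d + (- 2^-1 * 1) *: (sq d ^+ 2 - W) by rewrite mulr1 scaleNr.
move: (sq d) (sq d.+1) sqS g1 o1 g2 o2 => s S sqS g1 o1 g2 o2.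
have gS : gauss_le1 S by rewrite sqS; apply: gauss_le1D => //; exact: gauss_le1Z.
split; first by [].
- rewrite sqS addrAC; apply: order_geD => //; apply: order_geZ.
  exact: order_ge_leq o2.
- by rewrite expr2; apply: gauss_le1D; [exact: gauss_le1M|exact: gN].
rewrite (newton_step sqS).
rewrite -addn1; apply: order_geM => //; apply: order_geD; apply: order_geZ => //.
exact: order_ge_leq o2.
Qed.

Let sq_stable d e m : (mdeg m <= d)%N -> mcoeff m (sq (d + e)) = mcoeff m (sq d).
Proof.
move=> md; elim: e => [|e IH]; first by rewrite addn0.
have [_ _ _ o] := sqP (d + e).
rewrite addnS /= mcoeffB mcoeffZ o ?mulr0 ?subr0//.
by rewrite ltnS (leq_trans md)// leq_addr.
Qed.

(** The coefficient of a monomial of degree [d] is read off the [d]-th iterate. The condition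
    [|g - 1| < 1] selects the branch, since [-g] lies near [-1], which is far from 1 for odd [p]. *)
Lemma sqrt_series : exists c : {ffun 'I_n -> nat} -> K,
  (forall i, padic_norm (c i) * r ^+ (\sum_j i j)%N <= 1) /\
  forall (h : 'cV[K]_n) (g : K), (forall i, padic_norm (h i 0) <= r / q) ->
    g ^+ 2 = meval (fun i => h i 0) W -> padic_norm (g - 1) < 1 ->
    forall N : nat, padic_norm (\sum_(i : {ffun 'I_n -> 'I_N})
       c [ffun j => i j : nat] * \prod_j h j 0 ^+ i j - g) <= q ^ (- N%:Z).
Proof.
pose c i := mcoeff (mnm_of_ffun i) (sq (\sum_j i j)%N).
exists c; split=> [i|h g hr gW g1].
  by have [+ _ _ _] := sqP (\sum_j i j)%N => /(_ (mnm_of_ffun i)); rewrite mdeg_mnm_of_ffun.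
pose ev := meval (fun i => h i 0).
have evg d : padic_norm (ev (sq d) - g) <= q ^ (- d%:Z).
  have [s1 s2 s3 s4] := sqP d.
  have e1 : padic_norm (ev (sq d) - 1) < 1.
    have g1' : gauss_le1 (sq d - 1).
      rewrite -scaleN1r; apply: gauss_le1D => //; apply: gauss_le1Z; last exact: gauss_le1_one.
      by rewrite padic_normN padic_norm1.
    have := meval_le hr g1' s2; rewrite mevalB meval1 => /le_lt_trans; apply.
    by rewrite -[ltRHS](expr0z q) ltr_qX.
  (* Both terms are close to 1, so their sum is a unit like 2, and the distance between them equals
     the distance between their squares. *)
  have n1 : padic_norm (ev (sq d) + g) = 1.
    have -> : ev (sq d) + g = 2 + ((ev (sq d) - 1) + (g - 1)) by ring.
    by rewrite padic_norm_eqD padic_norm2// padic_normD_lt.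
  have -> : padic_norm (ev (sq d) - g) = padic_norm ((ev (sq d) - g) * (ev (sq d) + g)).
    by rewrite padic_normM n1 mulr1.
  rewrite -subr_sqr gW.
  have := meval_le hr s3 s4; rewrite mevalB rmorphXn /= => /le_trans; apply.
  by rewrite ler_qX//; lia.
(* Monomials of the box have degree at most [n * N], so their coefficients are final at step [d];
   the additional [N] secures the precision [p^-N]. *)
move=> N; pose d := (n * N + N)%N.
rewrite -[X in padic_norm (X - g)](_ : \sum_(i : {ffun 'I_n -> 'I_N})
    mcoeff (mnm_of_ffun [ffun j => i j : nat]) (sq d) * \prod_j h j 0 ^+ i j = _); last first.
  apply: eq_bigr => i _; congr (_ * _); rewrite /c.
  set k := (\sum_j _)%N.
  have kd : (k <= d)%N.
    rewrite (leq_trans _ (leq_addr _ _))// (@leq_trans (\sum_(j < n) N)%N)//.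
      by apply: leq_sum => j _; rewrite ffunE ltnW.
    by rewrite sum_nat_const card_ord.
  by rewrite -(subnKC kd) sq_stable// mdeg_mnm_of_ffun.
set B := \sum_(i : _) _.
rewrite (_ : B - g = (ev (sq d) - g) - (ev (sq d) - B)); last by ring.
apply: padic_normB_le.
  by rewrite (le_trans (evg d))// ler_qX// /d; lia.
by have [s1 _ _ _] := sqP d; exact: meval_box.
Qed.

End SqrtSeries.

Section SqrtQuadratic.
Import -(notations) mpoly.
Variables (p : nat) (p_pr : prime p) (p_odd : p <> 2%N) (n : nat).
Local Notation K := (padic p_pr).
Local Notation q := (p%:R : rat).
Variables (r : rat) (r_gt0 : 0 < r) (A B : 'I_n -> K).
Hypothesis A_le : forall j, padic_norm (A j) * r ^+ 1 <= 1.
Hypothesis B_le : forall j, padic_norm (B j) * r ^+ 2 <= 1.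

(** The shape met in the charts: [Q] is diagonal, so after recentring and division by the value at
    the centre the radicand is 1 plus linear and pure square terms. *)
Lemma sqrt_series_quadratic : exists c : {ffun 'I_n -> nat} -> K,
  (forall i, padic_norm (c i) * r ^+ (\sum_j i j)%N <= 1) /\
  forall (h : 'cV[K]_n) (g : K), (forall i, padic_norm (h i 0) <= r / q) ->
    g ^+ 2 = 1 + \sum_j (A j * h j 0 + B j * h j 0 ^+ 2) -> padic_norm (g - 1) < 1 ->
    forall N : nat, padic_norm (\sum_(i : {ffun 'I_n -> 'I_N})
       c [ffun j => i j : nat] * \prod_j h j 0 ^+ i j - g) <= q ^ (- N%:Z).
Proof.
pose S : mpoly n K := \sum_j (A j *: mpolyX K (mnm1 j)
   + B j *: mpolyX K (mnm_add (mnm1 j) (mnm1 j))).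
have gS : gauss_le1 r S.
  rewrite /S; elim/big_ind: _ => [m|P Q gP gQ|j _]; last 1 first.
  - by apply: gauss_le1D => //; apply: gauss_le1_monomial => //; rewrite ?mdegD ?mdeg1.
  - by rewrite mcoeff0 padic_norm0 mul0r.
  - exact: gauss_le1D.
have oS : order_ge 1 S.
  move=> m; rewrite ltnS leqn0 => /eqP m0; rewrite raddf_sum big1// => j _.
  rewrite raddfD /= !mcoeffZ !mcoeffX.
  have [mE|_] := eqVneq (mnm1 j) m; first by move: m0; rewrite -mE mdeg1.
  have [mE|_] := eqVneq (mnm_add _ _) m; first by move: m0; rewrite -mE mdegD mdeg1.
  by rewrite !mulr0 addr0.
have gW : gauss_le1 r (1 + S) by apply: gauss_le1D => //; exact: gauss_le1_one.
have oW : order_ge 1 (1 + S - 1) by rewrite addrAC subrr add0r.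
have [c [c1 c2]] := sqrt_series p_odd r_gt0 gW oW.
exists c; split=> // h g hr gE g1; apply: c2 => //.
rewrite gE mevalD meval1 raddf_sum; congr (_ + _); apply: eq_bigr => j _.
by rewrite /= mevalD !mevalZ mpolyXD mevalM !mevalXU expr2.
Qed.

End SqrtQuadratic.

Section PadicCvg.
Variables (p : nat) (p_pr : prime p).
Local Notation K := (padic p_pr).
Local Notation q := (p%:R : rat).

Lemma padic_cvg (s : nat -> K) (l : K) (C : rat) : 0 < C ->
  (forall N : nat, padic_norm (s N - l) <= C * q ^ (- N%:Z)) -> s @ \oo --> l.
Proof.
move=> C0 sl; apply/cvg_ballP => e e0.
have [N0 N0e] : exists N0 : nat, q ^ (- N0%:Z) < e / C by apply: qX_small => //; exact: divr_gt0.
near=> N; rewrite /ball /= /padic_dist padic_norm_distC.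
apply: le_lt_trans (sl N) _; rewrite mulrC -ltr_pdivlMr//.
apply: le_lt_trans N0e; rewrite ler_qX// lerN2 lez_nat; near: N.
exact: nbhs_infty_ge.
Unshelve. all: by end_near. Qed.

End PadicCvg.

(** * The hyperboloid and its charts *)

Section MinkowskiQ.
Variables (p : nat) (p_pr : prime p) (p_odd : p <> 2%N).
Local Notation K := (padic p_pr).
Local Notation q := (p%:R : rat).
Implicit Types (x y z k : 'cV[K]_4) (m : K).

Definition Qsgn (l : 'I_4) : K := if l == ord0 then 1 else -1.

Lemma QsgnK l (a : K) : Qsgn l * (Qsgn l * a) = a.
Proof. by rewrite /Qsgn; case: ifP => _; rewrite ?mul1r// !mulN1r opprK. Qed.

Lemma padic_norm_Qsgn l : padic_norm (Qsgn l) = 1.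
Proof. by rewrite /Qsgn; case: ifP => _; rewrite ?padic_normN padic_norm1. Qed.

Lemma bracketE x y : bracket x y = \sum_l Qsgn l * (x l 0 * y l 0).
Proof.
rewrite big_ord_recl /= mul1r /bracket -sumrN; congr (_ + _).
by apply: eq_bigr => i _; rewrite mulN1r.
Qed.

Lemma dQformE l k : dQform l k = Qsgn l * (2 * k l 0).
Proof. by rewrite /dQform /Qsgn; case: ifP => _; rewrite ?mul1r ?mulN1r. Qed.

Lemma padic_norm_dQform l k : padic_norm (dQform l k) = padic_norm (k l 0).
Proof. by rewrite dQformE !padic_normM padic_norm_Qsgn padic_norm2// !mul1r. Qed.

Lemma Qform_insert l (y : 'cV[K]_3) t :
  Qform (insert_coord l y t) = Qsgn l * t ^+ 2 + \sum_j Qsgn (lift l j) * y j 0 ^+ 2.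
Proof.
rewrite /Qform bracketE (bigD1 l) //= mxE unlift_none -expr2; congr (_ + _).
rewrite (reindex_onto (lift l) (fun i => odflt ord0 (unlift l i))) /=; last first.
  by move=> i il; case: unliftP il => [j ->|->]; rewrite ?eqxx.
apply: eq_big => [j|j _]; first by rewrite eq_sym neq_lift liftK/= eqxx.
by rewrite mxE liftK expr2.
Qed.

Definition drop_coord l k : 'cV[K]_3 := \col_j k (lift l j) 0.

Lemma insert_drop l k : insert_coord l (drop_coord l k) (k l 0) = k.
Proof.
apply/colP => i; rewrite mxE; case: unliftP => [j ->|->//].
by rewrite mxE.
Qed.

Lemma insert_coord_l l (y : 'cV[K]_3) t : insert_coord l y t l 0 = t.
Proof. by rewrite mxE unlift_none. Qed.

Lemma vball_insert l z (M : int) (y : 'cV[K]_3) t :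
  vball z M (insert_coord l y t) <->
  vball (drop_coord l z) M y /\ padic_norm (t - z l 0) <= q ^ (- M).
Proof.
split=> [zM|[yM tM] i].
  split=> [j|]; first by have := zM (lift l j); rewrite !mxE liftK.
  by have := zM l; rewrite insert_coord_l.
rewrite mxE; case: unliftP => [j ->|->//].
by have := yM j; rewrite mxE.
Qed.

Lemma padic_norm_sqrB (a b : K) (r d : rat) : padic_norm a <= r -> padic_norm b <= r ->
  padic_norm (a - b) <= d -> padic_norm (a ^+ 2 - b ^+ 2) <= d * r.
Proof.
move=> ar br ab; rewrite subr_sqr padic_normM ler_pM ?padic_norm_ge0//.
exact: padic_normD_le.
Qed.

Lemma Qform_dist x y (r d : rat) :
  (forall i, padic_norm (x i 0) <= r) -> (forall i, padic_norm (y i 0) <= r) ->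
  (forall i, padic_norm (x i 0 - y i 0) <= d) ->
  padic_norm (Qform x - Qform y) <= d * r.
Proof.
move=> xr yr xy; have r0 := le_trans (padic_norm_ge0 _) (xr 0).
have d0 := le_trans (padic_norm_ge0 _) (xy 0).
rewrite /Qform !bracketE -sumrB; apply: padic_norm_sum_le => [|i _]; first exact: mulr_ge0.
by rewrite -mulrBr padic_normM padic_norm_Qsgn mul1r -!expr2 padic_norm_sqrB.
Qed.

(** Rescaling by [c] reduces to a root of [1 + w / c^2] near 1, where the perturbation has norm at
    most [p^(-M - e) < 1]. *)
Lemma sqrt_near (c w : K) (e M : int) : padic_norm c = q ^ e -> - M < e ->
  padic_norm w <= q ^ (- M) * q ^ e ->
  exists2 t, t ^+ 2 = c ^+ 2 + w & padic_norm (t - c) <= q ^ (- M).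
Proof.
move=> ce Me wM; have c0 : c != 0 by rewrite -padic_norm_eq0 ce gt_eqF// qX_gt0.
pose r := q ^ (- M - e).
have r1 : r < 1 by rewrite -[ltRHS](expr0z q) ltr_qX//; lia.
have wr : padic_norm (1 + w / c ^+ 2 - 1) <= r.
  rewrite addrC addKr -(ler_pM2r (qX_gt0 p_pr (e + e))) /r -expfzDr ?q_neq0//.
  have -> : q ^ (e + e) = padic_norm (c ^+ 2) by rewrite expr2 padic_normM ce expfzDr ?q_neq0.
  rewrite -padic_normM divfK ?expf_neq0// (le_trans wM)// -expfzDr ?q_neq0//.
  by rewrite ler_qX//; lia.
have [t tw t1] := padic_sqrt_exists p_odd r1 wr.
exists (c * t); first by rewrite exprMn tw mulrDr mulr1 mulrCA divff ?expf_neq0 ?mulr1.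
rewrite -[X in _ - X]mulr1 -mulrBr padic_normM ce.
apply: le_trans (ler_wpM2l _ t1) _; first exact/ltW/qX_gt0.
by rewrite -expfzDr ?q_neq0// ler_qX//; lia.
Qed.

(** If [t = -u], then [2c] would be at most [p^-M], against [|2c| = p^e]. *)
Lemma sqrt_unique (c t u : K) (e M : int) : padic_norm c = q ^ e -> - M < e ->
  padic_norm (t - c) <= q ^ (- M) -> padic_norm (u - c) <= q ^ (- M) ->
  t ^+ 2 = u ^+ 2 -> t = u.
Proof.
move=> ce Me tc uc /eqP; rewrite eqf_sqr => /orP[/eqP//|/eqP tu].
have : padic_norm (2 * c) <= q ^ (- M).
  have -> : 2 * c = - ((t - c) + (u - c)) by rewrite tu; ring.
  by rewrite padic_normN padic_normD_le.
by rewrite padic_normM padic_norm2// mul1r ce ler_qX// leNgt Me.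
Qed.

Lemma padic_norm_near (c t : K) (e M : int) : padic_norm c = q ^ e -> - M < e ->
  padic_norm (t - c) <= q ^ (- M) -> padic_norm t = q ^ e.
Proof.
move=> ce Me tc; rewrite -[t](subrK c) addrC padic_norm_eqD// ce.
by rewrite (le_lt_trans tc)// ltr_qX.
Qed.

(** A quantitative Hensel lemma: the error in [Q] is absorbed by moving the [l]-th coordinate
    alone. *)
Lemma Qform_root_near m x l (e M : int) : padic_norm (x l 0) = q ^ e -> - M < e ->
  padic_norm (Qform x - m ^+ 2) <= q ^ (- M) * q ^ e ->
  exists2 z, hyperboloid m z & vball x M z.
Proof.
move=> xe Me xm.
have [|t tE tx] := @sqrt_near (x l 0) (- (Qsgn l * (Qform x - m ^+ 2))) e M xe Me.
  by rewrite padic_normN padic_normM padic_norm_Qsgn mul1r.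
exists (insert_coord l (drop_coord l x) t); last first.
  by apply/vball_insert; split=> //; exact: vball_refl.
rewrite /hyperboloid /= Qform_insert tE.
have := Qform_insert l (drop_coord l x) (x l 0); rewrite insert_drop => xE.
by rewrite mulrBr QsgnK addrAC -xE subKr.
Qed.

Lemma vnorm_attained x : exists l, forall i, padic_norm (x i 0) <= padic_norm (x l 0).
Proof.
exists [arg max_(i > (0 : 'I_4)) padic_norm (x i 0)]%O => i.
by case: arg_maxP => // j _; apply.
Qed.

Lemma padic_norm_Qform_le x (r : rat) : (forall i, padic_norm (x i 0) <= r) ->
  padic_norm (Qform x) <= r ^+ 2.
Proof.
move=> xr; have r0 := le_trans (padic_norm_ge0 _) (xr 0).
rewrite /Qform bracketE; apply: padic_norm_sum_le => [|i _]; first exact: exprn_ge0.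
by rewrite padic_normM padic_norm_Qsgn mul1r padic_normM expr2 ler_pM// padic_norm_ge0.
Qed.

End MinkowskiQ.

(** * Local charts: one coordinate as a square root in the other three *)

Section Chart.
Variables (p : nat) (p_pr : prime p) (p_odd : p <> 2%N).
Local Notation K := (padic p_pr).
Local Notation q := (p%:R : rat).
Variables (m : K) (z : 'cV[K]_4) (l : 'I_4) (e M : int).
Hypotheses (zm : hyperboloid m z) (ze : padic_norm (z l 0) = q ^ e).
Hypotheses (zl : forall i, padic_norm (z i 0) <= q ^ e) (Me : - M < e).
Implicit Types (y h : 'cV[K]_3).

Let U : set 'cV[K]_3 := vball (drop_coord l z) M.

(* On [U] the set below is a singleton; outside [U] the value is irrelevant. *)
Definition chart y : K := xget 0 [set t | hyperboloid m (insert_coord l y t) /\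
  padic_norm (t - z l 0) <= q ^ (- M)].

Let Uy y : U y -> forall j, padic_norm (y j 0) <= q ^ e.
Proof.
move=> yU j; rewrite -[y j 0](subrK (z (lift l j) 0)) padic_normD_le//.
by have := yU j; rewrite mxE => /le_trans; apply; rewrite ler_qX// ltW.
Qed.

Let sqrE y t : Qform (insert_coord l y t) = m ^+ 2 <->
  t ^+ 2 = Qsgn p_pr l * (m ^+ 2 - \sum_j Qsgn p_pr (lift l j) * y j 0 ^+ 2).
Proof.
rewrite Qform_insert; split=> [<-|->].
  by rewrite addrK QsgnK.
by rewrite QsgnK subrK.
Qed.

Let chartP y : U y -> hyperboloid m (insert_coord l y (chart y)) /\
  padic_norm (chart y - z l 0) <= q ^ (- M).
Proof.
move=> yU; rewrite /chart; case: xgetP => [t _ //|H]; exfalso.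
(* [w] is the change of the radicand when the other coordinates move from those of [z] to [y]; it is
   at most [p^-M * p^e], as [sqrt_near] asks. *)
pose w := - (Qsgn p_pr l * \sum_j Qsgn p_pr (lift l j) * (y j 0 ^+ 2 - z (lift l j) 0 ^+ 2)).
have [|t tE tz] := @sqrt_near _ _ p_odd (z l 0) w e M ze Me.
  rewrite padic_normN padic_normM padic_norm_Qsgn mul1r.
  apply: padic_norm_sum_le => [|j _]; first by rewrite mulr_ge0// ltW// qX_gt0.
  rewrite padic_normM padic_norm_Qsgn mul1r padic_norm_sqrB ?Uy//.
  by have := yU j; rewrite mxE.
apply: (H t); split=> //; rewrite /hyperboloid /=; apply/sqrE; rewrite tE.
have /sqrE -> : Qform (insert_coord l (drop_coord l z) (z l 0)) = m ^+ 2.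
  by rewrite insert_drop.
rewrite /w -mulrN -mulrDr; congr (_ * _); rewrite -addrA; congr (_ + _).
rewrite -opprD -big_split /=; congr (- _); apply: eq_bigr => j _.
by rewrite mxE -mulrDr addrC subrK.
Qed.

Let chart_unique y t : U y -> hyperboloid m (insert_coord l y t) ->
  padic_norm (t - z l 0) <= q ^ (- M) -> t = chart y.
Proof.
move=> yU /sqrE tm tz; have [/sqrE cm cz] := chartP yU.
by apply: (sqrt_unique p_odd ze Me tz cz); rewrite tm cm.
Qed.

Let chart_norm y : U y -> padic_norm (chart y) = q ^ e.
Proof. by move=> /chartP[_]; exact: padic_norm_near. Qed.

Lemma chart_image :
  [set insert_coord l y (chart y) | y in U] = vball z M `&` hyperboloid m.
Proof.
apply/seteqP; split=> [_ [y yU <-]|x [xz xm]].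
  by have [cm cz] := chartP yU; split=> //; apply/vball_insert.
have : vball z M (insert_coord l (drop_coord l x) (x l 0)) by rewrite insert_drop.
move=> /vball_insert[xU xz']; exists (drop_coord l x) => //.
by rewrite -(chart_unique (t := x l 0)) ?insert_drop.
Qed.

Lemma chart_dQform y : U y -> padic_norm (dQform l (insert_coord l y (chart y))) = q ^ e.
Proof. by move=> yU; rewrite padic_norm_dQform// insert_coord_l chart_norm. Qed.

Lemma chart_hyperboloid y : U y -> hyperboloid m (insert_coord l y (chart y)) /\
  dQform l (insert_coord l y (chart y)) != 0.
Proof.
move=> yU; split; first by have [] := chartP yU.
by rewrite -padic_norm_eq0 chart_dQform// gt_eqF// qX_gt0.
Qed.

(** Divide by [c = chart y]: the square of [chart (y + h) / c] is 1 plus the terms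
    [A_j h_j + B_j h_j^2]. As [|c| = p^e] dominates the coordinates of [y], these terms have Gauss
    norm at most 1 on the polydisc of radius [p^e], and [p^-M] is at least one power of [p]
    smaller. *)
Lemma chart_analytic y : U y -> analytic_at chart y.
Proof.
move=> yU; set c := chart y; have cn : padic_norm c = q ^ e := chart_norm yU.
have c0 : c != 0 by rewrite -padic_norm_eq0 cn gt_eqF// qX_gt0.
pose s j := - (Qsgn p_pr l * Qsgn p_pr (lift l j)).
have sn j : padic_norm (s j) = 1 by rewrite padic_normN padic_normM !padic_norm_Qsgn mulr1.
have cn1 : padic_norm c^-1 = q ^ (- e).
  apply: (mulIf (_ : padic_norm c != 0)); first by rewrite padic_norm_eq0.
  by rewrite -padic_normM mulVf// padic_norm1 cn -expfzDr ?q_neq0// addNr.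
pose A j := s j * (2 * y j 0) / c ^+ 2; pose B j := s j / c ^+ 2.
have gaussA j : padic_norm (A j) * (q ^ e) ^+ 1 <= 1.
  rewrite /A -exprVn expr2 !padic_normM sn padic_norm2// !mul1r cn1 expr1 -!mulrA.
  rewrite -[X in _ * (_ * X)](expfzDr _ _ (q_neq0 p_pr)) addNr mulr1.
  apply: le_trans (ler_wpM2r _ (Uy yU j)) _; first exact/ltW/qX_gt0.
  by rewrite -expfzDr ?q_neq0// subrr.
have gaussB j : padic_norm (B j) * (q ^ e) ^+ 2 <= 1.
  rewrite /B -exprVn !expr2 !padic_normM sn mul1r cn1 mulrACA -!expfzDr ?q_neq0//.
  by rewrite addNr.
have [w [wc ws]] := sqrt_series_quadratic p_odd (qX_gt0 p_pr e) gaussA gaussB.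
exists (fun i => c * w i), (q ^ (- M)), (q ^ e); split; first exact: qX_gt0.
  move=> i; rewrite padic_normM cn -mulrA ler_piMr ?(ltW (qX_gt0 _ _))//.
  apply: le_trans (wc i); rewrite ler_wpM2l ?padic_norm_ge0//.
  by rewrite lerXn2r ?nnegrE ?(ltW (qX_gt0 _ _))// ler_qX// ltW.
move=> h hM; have hM' i : padic_norm (h i 0) <= q ^ (- M).
  exact: (@vnorm_le _ _ _ h _ (ltW (qX_gt0 p_pr (- M)))).1 (ltW hM) i.
have yhU : U (y + h).
  by apply: vballD _ yU; apply/vball0P.
have [/sqrE gE gz] := chartP yhU.
have gc : padic_norm (chart (y + h) - c) <= q ^ (- M).
  have [_ cz] := chartP yU.
  by rewrite -(subrKA (z l 0)) padic_normD_le// padic_norm_distC.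
have hM1 i : padic_norm (h i 0) <= q ^ e / q.
  apply: le_trans (hM' i) _; rewrite -exprN1 -expfzDr ?q_neq0// ler_qX//; lia.
have root2 : (chart (y + h) / c) ^+ 2 = 1 + \sum_j (A j * h j 0 + B j * h j 0 ^+ 2).
  have c20 : c ^+ 2 != 0 by exact: expf_neq0.
  rewrite expr_div_n gE; apply: (mulIf c20).
  rewrite (divfK c20) mulrDl mul1r mulr_suml.
  have cK (u v : K) : u / c ^+ 2 * v * c ^+ 2 = u * v by rewrite mulrAC (divfK c20).
  have -> : \sum_j (A j * h j 0 + B j * h j 0 ^+ 2) * c ^+ 2 =
      \sum_j s j * (2 * y j 0 * h j 0 + h j 0 ^+ 2).
    apply: eq_bigr => j _; rewrite mulrDl /A /B.
    by rewrite (cK (s j * (2 * y j 0)) (h j 0)) (cK (s j) (h j 0 ^+ 2)) mulrDr -!mulrA.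
  have [/sqrE cE _] := chartP yU; rewrite [c ^+ 2]cE.
  rewrite !mulrBr -addrA; congr (_ + _).
  rewrite !mulr_sumr -!sumrN -big_split /=; apply: eq_bigr => j _.
  rewrite !mxE /s; move: (Qsgn p_pr l) (Qsgn p_pr (lift l j)) (y j 0) (h j 0); clear.
  move=> a b u v; ring.
have root1 : padic_norm (chart (y + h) / c - 1) < 1.
  have -> : chart (y + h) / c - 1 = (chart (y + h) - c) / c by rewrite mulrBl divff.
  rewrite padic_normM cn1; apply: le_lt_trans (ler_wpM2r _ gc) _; first exact/ltW/qX_gt0.
  by rewrite -expfzDr ?q_neq0// -[ltRHS](expr0z q) ltr_qX//; lia.
apply: (padic_cvg (qX_gt0 p_pr e)) => N.
have -> : \sum_(i : {ffun 'I_3 -> 'I_N}) c * w [ffun j => i j : nat] * \prod_j h j 0 ^+ i j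
    - chart (y + h) = c * (\sum_(i : {ffun 'I_3 -> 'I_N}) w [ffun j => i j : nat] *
    \prod_j h j 0 ^+ i j - chart (y + h) / c).
  rewrite mulrBr mulr_sumr [c * (_ / _)]mulrCA divff// mulr1; congr (_ - _).
  by apply: eq_bigr => i _; rewrite mulrA.
by rewrite padic_normM cn ler_wpM2l ?ws// ltW// qX_gt0.
Qed.

End Chart.

(** * The Gel'fand-Leray measure *)

Section Shell.
Variables (p : nat) (p_pr : prime p) (m : padic p_pr).
Local Notation K := (padic p_pr).
Local Notation q := (p%:R : rat).
Local Notation V4 := ('cV[K]_4).

Definition shell (n : nat) : set V4 :=
  [set k | padic_norm (Qform k - m ^+ 2) <= q ^ (- n%:Z)].

Lemma shell_open n : open (shell n).
Proof.
rewrite openE => x xn; have [k kx] := qX_large p_pr (vnorm x).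
have kx' : forall i, padic_norm (x i 0) <= q ^ k%:Z by apply/vnorm_le; rewrite ?(ltW (qX_gt0 _ _)).
apply: filterS (near_vball x (n + k)%N%:Z) => y xy; rewrite /shell /=.
have yk i : padic_norm (y i 0) <= q ^ k%:Z.
  rewrite -[y i 0](subrK (x i 0)) padic_normD_le// (le_trans (xy i))// ler_qX//; lia.
rewrite -[Qform y](subrK (Qform x)) -addrA padic_normD_le//.
apply: le_trans (Qform_dist yk kx' xy) _.
by rewrite -expfzDr ?q_neq0// ler_qX//; lia.
Qed.

Lemma shell_measurable n : measurable (shell n : set (padic_borel p_pr 4)).
Proof. by apply: open_measurable_padic; exact: shell_open. Qed.

Lemma hyperboloid_shell n : hyperboloid m `<=` shell n.
Proof. by move=> x xm; rewrite /shell /= xm subrr padic_norm0 ltW// qX_gt0. Qed.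

Lemma hyperboloid_measurable : measurable (hyperboloid m : set (padic_borel p_pr 4)).
Proof.
have -> : hyperboloid m = \bigcap_n shell n.
  apply/seteqP; split=> [x xm n _|x xn]; first exact: hyperboloid_shell.
  apply/eqP; rewrite -subr_eq0; apply/eqP/padic_norm_small => n; exact: xn.
by apply: bigcapT_measurable => n; exact: shell_measurable.
Qed.

End Shell.

Section GelfandLeray.
Variables (R : realType) (p : nat) (p_pr : prime p) (p_odd : p <> 2%N).
Local Notation K := (padic p_pr).
Local Notation q := (p%:R : rat).
Local Notation pR := (p%:R : R).
Local Notation V4 := ('cV[K]_4).
Variables (m : K) (m_neq0 : m <> 0).

Let pR_gt0 : 0 < pR. Proof. by rewrite ltr0n prime_gt0. Qed.
Let pR_neq0 : pR != 0. Proof. by rewrite gt_eqF. Qed.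

Lemma normalized_haar_vball n (mu : {measure set (padic_borel p_pr n) -> \bar R}) :
  normalized_haar mu ->
  forall z (N : int), mu (vball z N) = (pR ^ (- (n%:Z * N)))%:E.
Proof.
move=> [inv mu1] z N; rewrite (haar_vball (k := 1) inv) ?mul1r// -mu1.
congr (mu _); apply/seteqP; split=> x; first by move=> /vball0_vnorm; rewrite oppr0 expr0z.
by move=> x1; apply/vball0_vnorm; rewrite oppr0 expr0z.
Qed.

Variables (mu3 : {measure set (padic_borel p_pr 3) -> \bar R})
  (mu4 lam : {measure set (padic_borel p_pr 4) -> \bar R}).
Hypotheses (haar3 : normalized_haar mu3) (haar4 : normalized_haar mu4)
  (lamP : gelfand_leray mu3 m lam).

Lemma gelfand_leray_off (A : set V4) : measurable (A : set (padic_borel p_pr 4)) ->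
  A `&` hyperboloid m = set0 -> lam A = 0%E.
Proof.
move=> mA A0; have mV := measurableC (hyperboloid_measurable m).
apply/eqP; rewrite -measure_le0; have [<- _] := lamP.
apply: le_measure; rewrite ?inE//.
by move=> x Ax xm; have : set0 x by rewrite -A0.
Qed.

(** The derivative of [Q] in the [l]-th coordinate has constant norm [p^e] on the chart, which
    contributes [p^-e]; the base of the chart is a ball of Haar measure [p^(-3M)]. *)
Lemma gelfand_leray_vball (z : V4) (l : 'I_4) (e M : int) :
  hyperboloid m z -> padic_norm (z l 0) = q ^ e ->
  (forall i, padic_norm (z i 0) <= q ^ e) -> - M < e ->
  lam (vball z M) = (pR ^ (- (e + 3 * M)))%:E.
Proof.
move=> zm ze zl Me; have mB : measurable (vball z M : set (padic_borel p_pr 4)) := vball_measurable z M.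
rewrite (measureDI lam mB (hyperboloid_measurable m)).
rewrite [X in (X + _)%E]gelfand_leray_off ?add0e; last 2 first.
- exact: measurableD (hyperboloid_measurable m).
- by rewrite setDE -setIA setICl setI0.
rewrite -(chart_image p_odd zm ze zl Me).
have [_ lamU] := lamP.
apply: etrans (lamU l (vball (drop_coord l z) M) (chart m z l M) _ _ _) _; last first.
- rewrite (eq_integral (cst (pR ^ (- e))%:E)); last first.
    move=> y /set_mem yU; rewrite (chart_dQform p_odd zm ze zl Me yU) invr_expz.
    by rewrite /cst fmorphXz /= rmorph_nat.
  rewrite integral_cst; last exact: vball_measurable.
  rewrite (normalized_haar_vball haar3) -EFinM -expfzDr//.
  by congr ((_ ^ _)%:E); lia.
- exact: (chart_hyperboloid p_odd zm ze zl Me).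
- exact: (chart_analytic p_odd zm ze zl Me).
- exact: unif_open (@unif_vball_id _ _ _ _ _).
Qed.

Let m0 : m != 0. Proof. exact/eqP. Qed.
Local Notation em := (- padic_ord m).

Let mn : padic_norm m = q ^ em. Proof. exact: padic_norm_neq0. Qed.

Let m2n : padic_norm (m ^+ 2) = q ^ (em + em).
Proof. by rewrite expr2 padic_normM mn expfzDr ?q_neq0. Qed.

(** Packaged as a measure so that it can be compared with [lam] ball by ball. *)
Let thickening (n : nat) : {measure set (padic_borel p_pr 4) -> \bar R} :=
  mscale (NngNum (exprn_ge0 n (ltW pR_gt0))) (mrestr mu4 (shell_measurable m n)).

Let thickeningE n A : thickening n A = ((pR ^+ n)%:E * mu4 (A `&` shell m n))%E.
Proof. by []. Qed.

(** The three bounds say that the ball is smaller than [|m|], that the scale [n + e] refines [M0]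
    whenever [e >= em], and that the shell stays away from [Q = 0]. *)
Lemma gelfand_leray_shell_vball (M0 n : nat) (z0 : V4) : - M0%:Z < em -> M0%:Z - em <= n%:Z ->
  - n%:Z < em + em -> lam (vball z0 M0) = thickening n (vball z0 M0).
Proof.
move=> M0m nM0 nm; have [l lmax] := vnorm_attained z0.
have mB := vball_measurable z0 M0.
(* Either all coordinates stay below [|m|] on the ball, and [|Q| < |m^2|] keeps it off the shell, or
   the [l]-th coordinate has constant norm [p^e >= |m|] and dominates the others. *)
have [small|big] := ltP (padic_norm (z0 l 0)) (q ^ em).
  have xs x : vball z0 M0 x -> forall i, padic_norm (x i 0) <= q ^ (em - 1).
    move=> xz i; rewrite (_ : em - 1 = - (1 - em)); last by lia.
    rewrite padic_norm_le_ltS (_ : 1 - (1 - em) = em); last by lia.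
    rewrite -[x i 0](subrK (z0 i 0)) padic_normD_lt//.
      by rewrite (le_lt_trans (xz i))// ltr_qX.
    exact: le_lt_trans (lmax i) small.
  have off : vball z0 M0 `&` shell m n = set0.
    rewrite -subset0 => x [xz]; rewrite /shell /= => xn.
    have Qx : padic_norm (Qform x) < padic_norm (- m ^+ 2).
      rewrite padic_normN m2n (le_lt_trans (padic_norm_Qform_le (xs x xz)))//.
      by rewrite expr2 -expfzDr ?q_neq0// ltr_qX//; lia.
    move: xn; rewrite addrC padic_norm_eqD// padic_normN m2n ler_qX//; lia.
  rewrite thickeningE off measure0 mule0 gelfand_leray_off//.
  by rewrite -subset0 -off; apply: setIS; exact: hyperboloid_shell.
have z0l0 : z0 l 0 != 0.
  by rewrite -padic_norm_eq0 gt_eqF// (lt_le_trans _ big)// qX_gt0.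
pose e := - padic_ord (z0 l 0).
have z0e : padic_norm (z0 l 0) = q ^ e by exact: padic_norm_neq0.
have ee : em <= e by move: big; rewrite z0e ler_qX.
have M0e : - M0%:Z < e by lia.
have xe x : vball z0 M0 x -> padic_norm (x l 0) = q ^ e.
  by move=> xz; apply: padic_norm_near z0e M0e (xz l).
have xle x : vball z0 M0 x -> forall i, padic_norm (x i 0) <= q ^ e.
  move=> xz i; rewrite -[x i 0](subrK (z0 i 0)) padic_normD_le// -?z0e//.
  by rewrite z0e (le_trans (xz i))// ler_qX// ltW.
(* At this scale a small ball meeting the hyperboloid lies entirely in the shell. *)
have [M ME] : exists M : nat, M%:Z = n%:Z + e by exists `|(n%:Z + e)%R|%N; lia.
have M0M : M0%:Z <= M%:Z by lia.
have sub x : vball z0 M0 x -> vball x M `<=` vball z0 M0.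
  by move=> xz y xy; apply: vball_trans xz (vball_mono M0M xy).
apply: (measure_eq_unif (N := M)); first exact: unif_vball.
move=> x xz; rewrite thickeningE; have mBx := vball_measurable x M.
have [/eqP off|/set0P[z [xz' zm]]] := boolP (vball x M `&` hyperboloid m == set0).
  (* A small ball that misses the hyperboloid misses the shell too, since a point of the shell has
     an exact solution within [p^-M]. *)
  rewrite gelfand_leray_off// (_ : _ `&` _ = set0) ?measure0 ?mule0//.
  rewrite -subset0 => y [xy yn]; have yz := sub x xz y xy.
  have [|||w wm yw] := @Qform_root_near _ _ p_odd m y l e M; first exact: xe.
  - by lia.
  - by rewrite -expfzDr ?q_neq0// (_ : - M%:Z + e = - n%:Z)//; lia.
  by have : set0 w by [rewrite -off; split=> //; exact: vball_trans xy yw].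
have zz := sub x xz z xz'; rewrite (vball_eq xz').
rewrite (gelfand_leray_vball zm (xe z zz) (xle z zz)); last by lia.
have -> : vball z M `&` shell m n = vball z M.
  apply: setIidl => y zy; have yz := sub x xz y (vball_trans xz' zy).
  rewrite /shell /= -zm; apply: le_trans (Qform_dist (xle y yz) (xle z zz) zy) _.
  by rewrite -expfzDr ?q_neq0// ler_qX//; lia.
rewrite (normalized_haar_vball haar4) -EFinM exprnP -expfzDr//.
by congr ((_ ^ _)%:E); lia.
Qed.

(* The bound on [n] depends on [M0] only, not on [A], which may be unbounded. *)
Lemma gelfand_leray_shell (M0 : nat) : - M0%:Z < em ->
  exists n : nat, forall A : set V4, unif M0 A ->
    lam A = ((pR ^+ n)%:E * mu4 (A `&` shell m n))%E.
Proof.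
move=> M0m; exists (`|(M0%:Z - em)%R|%N.+1 + `|(em + em)%R|%N.+1)%N => A uA.
by apply: (measure_eq_unif (m2 := thickening _) uA) => z _; apply: gelfand_leray_shell_vball; lia.
Qed.

End GelfandLeray.

(** * Linear changes of variables in the Haar and Gel'fand-Leray measures *)

Section LinearChange.
Variables (R : realType) (p : nat) (p_pr : prime p).
Local Notation K := (padic p_pr).
Local Notation q := (p%:R : rat).
Local Notation pR := (p%:R : R).

Lemma mulmx_vball n (L : 'M[K]_n) : exists c : nat, forall (x y : 'cV[K]_n) (N : int),
  vball x (N + c%:Z) y -> vball (L *m x) N (L *m y).
Proof.
have [c cP] := qX_large p_pr (\big[Num.max/0]_(ij : 'I_n * 'I_n) padic_norm (L ij.1 ij.2)).
exists c => x y N xy i; rewrite !mxE -sumrB; apply: padic_norm_sum_le => [|j _].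
  exact/ltW/qX_gt0.
rewrite -mulrBr padic_normM (_ : - N = c%:Z + (- (N + c%:Z))); last by lia.
rewrite expfzDr ?q_neq0// ler_pM ?padic_norm_ge0//.
by apply: le_trans cP; apply: (le_bigmax _ (fun ij => padic_norm (L ij.1 ij.2)) (i, j)).
Qed.

Lemma mulmx_preimage_unif n (L : 'M[K]_n) (N : nat) (A : set 'cV[K]_n) : unif N A ->
  exists M : nat, unif M ([set x | A (L *m x)]).
Proof.
move=> uA; have [c cP] := mulmx_vball L; exists (N + c)%N => x y Ax xy.
by apply: uA Ax (cP _ _ _ _); rewrite -PoszD.
Qed.

Lemma mulmx_measurable n (L : 'M[K]_n) :
  measurable_fun setT ((fun x => L *m x) : padic_borel p_pr n -> padic_borel p_pr n).
Proof.
move=> mD; apply: (@measurability _ _ (padic_borel p_pr n) (padic_borel p_pr n) _ _ (@open 'cV[K]_n)) => //.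
move=> _ [A oA <-]; rewrite setTI; apply: open_measurable_padic.
rewrite openE => x Ax; have [c cP] := mulmx_vball L.
have /nbhs_vballP[N NA] : nbhs (L *m x) A by exact: open_nbhs_nbhs.
by apply: filterS (near_vball x (N%:Z + c%:Z)) => y xy; apply: NA; exact: cP.
Qed.

Lemma pushforward_measureE d d' (T1 : measurableType d) (T2 : measurableType d')
    (mu : {measure set T1 -> \bar R}) (f : T1 -> T2) : measurable_fun [set: T1] f ->
  exists nu : {measure set T2 -> \bar R}, (nu : set T2 -> \bar R) = pushforward mu f.
Proof.
by move=> mf; unshelve eexists (pushforward mu f : {measure set T2 -> \bar R}).
Qed.

(** The image of [mu] under [L] is again translation invariant, hence a multiple of [mu]; the factor
    is its value on the unit ball. *)
Lemma haar_mulmx n (mu : {measure set (padic_borel p_pr n) -> \bar R}) (L : 'M[K]_n) :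
  normalized_haar mu -> L \in unitmx ->
  exists2 k : R, 0 < k & forall A : set (padic_borel p_pr n), measurable A ->
    mu [set x | A (L *m x)] = (k%:E * mu A)%E.
Proof.
move=> haar Lu; have p0 : 0 < pR by rewrite ltr0n prime_gt0.
have [nu nuE] := pushforward_measureE mu (mulmx_measurable L).
have nuA A : nu A = mu [set x | A (L *m x)] by rewrite nuE.
have inv (a : 'cV[K]_n) (A : set (padic_borel p_pr n)) : measurable A ->
    nu [set a + x | x in (A : set 'cV[K]_n)] = nu A.
  move=> mA; rewrite !nuA; have [+ _] := haar => /(_ (invmx L *m a)) H.
  have mA' : measurable ([set x | A (L *m x)] : set (padic_borel p_pr n)).
    by rewrite -[X in measurable X]setTI; exact: mulmx_measurable.
  rewrite -(H _ mA'); congr (mu _); apply/seteqP; split=> [x [y Ay yx]|_ [y Ay <-]].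
    exists (x - invmx L *m a); last by rewrite addrC subrK.
    by rewrite /= mulmxBr mulKVmx// -yx addrC addKr.
  by exists (L *m y) => //; rewrite mulmxDr mulKVmx.
have [c cP] := mulmx_vball L; have [c' c'P] := mulmx_vball (invmx L).
(* [lo] and [hi] trap the preimage of the unit ball between two balls, which makes the factor
   positive and finite. *)
have lo : (mu (vball 0 c%:Z) <= nu (vball 0 0))%E.
  rewrite nuA; apply: le_measure; rewrite ?inE.
  - exact: vball_measurable.
  - rewrite -[X in measurable X]setTI; apply: mulmx_measurable => //.
    exact: vball_measurable.
  - by move=> x x0; rewrite /= -(mulmx0 _ L); apply: cP; rewrite add0r.
have hi : (nu (vball 0 0) <= mu (vball 0 (- c'%:Z)))%E.
  rewrite nuA; apply: le_measure; rewrite ?inE.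
  - rewrite -[X in measurable X]setTI; apply: mulmx_measurable => //.
    exact: vball_measurable.
  - exact: vball_measurable.
  - move=> x; rewrite /= => x0; rewrite -(mulKmx Lu x) -(mulmx0 _ (invmx L)).
    by apply: c'P; rewrite addNr.
rewrite (normalized_haar_vball haar) in lo; rewrite (normalized_haar_vball haar) in hi.
have nufin : nu (vball 0 0) \is a fin_num.
  by rewrite ge0_fin_numE// (le_lt_trans hi)// ltry.
pose k := fine (nu (vball 0 0)); have kE : nu (vball 0 0) = k%:E by rewrite fineK.
have k0 : 0 < k.
  by rewrite -lte_fin -kE; apply: lt_le_trans lo; rewrite lte_fin exprz_gt0.
exists k => // A mA; rewrite -nuA.
pose nu' : {measure set (padic_borel p_pr n) -> \bar R} := mscale (NngNum (ltW k0)) mu.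
rewrite (@measure_eq_balls _ _ _ _ nu nu' 0)//.
  move=> z N _; rewrite (haar_vball inv kE) /nu' /= /mscale (normalized_haar_vball haar).
  by rewrite -EFinM.
by move=> j; rewrite (haar_vball inv kE) ltry.
Qed.

(** As [Q] is preserved, the preimage of a shell is the same shell; the thickened formula then turns
    the scaling of [mu4] into the same scaling of [lam]. *)
Lemma gelfand_leray_mulmx (p_odd : p <> 2%N) (m : K) (m_neq0 : m <> 0)
  (mu3 : {measure set (padic_borel p_pr 3) -> \bar R})
  (mu4 lam : {measure set (padic_borel p_pr 4) -> \bar R})
  (haar3 : normalized_haar mu3) (haar4 : normalized_haar mu4)
  (lamP : gelfand_leray mu3 m lam) (L : 'M[K]_4) (k : R) : 0 < k ->
  (forall x, Qform (L *m x) = Qform x) ->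
  (forall A : set (padic_borel p_pr 4), measurable A ->
    mu4 [set x | A (L *m x)] = (k%:E * mu4 A)%E) ->
  forall A : set (padic_borel p_pr 4), measurable A ->
    lam [set x | A (L *m x)] = (k%:E * lam A)%E.
Proof.
move=> k0 LQ mu4L; have [nu nuE] := pushforward_measureE lam (mulmx_measurable L).
have nuA A : nu A = lam [set x | A (L *m x)] by rewrite nuE.
pose lam' : {measure set (padic_borel p_pr 4) -> \bar R} := mscale (NngNum (ltW k0)) lam.
have [N0 N0m] : exists N0 : nat, - N0%:Z < - padic_ord m.
  by exists `|padic_ord m|%N.+1; lia.
have lamB z (N : nat) : (N0 <= N)%N -> nu (vball z N) = lam' (vball z N).
  move=> N0N; rewrite nuA /lam' /= /mscale /=.
  have [M uM] := mulmx_preimage_unif L (@unif_vball_id _ _ _ z N).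
  (* A scale at which the ball and its preimage are both [unif], so that one thickness [n] serves
     both. *)
  pose M0 := maxn N M.
  have M0m : - M0%:Z < - padic_ord m.
    by rewrite (le_lt_trans _ N0m)// lerN2 lez_nat (leq_trans N0N)// leq_maxl.
  have [n nP] := gelfand_leray_shell p_odd m_neq0 haar3 haar4 lamP M0m.
  have uW (j : nat) (A : set 'cV[K]_4) : (j <= M0)%N -> unif j A -> unif M0 A.
    by move=> jM uA x y Ax xy; apply: uA Ax (vball_mono _ xy); rewrite lez_nat.
  rewrite (nP _ (uW _ _ (leq_maxr _ _) uM)).
  rewrite (nP _ (uW _ _ (leq_maxl _ _) (@unif_vball_id _ _ _ z N))).
  rewrite muleCA -mu4L; last first.
    by apply: measurableI; [exact: vball_measurable|exact: shell_measurable].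
  congr (_ * mu4 _)%E; apply/seteqP.
  by split=> x [xz xn]; split=> //; move: xn; rewrite /shell /= LQ.
move=> A mA; rewrite -nuA (measure_eq_balls (m2 := lam') lamB)// => j.
(* What remains is the finiteness of the image measure on large balls, again read off Haar measure
   through the thickened formula. *)
rewrite nuA; have [|M uM] := @mulmx_preimage_unif _ L 0 (vball 0 (- j%:Z)).
  by apply: unif_vball; lia.
pose M0 := maxn N0 M.
have M0m : - M0%:Z < - padic_ord m.
  by rewrite (le_lt_trans _ N0m)// lerN2 lez_nat leq_maxl.
have [n nP] := gelfand_leray_shell p_odd m_neq0 haar3 haar4 lamP M0m.
rewrite nP; last first.
  by move=> x y Ax xy; apply: uM Ax (vball_mono _ xy); rewrite lez_nat leq_maxr.
have mB : measurable ([set x | vball 0 (- j%:Z) (L *m x)] : set (padic_borel p_pr 4)).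
  by rewrite -[X in measurable X]setTI; apply: mulmx_measurable => //; exact: vball_measurable.
apply: (@le_lt_trans _ _ ((pR ^+ n)%:E * mu4 [set x | vball 0 (- j%:Z) (L *m x)])%E).
  rewrite lee_wpmul2l ?lee_fin ?exprn_ge0//; apply: le_measure; rewrite ?inE//.
  by apply: measurableI => //; exact: shell_measurable.
rewrite mu4L ?(normalized_haar_vball haar4) -?EFinM ?ltry//; exact: vball_measurable.
Qed.

End LinearChange.

(** * Test functions *)

Section TestFunctions.
Variables (R : realType) (p : nat) (p_pr : prime p) (n : nat).
Local Notation K := (padic p_pr).
Local Notation q := (p%:R : rat).
Local Notation V := ('cV[K]_n).
Local Notation Vb := (padic_borel p_pr n).
Local Notation C := R[i].
Implicit Types (f : V -> C) (phi : test_fun R p_pr n).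

(** One integer controls both the scale [p^-N] of constancy and the radius [p^N] of the support. *)
Definition schwartz (N : nat) f :=
  (forall x y, vball x N y -> f y = f x) /\ (forall x, f x != 0 -> vball 0 (- N%:Z) x).

Lemma schwartz_leq N M f : (N <= M)%N -> schwartz N f -> schwartz M f.
Proof.
move=> NM [lf sf]; split=> [x y xy|x fx].
  by apply: lf; apply: vball_mono xy; rewrite lez_nat.
by apply: vball_mono (sf x fx); rewrite lerN2 lez_nat.
Qed.

Lemma schwartz_out N f x : schwartz N f -> ~ vball 0 (- N%:Z) x -> f x = 0.
Proof. by move=> [_ sf] nx; apply/eqP; apply: contra_notT nx; exact: sf. Qed.

Lemma schwartz_test N f : schwartz N f -> (f : V -> C^o) \in @test_pred R p p_pr n.
Proof.
move=> [lf sf]; apply/asboolP; split=> [x|].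
  by apply: filterS (near_vball x N) => y; exact: lf.
have cB := @vball_compact _ p_pr n 0 (- N%:Z).
apply: (subclosed_compact _ cB); first exact: closed_closure.
rewrite closureE => x; apply; split; last exact: sf.
exact: unif_closed (@unif_vball_id _ _ _ _ _).
Qed.

Lemma to_testK N f : schwartz N f -> test_val (to_test f) = f.
Proof. by move=> /schwartz_test fP; rewrite /test_val /to_test insubdK. Qed.

(** Compactness of the support makes the pointwise scales of constancy uniform. *)
Lemma test_schwartz phi : exists N, schwartz N (test_val phi).
Proof.
have /asboolP[lf cf] := valP phi; set f := test_val phi; set S := [set x | f x != 0].
pose P (N : nat) (x : V) := vball 0 (- N%:Z) x /\ forall y, vball x N y -> f y = f x.
have [N _ NP] : \forall N \near \oo, closure S `<=` P N.
  have /compact_near_coveringP := cf; apply => x _.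
  have /nbhs_vballP[M xM] := lf x; have [k kx] := qX_large p_pr (vnorm x).
  exists (vball x M%:Z, [set N | (maxn k M <= N)%N]) => /=.
    by split; [exact: near_vball|exists (maxn k M)].
  move=> [y N] /= [xy]; rewrite geq_max => /andP[kN MN]; split.
    apply: (@vball_trans _ _ _ _ _ x).
      by apply: (@vball_mono _ _ _ _ (- k%:Z)); [lia|apply/vball0_vnorm; rewrite opprK].
    by apply: vball_mono xy; lia.
  move=> z yz; apply: etrans (esym (xM y xy)); apply: xM; apply: vball_trans xy (vball_mono _ yz).
  by rewrite lez_nat.
have SP x : f x != 0 -> P N x by move=> fx; apply: (NP N (leqnn N)); exact: subset_closure.
exists N; split=> [x y xy|x /SP[]//].
(* Outside the support uniformity comes by symmetry: a nonzero value at [y] would be shared by [x],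
   which lies in the ball around [y]. *)
have [fx|/SP[_ ->//]] := eqVneq (f x) 0.
have [fy|/SP[_ H]] := eqVneq (f y) 0; first by rewrite fy.
by rewrite (H x (vball_sym xy)).
Qed.

Lemma schwartz_unif N f (P : C -> Prop) : schwartz N f -> unif N [set x | P (f x)].
Proof. by move=> [lf _] x y; rewrite /= => Px /lf ->. Qed.

Lemma schwartz_measurable N f (g : C -> R) (D : set Vb) : schwartz N f ->
  measurable_fun D (fun x : Vb => g (f x)).
Proof.
move=> sf mD Y mY; apply: measurableI => //.
apply: (@unif_measurable _ _ _ N).
exact: (@schwartz_unif _ _ (fun c => Y (g c)) sf).
Qed.

Lemma schwartz_bounded N f (g : C -> R) : schwartz N f ->
  exists2 B, 0 <= B & forall x, `|g (f x)| <= B.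
Proof.
move=> sf; pose T := {ffun 'I_n -> 'I_(p ^ (N + N))}.
pose B := \sum_(a : T) `|g (f (grid p_pr a))| + `|g 0|.
have S0 : 0 <= \sum_(a : T) `|g (f (grid p_pr a))| by exact: sumr_ge0.
exists B => [|x]; first exact: addr_ge0.
have [xN|nx] := pselect (vball 0 (- N%:Z) x); last first.
  by rewrite (schwartz_out sf nx) lerDr.
have [a ax] := grid_cover N xN; rewrite (sf.1 _ _ ax).
by rewrite /B (bigD1 a) //= -addrA lerDl addr_ge0// sumr_ge0.
Qed.

(** [g] stands for the real part, the imaginary part, or real multiples and absolute values of
    these; [g 0 = 0] keeps the support bounded. *)
Lemma schwartz_integrable N f (g : C -> R) (mu : {measure set Vb -> \bar R}) (D : set Vb) :
  g 0 = 0 -> schwartz N f -> (mu (vball 0 (- N%:Z)) < +oo)%E -> measurable D ->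
  mu.-integrable D (EFin \o (fun x => g (f x))).
Proof.
move=> g0 sf muN mD; apply: (@integrableS _ _ _ _ setT) => //.
have mB := vball_measurable (0 : V) (- N%:Z).
have [B B0 Bf] := schwartz_bounded g sf.
have E : (EFin \o (fun x => g (f x))) \_ (vball 0 (- N%:Z) : set Vb) =
    EFin \o (fun x => g (f x)).
  apply/funext => x; rewrite patchE; case: ifPn => //; rewrite notin_setE => nx.
  by rewrite /= (schwartz_out sf nx) g0.
rewrite -E; apply/(integrable_mkcond _ mB).1; apply: measurable_bounded_integrable => //.
  exact: schwartz_measurable sf.
exists B; split; first exact: num_real.
by move=> M BM x _ /=; rewrite (le_trans (Bf x))// ltW.
Qed.

Definition ball_test (z : V) (N : nat) : test_fun R p_pr n :=
  to_test (fun x => if `[< vball z N x >] then 1 else 0).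

Lemma ball_test_schwartz z (N : nat) :
  exists M, schwartz M (fun x => if `[< vball z N x >] then 1 else 0 : C).
Proof.
have [k kz] := qX_large p_pr (vnorm z).
exists (N + k)%N; split=> [x y xy|x].
  have xy' : vball x N y by apply: vball_mono xy; lia.
  congr (if _ then _ else _); apply: asbool_equiv_eq; split=> [zy|zx].
    exact: vball_trans zy (vball_sym xy').
  exact: vball_trans zx xy'.
case: asboolP => [zx _|_]; last by rewrite eqxx.
apply: (@vball_trans _ _ _ _ _ z).
  by apply: (@vball_mono _ _ _ _ (- k%:Z)); [lia|apply/vball0_vnorm; rewrite opprK].
by apply: vball_mono zx; lia.
Qed.

Lemma ball_testE z (N : nat) x :
  test_val (ball_test z N) x = if `[< vball z N x >] then 1 else 0.
Proof. by have [M sM] := ball_test_schwartz z N; rewrite /ball_test (to_testK sM). Qed.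

Lemma test_decomposition phi : exists (k N : nat), phi =
  \sum_(a : {ffun 'I_n -> 'I_(p ^ (k + N))}) test_val phi (grid p_pr a) *: ball_test (grid p_pr a) N.
Proof.
have [N sN] := test_schwartz phi; exists N, N.
apply: val_inj; apply/funext => x.
rewrite -[RHS]/(test_val _ x).
have -> : forall (I : finType) (F : I -> test_fun R p_pr n) x,
    test_val (\sum_i F i) x = \sum_i test_val (F i) x.
  move=> I F y; elim/big_rec2 : _ => [//|i a b _ <-]; by [].
rewrite -[LHS]/(test_val phi x).
have H a : test_val (test_val phi (grid p_pr a) *: ball_test (grid p_pr a) N) x =
    test_val phi (grid p_pr (k := N) (N := N) a) * (if `[< vball (grid p_pr a) N x >] then 1 else 0).
  by rewrite -ball_testE.
under eq_bigr do rewrite H.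
have [xN|nx] := pselect (vball 0 (- N%:Z) x); last first.
  rewrite (schwartz_out sN nx) big1// => a _; case: asboolP => [ax|_]; last by rewrite mulr0.
  by case: nx; apply: vball_trans (grid_sub p_pr a) (vball_mono _ ax); lia.
have [a ax] := grid_cover N xN; rewrite (bigD1 a)//= big1 ?addr0 => [|b ba].
  by case: asboolP => // _; rewrite mulr1 (sN.1 _ _ ax).
by case: asboolP => [bx|_]; [rewrite (grid_inj bx ax) eqxx in ba|rewrite mulr0].
Qed.

(** Every test function is a finite combination of ball indicators, so these suffice to test an
    equality. *)
Lemma linear_test_ext (T1 T2 : test_fun R p_pr n -> C^o) : linear T1 -> linear T2 ->
  (forall z N, T1 (ball_test z N) = T2 (ball_test z N)) -> T1 = T2.
Proof.
move=> l1 l2 T12; apply/funext => phi; have [k [N ->]] := test_decomposition phi.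
have T0 T : linear T -> T 0 = 0 :> C^o.
  by move=> lT; have := lT (-1) 0 0; rewrite scaler0 addr0 scaleN1r addNr.
elim/big_rec : _ => [|a psi _ IH]; first by rewrite !T0.
by rewrite l1 l2 T12 IH.
Qed.

End TestFunctions.

(** * Integrals and the additive character *)

Section ComplexIntegrals.
Variables (R : realType) (p : nat) (p_pr : prime p) (n : nat).
Local Notation K := (padic p_pr).
Local Notation V := ('cV[K]_n).
Local Notation Vb := (padic_borel p_pr n).
Local Notation C := R[i].
Variable mu : {measure set Vb -> \bar R}.

(** The image of [mu] under [phi] is [k] times [mu]. The formula is transferred for non-negative
    functions, then for the positive and negative parts of [h]. *)
Lemma Rintegral_map (phi : Vb -> Vb) (k : R) (D : set Vb) (h : Vb -> R) :
  measurable_fun setT phi -> 0 <= k ->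
  (forall A : set Vb, measurable A -> mu (phi @^-1` A) = (k%:E * mu A)%E) ->
  measurable D -> measurable_fun setT h -> mu.-integrable D (EFin \o h) ->
  Rintegral mu (phi @^-1` D) (h \o phi) = k * Rintegral mu D h.
Proof.
move=> mphi k0 muphi mD mh ih; rewrite /Rintegral.
have [nu nuE] := pushforward_measureE mu mphi.
have ge0_map (g : Vb -> \bar R) : measurable_fun D g -> (forall x, 0 <= g x)%E ->
    (\int[mu]_(x in phi @^-1` D) (g \o phi) x = k%:E * \int[mu]_(x in D) g x)%E.
  move=> mg g0; rewrite -ge0_integral_pushforward// -nuE.
  rewrite (@eq_measure_integral _ _ _ _ (mscale (NngNum k0) mu)).
    by rewrite ge0_integral_mscale.
  by move=> A mA _; rewrite nuE /pushforward muphi.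
have mh' : measurable_fun D (EFin \o h).
  by apply/measurable_EFinP; exact: measurable_funTS.
have -> : (\int[mu]_(x in phi @^-1` D) ((h \o phi) x)%:E =
    k%:E * \int[mu]_(x in D) (h x)%:E)%E.
  rewrite integralE [in RHS]integralE muleBr//; last first.
    rewrite fin_num_adde_defr//.
    exact: integrable_fin_num (integrable_funepos mD ih).
  rewrite -(ge0_map _ (measurable_funepos mh') (@funepos_ge0 _ _ _)).
  rewrite -(ge0_map _ (measurable_funeneg mh') (@funeneg_ge0 _ _ _)).
  by congr (_ - _)%E; rewrite -?funepos_comp -?funeneg_comp.
rewrite fineM//; exact: (integrable_fin_num mD ih).
Qed.

Variables (N : nat) (f : V -> C) (D : set Vb).
Hypotheses (sf : schwartz N f) (muN : (mu (vball 0 (- N%:Z)) < +oo)%E) (mD : measurable D).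

Lemma Cintegral_map (phi : Vb -> Vb) (k : R) : measurable_fun setT phi -> 0 <= k ->
  (forall A : set Vb, measurable A -> mu (phi @^-1` A) = (k%:E * mu A)%E) ->
  Cintegral mu (phi @^-1` D) (f \o phi) = k%:C%C * Cintegral mu D f.
Proof.
move=> mphi k0 muphi; rewrite /Cintegral.
have H g : g 0 = 0 -> Rintegral mu (phi @^-1` D) (fun x => g (f (phi x))) =
    k * Rintegral mu D (fun x => g (f x)).
  move=> g0; rewrite -(@Rintegral_map phi)//.
  - exact: schwartz_measurable sf.
  - exact: schwartz_integrable g0 sf muN mD.
rewrite (H (@complex.Re R))// (H (@complex.Im R))//.
by apply/eqP; rewrite eq_complex /= !mul0r subr0 addr0 !eqxx.
Qed.

Lemma CintegralZ (c : C) : Cintegral mu D (fun x => c * f x) = c * Cintegral mu D f.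
Proof.
case: c => a b; rewrite /Cintegral.
have I g : g 0 = 0 -> mu.-integrable D (EFin \o (fun x => g (f x))).
  by move=> g0; exact: schwartz_integrable g0 sf muN mD.
have ReE x : complex.Re ((a +i* b)%C * f x) = a * complex.Re (f x) - b * complex.Im (f x).
  by case: (f x).
have ImE x : complex.Im ((a +i* b)%C * f x) = a * complex.Im (f x) - (- b) * complex.Re (f x).
  by case: (f x) => u v /=; rewrite mulNr opprK addrC.
have -> : (fun x : Vb => complex.Re ((a +i* b)%C * f x)) =
    fun x => a * complex.Re (f x) - b * complex.Im (f x) by apply/funext.
have -> : (fun x : Vb => complex.Im ((a +i* b)%C * f x)) =
    fun x => a * complex.Im (f x) - (- b) * complex.Re (f x) by apply/funext.
rewrite !RintegralB//; last first.
- by apply: (I (fun z => b * complex.Im z)); rewrite mulr0.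
- by apply: (I (fun z => a * complex.Re z)); rewrite mulr0.
- by apply: (I (fun z => - b * complex.Re z)); rewrite mulr0.
- by apply: (I (fun z => a * complex.Im z)); rewrite mulr0.
rewrite !RintegralZl//; try exact: (I (@complex.Re R)); try exact: (I (@complex.Im R)).
by rewrite mulNr opprK.
Qed.

End ComplexIntegrals.

(** * The additive character *)

Section AdditiveCharacter.
Variables (R : realType) (p : nat) (p_pr : prime p).
Local Notation K := (padic p_pr).
Local Notation q := (p%:R : rat).
Implicit Types (x y : K) (r s : rat).

Lemma padic_nat_eq0 (k : nat) : ((k%:R : K) == 0) = (k == 0%N).
Proof.
apply/eqP/eqP => [k0|->//]; apply/eqP; rewrite -leqn0 leqNgt; apply/negP => k_gt0.
have : (p ^ k %| k)%N by rewrite -(padic_norm_nat_le p_pr) k0 padic_norm0 ltW// qX_gt0.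
by move=> /dvdn_leq => /(_ k_gt0); rewrite leqNgt ltn_expl// prime_gt1.
Qed.

Lemma padic_intr_eq0 (z : int) : ((z%:~R : K) == 0) = (z == 0).
Proof.
case: z => k; first exact: padic_nat_eq0.
by rewrite NegzE mulrNz oppr_eq0 padic_nat_eq0.
Qed.

Lemma ratr_padic (r : rat) (n : nat) (z : int) : r * q ^+ n = z%:~R ->
  ratr r = z%:~R / p%:R ^+ n :> K.
Proof.
move=> rz; have d0 : ((denq r)%:~R : K) != 0 by rewrite padic_intr_eq0 denq_neq0.
have p0 : (p%:R : K) ^+ n != 0 by apply: expf_neq0; exact: prime_neq0.
rewrite /ratr; apply/eqP; rewrite (eqr_div _ _ d0 p0); apply/eqP.
have E : numq r * p%:Z ^+ n = z * denq r.
  apply: (@intr_inj rat); rewrite !rmorphM /= rmorphXn /= -rz.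
  by rewrite numqE -pmulrn; ring.
have := congr1 (fun z : int => z%:~R : K) E.
by rewrite !rmorphM /= rmorphXn /=.
Qed.

Lemma padic_norm_int_le (z : int) (n : nat) : padic_norm (z%:~R : K) <= q ^ (- n%:Z) ->
  exists w : int, z = w * p%:Z ^+ n.
Proof.
case: z => k; last rewrite NegzE mulrNz padic_normN.
  rewrite padic_norm_nat_le => /dvdnP[w ->]; exists w%:Z.
  by rewrite PoszM -[Posz (p ^ n)]natz natrX natz.
rewrite padic_norm_nat_le => /dvdnP[w ->]; exists (- w%:Z).
by rewrite PoszM -[Posz (p ^ n)]natz natrX natz mulNr.
Qed.

Definition padic_frac_rat r := exists n, r * q ^+ n \is a Num.int.

(** Z[1/p] meets Z_p in Z: after multiplication by a common [p^n], an integer of norm at most [p^-n]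
    is divisible by [p^n]. *)
Lemma padic_frac_rat_int r s t : padic_frac_rat r -> padic_frac_rat s -> padic_frac_rat t ->
  padic_norm (ratr t - ratr r - ratr s : K) <= 1 -> t - r - s \is a Num.int.
Proof.
move=> [nr zr] [ns zs] [nt zt].
have E u a b : u * q ^+ a \is a Num.int -> u * q ^+ (a + b) \is a Num.int.
  by move=> ua; rewrite exprD mulrA rpredM ?rpredX ?rpred_nat.
pose n := (nr + ns + nt)%N.
have /intrP[a aE] : r * q ^+ n \is a Num.int by rewrite /n -addnA; exact: E.
have /intrP[b bE] : s * q ^+ n \is a Num.int by rewrite /n -addnA addnCA; exact: E.
have /intrP[c cE] : t * q ^+ n \is a Num.int by rewrite /n addnC; exact: E.
rewrite (ratr_padic aE) (ratr_padic bE) (ratr_padic cE) -!mulrBl -!rmorphB /= => H.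
have p0 : (p%:R : K) ^+ n != 0 by apply: expf_neq0; exact: prime_neq0.
have {}H : padic_norm ((c - a - b)%:~R : K) <= q ^ (- n%:Z).
  rewrite -[_%:~R](divfK p0) padic_normM exprnP padic_norm_expz.
  by rewrite ler_piMl// ltW// qX_gt0.
have [w wE] := padic_norm_int_le H.
have q0 : q ^+ n != 0 by rewrite expf_neq0// q_neq0.
apply/intrP; exists w; apply: (mulIf q0); rewrite !mulrBl aE bE cE -!rmorphB wE.
by rewrite rmorphM /= rmorphXn.
Qed.

(** The fractional part is a choice with default [0], so existence must be shown: cut the digits of
    [x] at position 0. *)
Lemma padic_frac_partP x : [/\ 0 <= padic_frac_part x < 1,
  padic_frac_rat (padic_frac_part x) & padic_norm (x - ratr (padic_frac_part x)) <= 1].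
Proof.
rewrite /padic_frac_part; case: xgetP => [r _ //|H]; exfalso.
have [k kx] := qX_large p_pr (padic_norm x); have [a ax] := padic_digits 0 kx.
have q0 : 0 < q ^+ k by rewrite exprn_gt0// q_gt0.
have aE : (a : nat)%:R / q ^+ k * q ^+ k = ((a : nat)%:Z)%:~R by rewrite divfK ?gt_eqF.
apply: (H ((a : nat)%:R / q ^+ k)); split.
- rewrite divr_ge0 ?ler0n ?(ltW q0)//= ltr_pdivrMr// mul1r -natrX ltr_nat.
  by rewrite -[k in (_ < p ^ k)%N]addn0 ltn_ord.
- by exists k; rewrite aE intr_int.
- by rewrite (ratr_padic aE) exprnN; move: ax; rewrite oppr0 expr0z.
Qed.

Local Notation chi := (@padic_char R p p_pr).

Let cosDint (t : R) (z : int) : cos (t + 2 * pi * z%:~R) = cos t /\ sin (t + 2 * pi * z%:~R) = sin t.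
Proof.
have pos (s : R) (k : nat) : cos (s + 2 * pi * k%:R) = cos s /\ sin (s + 2 * pi * k%:R) = sin s.
  elim: k => [|k [IH1 IH2]]; first by rewrite mulr0 addr0.
  have -> : s + 2 * pi * k.+1%:R = (s + 2 * pi * k%:R) + pi *+ 2.
    by rewrite -[k.+1%:R]natr1 mulrDr mulr1 addrA -[pi *+ 2]mulr_natl.
  by rewrite cosD2pi sinD2pi.
case: z => k; first exact: pos.
have [<- <-] := pos (t + 2 * pi * (Negz k)%:~R) k.+1.
by rewrite -addrA -mulrDr NegzE mulrNz addNr mulr0 addr0.
Qed.

Lemma padic_charD x y : chi (x + y) = chi x * chi y.
Proof.
have [_ fx nx] := padic_frac_partP x; have [_ fy ny] := padic_frac_partP y.
have [_ fxy nxy] := padic_frac_partP (x + y).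
have /intrP[z zE] : padic_frac_part (x + y) - padic_frac_part x - padic_frac_part y \is a Num.int.
  apply: (padic_frac_rat_int fx fy fxy).
  have E (a b c : K) : c - a - b = (x - a) + (y - b) - (x + y - c) by ring.
  rewrite E; exact: (padic_normB_le (padic_normD_le nx ny) nxy).
have E : padic_frac_part (x + y) = padic_frac_part x + padic_frac_part y + z%:~R.
  by rewrite -zE; ring.
have tE : 2 * pi * ratr (padic_frac_part (x + y)) = 2 * pi * ratr (padic_frac_part x) +
    2 * pi * ratr (padic_frac_part y) + 2 * pi * z%:~R :> R.
  by rewrite E !rmorphD /= ratr_int; move: pi (ratr _ : R) (ratr _ : R) => P u v; ring.
rewrite /padic_char tE.
have [-> ->] := cosDint (2 * pi * ratr (padic_frac_part x) + 2 * pi * ratr (padic_frac_part y)) z.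
by rewrite cosD sinD; apply/eqP; rewrite eq_complex /= eqxx /= addrC eqxx.
Qed.

Lemma padic_char_int x : padic_norm x <= 1 -> chi x = 1.
Proof.
move=> x1; have [/andP[f0 f1] fx nx] := padic_frac_partP x.
have /intrP[z zE] : padic_frac_part x - 0 - 0 \is a Num.int.
  have f0' : padic_frac_rat 0 by exists 0%N; rewrite mul0r rpred0.
  apply: (padic_frac_rat_int f0' f0' fx).
  have -> : ratr 0 = 0 :> K by rewrite (ratr_padic (z := 0) (n := 0%N)) mul0r.
  by rewrite !subr0 -[ratr _](subKr x); exact: padic_normB_le.
have z0 : z = 0.
  move: f0 f1; rewrite -[padic_frac_part x]subr0 -[_ - 0]subr0 zE ler0z ltrz1; lia.
rewrite /padic_char; rewrite !subr0 z0 in zE; rewrite zE rmorph0 mulr0 cos0 sin0.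
by apply/eqP; rewrite eq_complex /= !eqxx.
Qed.

(** The fractional part [r] satisfies [0 < r < 1], whereas [cos (2 pi r) = 1] would force
    [sin (pi r) = 0]. *)
Lemma padic_char_neq1 x : 1 < padic_norm x -> chi x != 1.
Proof.
move=> x1; have [/andP[f0 f1] fx nx] := padic_frac_partP x.
set r := padic_frac_part x in f0 f1 fx nx *.
have r0 : 0 < r.
  rewrite lt_neqAle f0 andbT eq_sym; apply: contraTN x1 => /eqP r0.
  by rewrite -leNgt; move: nx; rewrite r0 (ratr_padic (z := 0) (n := 0%N)) mul0r// subr0.
have rR0 : 0 < ratr r :> R by rewrite ltr0q.
have rR1 : ratr r < 1 :> R by rewrite -(rmorph1 (@ratr R)) ltr_rat.
have s0 : 0 < sin (pi * ratr r : R).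
  by apply: sin_gt0_pi; rewrite mulr_gt0 ?pi_gt0//= gtr_pMr// pi_gt0.
apply/eqP => /(congr1 (@complex.Re R)); rewrite /padic_char /= -/r => c1.
have := cos_mulr2n (pi * ratr r : R).
have -> : (pi * ratr r) *+ 2 = 2 * pi * ratr r :> R by rewrite -mulr_natl mulrA.
rewrite c1 cos2sin2 => E; have : sin (pi * ratr r : R) ^+ 2 = 0 by lra.
by apply/eqP; rewrite expf_eq0 /= gt_eqF.
Qed.

End AdditiveCharacter.

(** * Fourier transform *)

Section Fourier.
Variables (R : realType) (p : nat) (p_pr : prime p).
Local Notation K := (padic p_pr).
Local Notation q := (p%:R : rat).
Local Notation V := ('cV[K]_4).
Local Notation Vb := (padic_borel p_pr 4).
Local Notation C := R[i].
Local Notation chi := (@padic_char R p p_pr).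
Implicit Types (x y k z w : V).

Lemma bracketC x y : bracket x y = bracket y x.
Proof. by rewrite !bracketE; apply: eq_bigr => l _; rewrite [x l 0 * _]mulrC. Qed.

Lemma bracketDl x y z : bracket (x + y) z = bracket x z + bracket y z.
Proof.
by rewrite !bracketE -big_split; apply: eq_bigr => l _; rewrite /= mxE mulrDl mulrDr.
Qed.

Lemma bracketDr x y z : bracket z (x + y) = bracket z x + bracket z y.
Proof. by rewrite bracketC bracketDl ![bracket _ z]bracketC. Qed.

Lemma bracket_le x y (r s : rat) : 0 <= r -> (forall i, padic_norm (x i 0) <= r) ->
  (forall i, padic_norm (y i 0) <= s) -> padic_norm (bracket x y) <= r * s.
Proof.
move=> r0 xr ys; have s0 := le_trans (padic_norm_ge0 _) (ys 0).
rewrite bracketE; apply: padic_norm_sum_le => [|i _]; first exact: mulr_ge0.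
by rewrite padic_normM padic_norm_Qsgn mul1r padic_normM ler_pM ?padic_norm_ge0.
Qed.

Lemma bracket_vball x y (M N : int) : 0 <= M + N -> vball 0 M x -> vball 0 N y ->
  padic_norm (bracket x y) <= 1.
Proof.
move=> MN /vball0P xM /vball0P yN.
apply: le_trans (bracket_le (ltW (qX_gt0 p_pr _)) xM yN) _.
by rewrite -expfzDr ?q_neq0// qX_le1//; lia.
Qed.

Lemma char_bracket_local w : exists M : nat, forall x y, vball x M y ->
  chi (bracket y w) = chi (bracket x w).
Proof.
have [k kw] := qX_large p_pr (vnorm w); exists k => x y /vballB xy.
rewrite -[y](subrK x) bracketDl padic_charD padic_char_int ?mul1r//.
apply: (bracket_vball _ xy (N := - k%:Z)); first by rewrite subrr.
by apply/vball0_vnorm; rewrite opprK.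
Qed.

Lemma schwartz_char N (f : V -> C) w : schwartz N f ->
  exists2 M : nat, (N <= M)%N & schwartz M (fun x => chi (bracket x w) * f x).
Proof.
move=> sf; have [k kw] := char_bracket_local w.
exists (maxn N k); first exact: leq_maxl.
have [lf sf'] := schwartz_leq (leq_maxl N k) sf; split=> [x y xy|x].
  rewrite (lf _ _ xy) (kw x y)//; apply: vball_mono xy.
  by rewrite lez_nat leq_maxr.
by rewrite mulf_eq0 negb_or => /andP[_ /sf'].
Qed.

(** The radius is [p^N]: this is the ball dual to [vball 0 N] under the bracket. *)
Definition ball_ind (N : nat) k : C := if `[< vball 0 (- N%:Z) k >] then 1 else 0.

Lemma schwartz_ball_ind (N : nat) : schwartz N (ball_ind N).
Proof.
split=> [x y xy|x]; rewrite /ball_ind; last by case: asboolP => //; rewrite eqxx.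
have xy' : vball x (- N%:Z) y by apply: vball_mono xy; lia.
congr (if _ then _ else _); apply: asbool_equiv_eq; split=> H.
  exact: vball_trans H (vball_sym xy').
exact: vball_trans H xy'.
Qed.

Variable mu4 : {measure set Vb -> \bar R}.
Hypothesis haar4 : normalized_haar mu4.

Let mu_fin z (N : int) : (mu4 (vball z N) < +oo)%E.
Proof. by rewrite (normalized_haar_vball haar4) ltry. Qed.

Lemma Cintegral_translate (N : nat) (f : V -> C) (a : V) : schwartz N f ->
  Cintegral mu4 setT (fun x => f (a + x)) = Cintegral mu4 setT f.
Proof.
move=> sf; have mT : measurable_fun setT ((fun x => a + x) : Vb -> Vb).
  move=> mD; apply: (@measurability _ _ Vb Vb _ _ (@open V)) => //.
  move=> _ [A oA <-]; rewrite setTI; apply: open_measurable_padic.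
  rewrite openE => x Ax; have /nbhs_vballP[M MA] : nbhs (a + x) A by exact: open_nbhs_nbhs.
  apply: filterS (near_vball x M%:Z) => y xy; apply: MA => i.
  by have := xy i; rewrite !mxE opprD addrACA subrr add0r.
have muT (A : set Vb) : measurable A ->
    mu4 ((fun x => a + x : Vb) @^-1` A) = (1%:E * mu4 A)%E.
  move=> mA; have [inv _] := haar4; rewrite mul1e -(inv (- a) A mA); congr (mu4 _).
  apply/seteqP; split=> [x Ax|_ [x Ax <-]]; last by rewrite /= addNKr.
  by exists (a + x) => //; rewrite addKr.
have := Cintegral_map sf (mu_fin _ _) measurableT mT ler01 muT.
by rewrite preimage_setT mul1r => <-.
Qed.

(** Orthogonality of characters: off the dual ball, a translation inside the ball multiplies the
    integral by a number other than 1, so it vanishes. *)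
Lemma Cintegral_char_ball (N : nat) w :
  Cintegral mu4 setT (fun k => chi (bracket k w) * ball_ind N k) =
  if `[< vball 0 N%:Z w >] then ((p ^ (4 * N))%:R : C) else 0.
Proof.
case: asboolP => [wN|wN].
  have -> : (fun k => chi (bracket k w) * ball_ind N k) = ball_ind N.
    apply/funext => k; rewrite /ball_ind; case: asboolP => [kN|_]; last by rewrite mulr0.
    by rewrite mulr1 padic_char_int// (bracket_vball _ kN wN)// addNr.
  have mB : measurable (vball 0 (- N%:Z) : set Vb) := vball_measurable _ _.
  have re : Rintegral mu4 setT (fun x => complex.Re (ball_ind N x)) = (p ^ (4 * N))%:R.
    transitivity (Rintegral mu4 (vball 0 (- N%:Z)) (fun=> 1)).
      rewrite [RHS]Rintegral_mkcond; congr (Rintegral _ _ _); apply/funext => x.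
      rewrite patchE /ball_ind -[x \in _]/(`[< vball 0 (- N%:Z) x >]).
      by case: asboolP.
    by rewrite Rintegral_cst// mul1r (normalized_haar_vball haar4) /= mulrN opprK natrX.
  have im : Rintegral mu4 setT (fun x => complex.Im (ball_ind N x)) = 0.
    transitivity (Rintegral mu4 setT (fun=> 0)); last by rewrite Rintegral_cst// mul0r.
    by congr (Rintegral _ _ _); apply/funext => x; rewrite /ball_ind; case: asboolP.
  by rewrite /Cintegral re im -(rmorph_nat (real_complex R)).
have [l wl] : exists l, q ^ (- N%:Z) < padic_norm (w l 0).
  apply: contrapT => H; apply: wN; apply/vball0P => i; rewrite leNgt; apply/negP => wi.
  by apply: H; exists i.
(* The largest vector of the ball along a coordinate where [w] is too big, which makes [|[a, w]| >
   1]. *)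
pose a : V := \col_i (if i == l then p%:R ^ (- N%:Z) else 0).
have aN : vball 0 (- N%:Z) a.
  apply/vball0P => i; rewrite mxE; case: ifP => _; last by rewrite padic_norm0 ltW// qX_gt0.
  by rewrite padic_norm_expz.
have aw : bracket a w = Qsgn p_pr l * (p%:R ^ (- N%:Z) * w l 0).
  rewrite bracketE (bigD1 l) //= mxE eqxx big1 ?addr0// => i /negbTE il.
  by rewrite mxE il mul0r mulr0.
have chia : chi (bracket a w) != 1.
  apply: padic_char_neq1; rewrite aw !padic_normM padic_norm_Qsgn mul1r padic_norm_expz opprK.
  by rewrite mulrC -ltr_pdivrMr ?qX_gt0// div1r invr_expz.
have [M _ sM] := schwartz_char w (schwartz_ball_ind N).
have := Cintegral_translate a sM.
have -> : (fun x => chi (bracket (a + x) w) * ball_ind N (a + x)) =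
    (fun x => chi (bracket a w) * (chi (bracket x w) * ball_ind N x)).
  apply/funext => x; rewrite bracketDl padic_charD -mulrA; congr (_ * (_ * _)).
  rewrite /ball_ind; congr (if _ then _ else _); apply: asbool_equiv_eq; split=> H.
    move: H aN => /vball0P H /vball0P aN; apply/vball0P => i.
    have -> : x i 0 = (a + x) i 0 - a i 0 by rewrite mxE addrC addKr.
    exact: padic_normB_le (H i) (aN i).
  by rewrite addrC; exact: vballD aN H.
rewrite (CintegralZ sM (mu_fin _ _) measurableT) => /eqP.
rewrite -subr_eq0 -[X in _ - X]mul1r -mulrBl mulf_eq0 subr_eq0 (negbTE chia) /=.
by move=> /eqP.
Qed.

(** The inverse Fourier transform of the indicator of [vball z N]: a character carrying the centre,
    times the normalized indicator of the dual ball. *)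
Definition packet z (N : nat) k : C :=
  chi (bracket k (- z)) * (((p ^ (4 * N))%:R)^-1 * ball_ind N k).

Lemma packet_schwartz z (N : nat) : exists M, schwartz M (packet z N).
Proof.
have sN : schwartz N (fun k => ((p ^ (4 * N))%:R : C)^-1 * ball_ind N k).
  have [lf sf] := schwartz_ball_ind N; split=> [x y /lf ->//|x].
  by rewrite mulf_eq0 negb_or => /andP[_ /sf].
by have [M _ sM] := schwartz_char (- z) sN; exists M.
Qed.

Lemma fourier_packet z (N : nat) :
  fourier mu4 (to_test (packet z N)) = test_val (ball_test R z N).
Proof.
apply/funext => x; have [M sM] := packet_schwartz z N.
rewrite /fourier (to_testK sM) ball_testE.
have c0 : ((p ^ (4 * N))%:R : C) != 0 by rewrite pnatr_eq0 expn_eq0 negb_and -lt0n prime_gt0.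
have -> : (fun k => chi (bracket k x) * packet z N k) =
    (fun k => ((p ^ (4 * N))%:R : C)^-1 * (chi (bracket k (x - z)) * ball_ind N k)).
  by apply/funext => k; rewrite /packet bracketDr padic_charD [LHS]mulrA [LHS]mulrCA.
have [M' _ sM'] := schwartz_char (x - z) (schwartz_ball_ind N).
rewrite (CintegralZ sM' (mu_fin _ _) measurableT) Cintegral_char_ball.
have -> : `[< vball z N x >] = `[< vball 0 N%:Z (x - z) >].
  by apply: asbool_equiv_eq; exact: vballB.
by case: asboolP => _; rewrite ?mulVf// mulr0.
Qed.

(** Substitute [L y] for [y]: preservation of the bracket moves [L] onto [x], at the price of the
    factor [k]. *)
Lemma fourier_mulmx (L : 'M[K]_4) (k : R) (psi : V -> C) (N : nat) : 0 <= k ->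
  schwartz N psi -> L \in unitmx ->
  (forall x y, bracket (L *m x) (L *m y) = bracket x y) ->
  (forall A : set Vb, measurable A -> mu4 [set x | A (L *m x)] = (k%:E * mu4 A)%E) ->
  forall x, Cintegral mu4 setT (fun y => chi (bracket y x) * psi (L *m y)) =
   k%:C%C * Cintegral mu4 setT (fun y => chi (bracket y (L *m x)) * psi y).
Proof.
move=> k0 spsi Lu Lb muL x; have [M _ sM] := schwartz_char (L *m x) spsi.
rewrite -(Cintegral_map sM (mu_fin _ _) measurableT (mulmx_measurable L) k0 muL).
by rewrite preimage_setT; congr (Cintegral _ _ _); apply/funext => y /=; rewrite Lb.
Qed.

Lemma schwartz_mulmx (L : 'M[K]_4) (f : V -> C) (N : nat) : L \in unitmx -> schwartz N f ->
  exists M, schwartz M (fun x => f (L *m x)).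
Proof.
move=> Lu [lf sf]; have [c cP] := mulmx_vball L; have [d dP] := mulmx_vball (invmx L).
exists (N + c + d)%N; split=> [x y xy|x fx].
  by apply: lf; apply: cP; apply: vball_mono xy; lia.
rewrite -(mulKmx Lu x) -(mulmx0 _ (invmx L)); apply: dP.
by apply: vball_mono (sf _ fx); lia.
Qed.

End Fourier.

(** * Lorentz invariance *)

Section Invariance.
Variables (R : realType) (p : nat) (p_pr : prime p).
Local Notation K := (padic p_pr).
Local Notation q := (p%:R : rat).
Local Notation V := ('cV[K]_4).
Local Notation Vb := (padic_borel p_pr 4).
Local Notation C := R[i].
Local Notation S4 := (test_fun R p_pr 4).

(** A perturbation smaller than [u] changes neither its order nor its leading digit. Sheets are thus
    relatively open in the hyperboloid. *)
Lemma padic_positive_near (u v : K) : padic_positive u ->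
  padic_norm (v - u) < padic_norm u -> padic_positive v.
Proof.
move=> [u0 [j jp uj]] vu.
have vE : padic_norm v = padic_norm u by rewrite -[v](subrK u) addrC padic_norm_eqD.
have v0 : v != 0 by rewrite -padic_norm_eq0 vE padic_norm_eq0.
have oE : padic_ord v = padic_ord u.
  move: vE; rewrite !padic_norm_neq0// => /eqP.
  rewrite eq_le !ler_qX// !lerN2 => /andP[? ?]; apply/eqP; rewrite eq_le; exact/andP.
split; first exact: v0.
exists j; first exact: jp.
have -> : padic_ac v - j%:R = (v - u) * p%:R ^ (- padic_ord u) + (padic_ac u - j%:R).
  by rewrite /padic_ac oE mulrBl addrA subrK.
apply: padic_normD_lt => //; rewrite padic_normM padic_norm_expz opprK.
rewrite -(ltr_pM2r (qX_gt0 p_pr (- padic_ord u))) -mulrA -expfzDr ?q_neq0// subrr expr0z.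
by rewrite mulr1 mul1r -padic_norm_neq0.
Qed.

Lemma sheet_measurable (m : K) s : measurable (sheet m s : set Vb).
Proof.
rewrite (_ : sheet m s = hyperboloid m `&` [set k | padic_positive ((-1) ^+ s * k 0 0)])//.
apply: measurableI; first exact: hyperboloid_measurable.
apply: open_measurable_padic; rewrite openE => x xs; have [x0 _] := xs.
have x0' : 0 < padic_norm ((-1) ^+ s * x 0 0).
  by rewrite lt_neqAle padic_norm_ge0 andbT eq_sym padic_norm_eq0.
have [M Mx] := qX_small p_pr x0'.
apply: filterS (near_vball x M%:Z) => y xy; apply: padic_positive_near xs _.
rewrite -mulrBr padic_normM.
have sgn1 (t : bool) : padic_norm ((-1) ^+ t : K) = 1.
  by case: t; rewrite ?expr0 ?expr1 ?padic_normN padic_norm1.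
by rewrite sgn1 mul1r (le_lt_trans (xy 0)).
Qed.

Variables (p_odd : p <> 2%N) (m : K) (m_neq0 : m <> 0)
  (mu3 : {measure set (padic_borel p_pr 3) -> \bar R})
  (mu4 lam : {measure set Vb -> \bar R})
  (haar3 : normalized_haar mu3) (haar4 : normalized_haar mu4)
  (lamP : gelfand_leray mu3 m lam).

Lemma gelfand_leray_fin (N : nat) : (lam (vball 0 (- N%:Z)) < +oo)%E.
Proof.
have M0m : - (`|padic_ord m|%N.+1)%:Z < - padic_ord m by lia.
have [n nP] := gelfand_leray_shell p_odd m_neq0 haar3 haar4 lamP M0m.
rewrite nP; last by apply: unif_vball; lia.
apply: (@le_lt_trans _ _ (((p%:R : R) ^+ n)%:E * mu4 (vball 0 (- N%:Z)))%E).
  rewrite lee_wpmul2l ?lee_fin ?exprn_ge0//; apply: le_measure; rewrite ?inE//.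
  - by apply: measurableI; [exact: vball_measurable|exact: shell_measurable].
  - exact: vball_measurable.
by rewrite (normalized_haar_vball haar4) -EFinM ltry.
Qed.

Lemma to_test_val (phi : S4) : to_test (test_val phi) = phi.
Proof. by have [N sN] := test_schwartz phi; apply: val_inj; exact: (to_testK sN). Qed.

Lemma act_testE (L : 'M[K]_4) (phi : S4) : L \in unitmx ->
  test_val (act_test (invmx L) phi) = fun x => test_val phi (L *m x).
Proof.
move=> Lu; have [N sN] := test_schwartz phi; have [M sM] := schwartz_mulmx Lu sN.
by rewrite /act_test invmxK (to_testK sM).
Qed.

Lemma act_dist_linear (L : 'M[K]_4) (T : S4 -> C^o) : L \in unitmx -> linear T ->
  linear (act_dist L T).
Proof.
move=> Lu lT c u v; rewrite /act_dist -lT; congr (T _); apply: val_inj.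
by apply/funext => x; rewrite -[LHS]/(test_val _ x) -[RHS]/(c * test_val _ x + test_val _ x) !act_testE.
Qed.

Lemma sheet_preimage (L : 'M[K]_4) s : L \in unitmx ->
  [set L *m k | k in sheet m s] = sheet m s -> [set x | sheet m s (L *m x)] = sheet m s.
Proof.
move=> Lu LS; apply/seteqP; split=> x /=.
  rewrite -{1}LS => -[k ks kx].
  by rewrite -(mulKmx Lu x) -kx mulKmx.
by move=> xs; rewrite -LS; exists x.
Qed.

Lemma delta_sheet_mulmx (L : 'M[K]_4) (k : R) s (psi : S4) : 0 < k -> L \in unitmx ->
  (forall A : set Vb, measurable A -> lam [set x | A (L *m x)] = (k%:E * lam A)%E) ->
  [set L *m k | k in sheet m s] = sheet m s ->
  delta_sheet lam m s (act_test (invmx L) psi) = k%:C%C * delta_sheet lam m s psi.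
Proof.
move=> k0 Lu lamL LS; rewrite /delta_sheet act_testE//.
have [N sN] := test_schwartz psi.
have := Cintegral_map sN (gelfand_leray_fin N) (sheet_measurable m s) (mulmx_measurable L) (ltW k0) lamL.
have -> : (fun x : Vb => L *m x : Vb) @^-1` sheet m s = sheet m s by exact: sheet_preimage.
exact.
Qed.

(* The factor [k] by which [L] scales [mu4] also scales [lam]; it enters both the Fourier
   transform and the integrals over the sheets, and cancels. *)
Lemma lorentz_invariant (a b : C) (T : S4 -> C^o) (T_linear : linear T)
  (FT : fourier_dist mu4 T =
        fun phi => a * delta_sheet lam m false phi + b * delta_sheet lam m true phi)
  (G : set 'M[K]_4) : sheet_preserving_subgroup m G -> invariant_under G T.
Proof.
move=> [_ GSO GS] L GL; have [Lu LB _] := GSO L GL.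
apply: linear_test_ext => //; first exact: act_dist_linear.
move=> z N; have [k k0 muL] := haar_mulmx haar4 Lu.
have LQ x : Qform (L *m x) = Qform x by exact: LB.
have lamL := gelfand_leray_mulmx p_odd m_neq0 haar3 haar4 lamP k0 LQ muL.
have [M sM] := packet_schwartz R z N; set psi := to_test (packet R z N).
have TE : T (ball_test R z N) = a * delta_sheet lam m false psi + b * delta_sheet lam m true psi.
  by rewrite -[RHS]/((fun phi => a * delta_sheet lam m false phi + b * delta_sheet lam m true phi) psi)
    -FT /fourier_dist fourier_packet// to_test_val.
have kC : k%:C%C != 0 :> C by rewrite eq_complex /= negb_and gt_eqF.
apply: (mulfI kC); rewrite /act_dist.
(* The transform of [psi] composed with [L] is [k] times the ball indicator composed with [L]; this
   expresses the action on [T] through its Fourier transform. *)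
have H : to_test (fourier mu4 (act_test (invmx L) psi)) = k%:C%C *: act_test (invmx L) (ball_test R z N).
  rewrite -[RHS]to_test_val; congr to_test; apply/funext => x.
  rewrite -[RHS]/(k%:C%C * test_val (act_test (invmx L) (ball_test R z N)) x) act_testE//.
  rewrite -(fourier_packet haar4) /fourier act_testE// (to_testK sM).
  exact: (fourier_mulmx haar4 (ltW k0) sM Lu LB muL).
have T0 : T 0 = 0 by have := T_linear (-1) 0 0; rewrite scaler0 addr0 scaleN1r addNr.
have -> : k%:C%C * T (act_test (invmx L) (ball_test R z N)) = fourier_dist mu4 T (act_test (invmx L) psi).
  rewrite /fourier_dist H; have := T_linear k%:C%C (act_test (invmx L) (ball_test R z N)) 0.
  by rewrite addr0 T0 addr0.
rewrite FT TE !(delta_sheet_mulmx _ k0 Lu lamL)//; [|exact: GS..].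
by rewrite mulrDr; congr (_ + _); rewrite mulrCA.
Qed.

End Invariance.

(** * The weak equation *)

Section ComplexNorm.
Variable R : realType.
Local Notation C := R[i].

Lemma complex_norm_le (z : C) (r : R) :
  `|complex.Re z| <= r -> `|complex.Im z| <= r -> `|z| <= (r *+ 2)%:C%C.
Proof.
move=> ur vr; rewrite [z]complexE.
rewrite (le_trans (ler_normD _ _))// normrM.
have -> : `|'i%C : C| = 1 by rewrite normc_def /= expr0n expr1n add0r sqrtr1.
by rewrite mul1r !normc_def /= !expr0n /= !addr0 !sqrtr_sqr -rmorphD lecR mulr2n lerD.
Qed.

End ComplexNorm.

Section WeakSolution.
Variables (R : realType) (p : nat) (p_pr : prime p).
Local Notation K := (padic p_pr).
Local Notation q := (p%:R : rat).
Local Notation V := ('cV[K]_4).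
Local Notation Vb := (padic_borel p_pr 4).
Local Notation C := R[i].
Local Notation S4 := (test_fun R p_pr 4).

(** Read off the definition as a supremum over simple functions, so it also covers integrands whose
    measurability has not been established. *)
Lemma ge0_le_integralT d (T : measurableType d) (mu : {measure set T -> \bar R})
    (f g : T -> \bar R) : (forall x, 0 <= f x)%E -> (forall x, f x <= g x)%E ->
  (\int[mu]_x f x <= \int[mu]_x g x)%E.
Proof.
move=> f0 fg; have g0 x : (0 <= g x)%E := le_trans (f0 x) (fg x).
rewrite !ge0_integralTE//; apply: le_ereal_sup => _ [h hf <-].
by exists h => // x; exact: le_trans (hf x) (fg x).
Qed.

Lemma delta_jE (x y : V) (j : nat) : delta_j R j (x - y) =
  ((p ^ (4 * j))%:R * (if `[< vball x j y >] then 1 else 0))%:C%C.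
Proof.
have -> : `[< vball x j y >] = (p%:R ^+ j * vnorm (x - y) <= 1 :> rat).
  rewrite -ler_pdivlMl ?exprn_gt0 ?q_gt0// mulr1 exprnN.
  apply/asboolP/idP => [/vball_sym|] H.
    exact: (vball0_vnorm _ _).1 ((vballB _ _ _).1 H).
  exact: vball_sym ((vballB _ _ _).2 ((vball0_vnorm _ _).2 H)).
by rewrite /delta_j; case: ifP => _; rewrite ?mulr1 ?mulr0 ?rmorph0 ?rmorph_nat.
Qed.

Lemma delta_j_schwartz (x : V) (j : nat) :
  exists M, schwartz M (fun y => delta_j R j (x - y)).
Proof.
have E y : delta_j R j (x - y) = (p ^ (4 * j))%:R * test_val (ball_test R x j) y.
  rewrite ball_testE delta_jE.
  by case: asboolP => _; rewrite ?mulr1 ?mulr0 ?rmorph0 ?rmorph_nat.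
have [M [lf sf]] := test_schwartz (ball_test R x j).
exists M; split=> [y z yz|y]; first by rewrite !E (lf _ _ yz).
by rewrite E mulf_eq0 negb_or => /andP[_ /sf].
Qed.

Variables (m : K) (mu4 : {measure set Vb -> \bar R}) (haar4 : normalized_haar mu4)
  (alpha : R) (alpha_gt0 : 0 < alpha).

(** The regularization is the mean of [|Q - m^2|^alpha] over the ball of radius [p^-j] around [x].
    As [Q x = m^2] and the coordinates are at most [p^k], there [|Q - m^2| <= p^(k - j)]. *)
Lemma conv_delta_le (k j : nat) (x : V) : hyperboloid m x -> vball 0 (- k%:Z) x ->
  exists2 c : R, 0 <= c <= ((p%:R : R) ^ (k%:Z - j%:Z)) `^ alpha &
    conv_delta (box_symbol mu4 alpha m) j x = c%:C%C.
Proof.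
move=> xm xk; have [M sM] := delta_j_schwartz x j.
rewrite /conv_delta /box_symbol /regular_dist (to_testK sM).
pose g (y : V) : R := ratr (padic_norm (bracket y y - m ^+ 2)) `^ alpha.
pose e : R := ((p%:R : R) ^ (k%:Z - j%:Z)) `^ alpha.
pose ind (y : V) : R := if `[< vball x j y >] then 1 else 0.
have ind0 y : 0 <= ind y by rewrite /ind; case: ifP.
have pj0 : 0 <= (p ^ (4 * j))%:R :> R by [].
have prodE y : (g y)%:C%C * delta_j R j (x - y) = (g y * ((p ^ (4 * j))%:R * ind y))%:C%C.
  by rewrite delta_jE -rmorphM.
have gle y : g y * ((p ^ (4 * j))%:R * ind y) <= e * (p ^ (4 * j))%:R * ind y.
  rewrite -mulrA /ind; case: asboolP => [xy|_]; last by rewrite !mulr0.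
  rewrite !mulr1 ler_wpM2r// /g /e; apply: ge0_ler_powR.
  - exact: ltW.
  - by rewrite nnegrE ler0q padic_norm_ge0.
  - by rewrite nnegrE exprz_ge0.
  have -> : (p%:R : R) ^ (k%:Z - j%:Z) = ratr (q ^ (k%:Z - j%:Z)).
    by rewrite fmorphXz /= rmorph_nat.
  rewrite ler_rat -xm.
  have yk : vball 0 (- k%:Z) y.
    by apply: vball_trans xk (vball_mono _ xy); lia.
  move: xk yk => /vball0P xk /vball0P yk.
  apply: le_trans (Qform_dist yk xk xy) _.
  by rewrite opprK -expfzDr ?q_neq0// ler_qX//; lia.
have g0 y : 0 <= g y * ((p ^ (4 * j))%:R * ind y).
  by rewrite mulr_ge0 ?powR_ge0// mulr_ge0.
have int_le : (\int[mu4]_y (g y * ((p ^ (4 * j))%:R * ind y))%:E <= e%:E)%E.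
  apply: le_trans (ge0_le_integralT mu4 (g := fun y => (e * (p ^ (4 * j))%:R * ind y)%:E) _ _) _.
  - by move=> y; rewrite lee_fin.
  - by move=> y; rewrite lee_fin.
  have -> : (fun y : Vb => (e * (p ^ (4 * j))%:R * ind y)%:E) =
      ((cst (e * (p ^ (4 * j))%:R)%:E) \_ (vball x j : set Vb)).
    apply/funext => y; rewrite patchE /ind -[y \in _]/(`[< vball x j y >]).
    by case: asboolP; rewrite ?mulr1 ?mulr0.
  rewrite -integral_mkcond integral_cst; last exact: vball_measurable.
  rewrite (normalized_haar_vball haar4) -EFinM lee_fin -mulrA natrX exprnP -expfzDr; last first.
    by rewrite pnatr_eq0 -lt0n prime_gt0.
  by rewrite subrr expr0z mulr1.
exists (fine (\int[mu4]_y (g y * ((p ^ (4 * j))%:R * ind y))%:E)).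
  have i0 : (0 <= \int[mu4]_y (g y * ((p ^ (4 * j))%:R * ind y))%:E)%E.
    by apply: integral_ge0 => y _; rewrite lee_fin.
  rewrite fine_ge0//= -lee_fin fineK//.
  by rewrite ge0_fin_numE// (le_lt_trans int_le)// ltry.
have -> : (fun y => (g y)%:C%C * delta_j R j (x - y)) =
    fun y => (g y * ((p ^ (4 * j))%:R * ind y))%:C%C by apply/funext.
by rewrite /Cintegral /= /Rintegral integral0 /=.
Qed.

(** A geometric sequence of ratio [p^-alpha], which is below 1 because [alpha > 0]. *)
Lemma powR_shift_cvg0 (k : nat) :
  (fun j : nat => ((p%:R : R) ^ (k%:Z - j%:Z)) `^ alpha) @ \oo --> (0 : R).
Proof.
have p0 : 0 < p%:R :> R by rewrite ltr0n prime_gt0.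
pose x : R := p%:R `^ (- alpha).
have -> : (fun j : nat => ((p%:R : R) ^ (k%:Z - j%:Z)) `^ alpha) =
    (fun j => (p%:R `^ (k%:R * alpha)) * x ^+ j).
  apply/funext => j; rewrite -powR_intmul ?ltW// -powRrM /x -powR_mulrn ?powR_ge0//.
  rewrite -powRrM -powRD; last by rewrite (gt_eqF p0) implybT.
  congr (_ `^ _); rewrite rmorphB /=.
  by rewrite mulrBl mulNr [j%:~R * _]mulrC.
have x1 : `|x| < 1.
  rewrite ger0_norm ?powR_ge0// /x powRN invf_lt1 ?powR_gt0//.
  have := @gt0_ltr_powR R alpha alpha_gt0 1 p%:R.
  by rewrite powR1 !nnegrE ler01 ler0n ltr1n prime_gt1//; apply.
by have := cvgM (cvg_cst (p%:R `^ (k%:R * alpha) : R)) (cvg_expr x1); rewrite mulr0; apply.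
Qed.

Variables (p_odd : p <> 2%N) (m_neq0 : m <> 0)
  (mu3 : {measure set (padic_borel p_pr 3) -> \bar R})
  (lam : {measure set Vb -> \bar R})
  (haar3 : normalized_haar mu3) (lamP : gelfand_leray mu3 m lam).

(* [to_test F] is either [F] or [0], so the bound needs no check that the regularized
   product is a test function. *)
Lemma delta_sheet_conv_le (phi : S4) (s : bool) : exists (k : nat) (B : R), forall j : nat,
  `|delta_sheet lam m s (to_test (fun x =>
      conv_delta (box_symbol mu4 alpha m) j x * test_val phi x))| <=
   (((p%:R : R) ^ (k%:Z - j%:Z)) `^ alpha * B)%:C%C.
Proof.
have [k sk] := test_schwartz phi; exists k.
have fin := gelfand_leray_fin p_odd m_neq0 haar3 haar4 lamP.
have mS := sheet_measurable m s.
pose I (g : C -> R) := Rintegral lam (sheet m s) (fun x => `|g (test_val phi x)|).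
have I0 g : 0 <= I g by apply: Rintegral_ge0.
exists ((I (@complex.Re R) + I (@complex.Im R)) *+ 2) => j.
set F := to_test _; set e := _ `^ alpha; have e0 : 0 <= e by exact: powR_ge0.
have [N sN] := test_schwartz F.
have Fle (g : C -> R) x : g 0 = 0 -> (forall (c : R) z, g (c%:C%C * z) = c * g z) ->
    sheet m s x -> `|g (test_val F x)| <= e * `|g (test_val phi x)|.
  move=> g0 gZ [xm _].
  have [F0|FE] : test_val F x = 0 \/ test_val F x =
      conv_delta (box_symbol mu4 alpha m) j x * test_val phi x.
    rewrite /F /to_test /test_val val_insubd; case: ifP => _; [by right|by left].
  - by rewrite F0 g0 normr0 mulr_ge0.
  have [xk|nx] := pselect (vball 0 (- k%:Z) x); last first.
    by rewrite FE (schwartz_out sk nx) mulr0 g0 normr0 mulr_ge0.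
  have [c /andP[c0 ce] cE] := conv_delta_le j xm xk.
  by rewrite FE cE gZ normrM ger0_norm// ler_wpM2r.
have intle g : g 0 = 0 -> (forall (c : R) z, g (c%:C%C * z) = c * g z) ->
    `|Rintegral lam (sheet m s) (fun x => g (test_val F x))| <= e * I g.
  move=> g0 gZ; have iF := schwartz_integrable g0 sN (fin N) mS.
  have n0 : `|g 0| = 0 by rewrite g0 normr0.
  have iF' := schwartz_integrable (g := fun z => `|g z|) n0 sN (fin N) mS.
  have iphi := schwartz_integrable (g := fun z => `|g z|) n0 sk (fin k) mS.
  apply: le_trans (le_normr_Rintegral mS iF) _.
  rewrite /I -RintegralZl//; apply: le_Rintegral => //.
    by apply: (schwartz_integrable (g := fun z => e * `|g z|) _ sk (fin k) mS); rewrite n0 mulr0.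
  by move=> x xs; exact: Fle.
rewrite /delta_sheet /Cintegral mulrnAr; apply: complex_norm_le => /=.
  apply: le_trans (intle (@complex.Re R) _ _) _ => //.
    by move=> c [u v] /=; rewrite mul0r subr0.
  by rewrite ler_wpM2l// lerDl.
apply: le_trans (intle (@complex.Im R) _ _) _ => //.
  by move=> c [u v] /=; rewrite mul0r addr0.
by rewrite ler_wpM2l// lerDr.
Qed.

Lemma dist_product_delta_sheets (a b : C) :
  dist_product (box_symbol mu4 alpha m)
    (fun phi => a * delta_sheet lam m false phi + b * delta_sheet lam m true phi : C^o)
    (fun=> 0).
Proof.
move=> phi; have [k1 [B1 H1]] := delta_sheet_conv_le phi false.
have [k2 [B2 H2]] := delta_sheet_conv_le phi true.
pose e (k j : nat) : R := ((p%:R : R) ^ (k%:Z - j%:Z)) `^ alpha.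
(* The modulus takes values in [R[i]]; passing to real parts lets the limit be taken on the real
   sequence [u]. *)
have norm_real (c : C) : `|c| = (complex.Re `|c|)%:C%C by rewrite normc_def.
set A := complex.Re `|a|; set B := complex.Re `|b|.
have A0 : 0 <= A by rewrite -lecR -norm_real; exact: normr_ge0.
have B0 : 0 <= B by rewrite -lecR -norm_real; exact: normr_ge0.
pose u (j : nat) : R := A * (e k1 j * B1) + B * (e k2 j * B2).
have u0 : u @ \oo --> (0 : R).
  have E k c D : (fun j : nat => c * (e k j * D)) @ \oo --> (0 : R).
    have -> : (fun j : nat => c * (e k j * D)) = (fun j => (c * D) * e k j).
      by apply/funext => j; rewrite mulrA mulrAC.
    by have := cvgM (cvg_cst (c * D : R)) (powR_shift_cvg0 k); rewrite mulr0; apply.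
  by have := cvgD (E k1 A B1) (E k2 B B2); rewrite addr0; apply.
apply/cvgr0Pnorm_lt => eps eps0.
have epsE : eps = (complex.Re eps)%:C%C by rewrite -[LHS](gtr0_norm eps0) norm_real gtr0_norm.
have re0 : 0 < complex.Re eps by rewrite -ltcR -epsE.
have /cvgr0Pnorm_lt /(_ _ re0) := u0; apply: filterS => j uj.
have := H2 j; have := H1 j.
move: (delta_sheet lam m false _) (delta_sheet lam m true _) => d1 d2 h1 h2.
apply: le_lt_trans (ler_normD (a * d1) (b * d2)) _; rewrite epsE (normrM a) (normrM b).
apply: (@le_lt_trans _ _ (u j)%:C%C).
  rewrite rmorphD (rmorphM _ A) (rmorphM _ B) /= -!norm_real.
  by apply: lerD; apply: ler_wpM2l => //; exact: normr_ge0.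
by rewrite ltcR (le_lt_trans (ler_norm _)).
Qed.

End WeakSolution.

Theorem proposition2 (R : realType) (p : nat) (p_pr : prime p) (p_odd : p <> 2%N)
  (alpha : R) (alpha_gt0 : 0 < alpha)
  (m : padic p_pr) (m_neq0 : m <> 0) (a b : R[i])
  (mu3 : {measure set (padic_borel p_pr 3) -> \bar R})
  (mu4 : {measure set (padic_borel p_pr 4) -> \bar R})
  (lam : {measure set (padic_borel p_pr 4) -> \bar R})
  (haar3 : normalized_haar mu3) (haar4 : normalized_haar mu4)
  (lamP : gelfand_leray mu3 m lam)
  (T : test_fun R p_pr 4 -> R[i]^o) (T_linear : linear T)
  (FT : fourier_dist mu4 T =
        fun phi => a * delta_sheet lam m false phi + b * delta_sheet lam m true phi) :
  weak_solution mu4 alpha m T 0 /\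
  (forall G : set 'M[padic p_pr]_4, restricted_lorentz_group m G ->
     invariant_under G T).
Proof.
have FT0 : dist_product (box_symbol mu4 alpha m) (fourier_dist mu4 T) (fun=> 0).
  by rewrite FT; exact: (dist_product_delta_sheets haar4 alpha_gt0 p_odd m_neq0 haar3 lamP a b).
have lin0 : linear (0 : test_fun R p_pr 4 -> R[i]^o).
  by move=> c u v; rewrite [RHS]addr0 [RHS]mulr0.
split; last first.
  by move=> G [GS _]; exact: (lorentz_invariant p_odd m_neq0 haar3 haar4 lamP T_linear FT GS).
split; first by split=> //; exists (fun=> 0).
by split=> //; exists (fun=> 0).
Qed.
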